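(* Let (A) denote the statement: there exist $\delta>0$ and $T_0\in\mathbb{R}$ such that, for every $\sigma\in[1/2-\delta,1/2+\delta]$, the function $$t\longmapsto \operatorname{Re}\frac{\Xi'(\sigma+it)}{\Xi(\sigma+it)}$$ is strictly concave for all $|t|\ge T_0$ wherever it is defined. Then the following assertion is false: (A) holds, and (A) is equivalent to the Riemann Hypothesis.
   Context: Here $\Xi$ denotes the completed Riemann zeta function $$\Xi(s)=\xi(s)=\tfrac12 s(s-1)\pi^{-s/2}\Gamma(s/2)\zeta(s),$$ extended to an entire function of $s\in\mathbb{C}$ (the notation $\Xi$ is used for $\xi$ itself, as a function of $s$). Its zeros are the nontrivial zeros of $\zeta$. The function in (A) is defined at those $t$ with $\Xi(\sigma+it)\ne0$; ''strictly concave for all $|t|\ge T_0$ wherever it is defined'' means strictly concave on every interval contained in $\{t\in\mathbb{R}:|t|\ge T_0\}$ on which it is defined. The Riemann Hypothesis is the statement that all zeros of $\Xi$ have real part $1/2$. *)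

(* Defs.v *)
From Stdlib Require Import Reals.
From Coquelicot Require Import Coquelicot.

Open Scope R_scope.

Definition Cexp (z : C) : C :=
  (exp (Re z) * cos (Im z), exp (Re z) * sin (Im z)).

(* [Rcpower x s] is x ^ s for x > 0; for x <= 0 the value is meaningless. *)
Definition Rcpower (x : R) (s : C) : C := Cexp (s * RtoC (ln x))%C.

(* Euler's integral; it converges for Re s > 0, and only such s are used. *)
Definition Gamma (s : C) : C :=
  RInt_gen (V := C_R_CompleteNormedModule)
    (fun x : R => (Rcpower x (s - 1) * RtoC (exp (- x)))%C)
    (at_right 0) (Rbar_locally p_infty).

(* The Dirichlet series sum_{n >= 1} n ^ (-s), summed componentwise; it
   converges for Re s > 1, and only such s are used. *)
Definition zeta (s : C) : C :=
  (Series (fun n : nat => Re (Rcpower (INR (S n)) (- s))),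
   Series (fun n : nat => Im (Rcpower (INR (S n)) (- s)))).

(* Complex differentiability: [ex_derive] is taken over the field C. *)
Definition entire (f : C -> C) : Prop :=
  forall z : C, ex_derive (K := C_AbsRing) (V := C_NormedModule) f z.

(* The entire extension of s (s - 1) pi^(-s/2) Gamma(s/2) zeta(s) / 2 from the
   half-plane Re s > 1, where the integral and the series both converge. By
   the identity theorem at most one function satisfies this predicate. *)
Definition is_completed_zeta (Xi : C -> C) : Prop :=
  entire Xi /\
  forall s : C, 1 < Re s ->
    Xi s = (RtoC (1 / 2) * s * (s - 1) * Rcpower PI (- s / 2)
            * Gamma (s / 2) * zeta s)%C.

(* [(sigma, t) : C] is sigma + i t. Where Xi vanishes the library's total
   division gives a junk value, and such t are excluded in [concavity_A].
   [C_derive Xi z] is the complex derivative wherever Xi is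
   complex-differentiable (see [C_derive_correct]). *)
Definition re_log_deriv (Xi : C -> C) (sigma t : R) : R :=
  Re (C_derive Xi (sigma, t) / Xi (sigma, t))%C.

Definition is_interval (I : R -> Prop) : Prop :=
  forall x y z : R, I x -> I z -> x <= y <= z -> I y.

Definition strictly_concave_on (I : R -> Prop) (f : R -> R) : Prop :=
  forall x y l : R, I x -> I y -> x <> y -> 0 < l < 1 ->
    l * f x + (1 - l) * f y < f (l * x + (1 - l) * y).

Definition concavity_A (Xi : C -> C) : Prop :=
  exists delta T0 : R, 0 < delta /\
    forall sigma : R, 1 / 2 - delta <= sigma <= 1 / 2 + delta ->
      forall I : R -> Prop, is_interval I ->
        (forall t : R, I t -> T0 <= Rabs t /\ Xi (sigma, t) <> RtoC 0) ->
        strictly_concave_on I (re_log_deriv Xi sigma).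

Definition Riemann_hypothesis (Xi : C -> C) : Prop :=
  forall s : C, Xi s = RtoC 0 -> Re s = 1 / 2.

(* Main.v *)
Require Import Defs.
From Stdlib Require Import Reals ZArith Lra Lia Psatz Classical.
From Coquelicot Require Import Coquelicot.

(* Assertion (A) fails already at sigma = 1/2. There Xi is real, so the vertical
   derivative i Xi' is real as well, Re (Xi'/Xi) vanishes identically, and a
   constant is not strictly concave. The Riemann Hypothesis is used only to
   exclude that Xi vanishes on a vertical segment: that would force zeros to
   the left of the critical line.

   Xi is given by a formula on Re s > 1 only, so its reality on the critical
   line is the functional equation. The theta transformation is obtained by
   Polya's argument: summing (2 cos (pi k / l))^(2m) over k < l gives l times
   the sum of the binomial coefficients C(2m, m + j l), and l tends to infinity
   with m ~ y l^2; the constant is found by putting x = 1 in the resulting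
   transformation. The Mellin transform then gives the symmetric formula for Xi
   on Re s >= 2, and both sides are entire. They agree on Re s = 1/2 by Cauchy's
   theorem for rectangles with a Gaussian kernel. *)

(** Assuming the refuted conjunction makes (A) and the Riemann Hypothesis available together, and
    they clash. The only form of the identity theorem in use concerns vertical lines; it serves
    twice, to carry the formula for Xi from Re s = 2 to Re s = 1/2 and to move a hypothetical
    segment of zeros off the critical line. In Polya's argument l is odd, so that k and l - k pair
    up without a middle term and every angle pi k / l left lies in [0, pi/2], where even powers of
    the cosine have a Gaussian majorant. The central binomial coefficient enters through a monotone
    sequence whose limit stays an unknown constant until x = 1 fixes it. Mellin integrals are
    written in v = ln x throughout: powers become exponentials, dilations translations, and x -> 1/x
    the reflection v -> -v. An integral over (0, oo) is then a pair of half-line integrals with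
    exponentially decaying integrands, and every exchange of limits reduces to such a majorant. *)

(** * Complex differentiability and complex-valued integrals *)

Notation is_Cderive f z l :=
  (is_derive (K := C_AbsRing) (V := C_NormedModule) f z l).
Notation CInt f a b := (RInt (V := C_R_CompleteNormedModule) f a b).
Notation is_CInt f a b l := (is_RInt (V := C_R_CompleteNormedModule) f a b l).

Lemma is_Cderive_eps (f : C -> C) (z l : C) :
  is_Cderive f z l <->
  forall eps : R, 0 < eps -> exists d : R, 0 < d /\
    forall h : C, Cmod h < d ->
      Cmod (f (z + h) - f z - h * l)%C <= eps * Cmod h.
Proof.
split.
- intros [_ Hd] eps Heps.
  destruct (Hd z (fun P H => H) (mkposreal eps Heps)) as [d Hd'].
  exists d; split; [apply cond_pos|]. intros h Hh.
  assert (E : (z + h - z)%C = h) by ring.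
  specialize (Hd' (z + h)%C). simpl in Hd'.
  change (Cmod (z + h - z)%C < d ->
    Cmod (f (z + h)%C - f z - ((z + h - z) * l))%C <= eps * Cmod (z + h - z)%C) in Hd'.
  rewrite E in Hd'. now apply Hd'.
- intros H. split.
  + apply is_linear_scal_l.
  + intros x Hx.
    assert (Ex : z = x).
    { apply (is_filter_lim_locally_unique (K := C_AbsRing) (V := AbsRing_NormedModule C_AbsRing)); exact Hx. }
    subst x. intros eps. destruct (H eps (cond_pos eps)) as [d [Hd0 Hd]].
    exists (mkposreal d Hd0). intros y Hy.
    change (Cmod (y - z)%C < d) in Hy.
    change (Cmod (f y - f z - ((y - z) * l))%C <= eps * Cmod (y - z)%C).
    specialize (Hd (y - z)%C Hy).
    replace (z + (y - z))%C with (y : C) in Hd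
      by (simpl in y; apply injective_projections; simpl; ring).
    exact Hd.
Qed.

Definition Ccont (f : C -> C) (z : C) : Prop :=
  forall eps : R, 0 < eps -> exists d : R, 0 < d /\
    forall w : C, Cmod (w - z)%C < d -> Cmod (f w - f z)%C < eps.

Lemma is_Cderive_cont (f : C -> C) (z l : C) : is_Cderive f z l -> Ccont f z.
Proof.
intros H eps Heps. rewrite is_Cderive_eps in H.
destruct (H 1 Rlt_0_1) as [d [Hd Hf]].
assert (Hl := Cmod_ge_0 l).
exists (Rmin d (eps / (2 + Cmod l))). split.
{ apply Rmin_glb_lt; auto. apply Rdiv_lt_0_compat; lra. }
intros w Hw. specialize (Hf (w - z)%C (Rlt_le_trans _ _ _ Hw (Rmin_l _ _))).
replace (z + (w - z))%C with w in Hf by ring.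
assert (Hw' := Rlt_le_trans _ _ _ Hw (Rmin_r _ _)).
apply Rlt_div_r in Hw'; [|lra].
replace (f w - f z)%C with ((f w - f z - (w - z) * l) + (w - z) * l)%C by ring.
eapply Rle_lt_trans; [apply Cmod_triangle|]. rewrite Cmod_mult.
assert (Hn := Cmod_ge_0 (w - z)%C). nra.
Qed.

Lemma continuous_C_eps (g : R -> C) (x : R) :
  (forall eps : R, 0 < eps -> exists d : R, 0 < d /\
    forall y : R, Rabs (y - x) < d -> Cmod (g y - g x)%C < eps) ->
  continuous (U := C_R_CompleteNormedModule) g x.
Proof.
intros H. apply filterlim_locally. intros eps.
destruct (H eps (cond_pos eps)) as [d [Hd Hg]].
exists (mkposreal d Hd). intros y Hy.
apply C_NormedModule_mixin_compat1. apply Hg. exact Hy.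
Qed.

Lemma Cmod_pair (x y : R) : Cmod (x, y) <= Rabs x + Rabs y.
Proof.
replace ((x, y) : C) with (RtoC x + Ci * RtoC y)%C.
- eapply Rle_trans; [apply Cmod_triangle|].
  rewrite Cmod_mult, Cmod_Ci, !Cmod_R. lra.
- unfold Ci, RtoC, Cplus, Cmult; simpl. f_equal; ring.
Qed.

Lemma Ccont_hor (f : C -> C) (x c : R) : Ccont f (x, c) ->
  continuous (U := C_R_CompleteNormedModule) (fun t => f (t, c)) x.
Proof.
intros H. apply continuous_C_eps. intros eps Heps.
destruct (H eps Heps) as [d [Hd Hf]]. exists d; split; auto.
intros y Hy. apply Hf. change (Cmod ((y, c) - (x, c))%C < d).
replace ((y, c) - (x, c))%C with (RtoC (y - x)).
- now rewrite Cmod_R.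
- unfold Cminus, Cplus, Copp, RtoC; simpl; f_equal; ring.
Qed.

Lemma Ccont_ver (f : C -> C) (x c : R) : Ccont f (c, x) ->
  continuous (U := C_R_CompleteNormedModule) (fun t => f (c, t)) x.
Proof.
intros H. apply continuous_C_eps. intros eps Heps.
destruct (H eps Heps) as [d [Hd Hf]]. exists d; split; auto.
intros y Hy. apply Hf. change (Cmod ((c, y) - (c, x))%C < d).
replace ((c, y) - (c, x))%C with (Ci * RtoC (y - x))%C.
- now rewrite Cmod_mult, Cmod_Ci, Cmod_R, Rmult_1_l.
- unfold Cminus, Cplus, Cmult, Copp, Ci, RtoC; simpl; f_equal; ring.
Qed.

Lemma is_CInt_pair (f : R -> C) (a b lu lv : R) :
  is_RInt (fun t => Re (f t)) a b lu -> is_RInt (fun t => Im (f t)) a b lv ->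
  is_CInt f a b (lu, lv).
Proof. intros. now apply (is_RInt_fct_extend_pair (U := R_NormedModule) (V := R_NormedModule)). Qed.

Lemma is_CInt_Re (f : R -> C) (a b : R) (l : C) :
  is_CInt f a b l -> is_RInt (fun t => Re (f t)) a b (Re l).
Proof. intros H. exact (is_RInt_fct_extend_fst (U := R_NormedModule) (V := R_NormedModule) _ _ _ _ H). Qed.

Lemma is_CInt_Im (f : R -> C) (a b : R) (l : C) :
  is_CInt f a b l -> is_RInt (fun t => Im (f t)) a b (Im l).
Proof. intros H. exact (is_RInt_fct_extend_snd (U := R_NormedModule) (V := R_NormedModule) _ _ _ _ H). Qed.

Lemma is_CInt_scal (f : R -> C) (a b : R) (c l : C) :
  is_CInt f a b l -> is_CInt (fun t => c * f t)%C a b (c * l)%C.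
Proof.
intros H. apply is_CInt_pair; simpl.
- apply (is_RInt_minus (V := R_NormedModule));
    apply (is_RInt_scal (V := R_NormedModule));
    [apply (is_CInt_Re _ _ _ _ H)|apply (is_CInt_Im _ _ _ _ H)].
- apply (is_RInt_plus (V := R_NormedModule));
    apply (is_RInt_scal (V := R_NormedModule));
    [apply (is_CInt_Im _ _ _ _ H)|apply (is_CInt_Re _ _ _ _ H)].
Qed.

Lemma is_CInt_plus (f g : R -> C) (a b : R) (l m : C) :
  is_CInt f a b l -> is_CInt g a b m ->
  is_CInt (fun t => f t + g t)%C a b (l + m)%C.
Proof. intros; now apply (is_RInt_plus (V := C_R_CompleteNormedModule)). Qed.

Lemma is_CInt_minus (f g : R -> C) (a b : R) (l m : C) :
  is_CInt f a b l -> is_CInt g a b m ->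
  is_CInt (fun t => f t - g t)%C a b (l - m)%C.
Proof. intros; now apply (is_RInt_minus (V := C_R_CompleteNormedModule)). Qed.

Lemma is_CInt_Chasles (f : R -> C) (a b c : R) (l m : C) :
  is_CInt f a b l -> is_CInt f b c m -> is_CInt f a c (l + m)%C.
Proof. intros; now apply (is_RInt_Chasles (V := C_R_CompleteNormedModule) _ _ b). Qed.

Lemma CInt_unique (f : R -> C) (a b : R) (l : C) : is_CInt f a b l -> CInt f a b = l.
Proof. apply (is_RInt_unique (V := C_R_CompleteNormedModule)). Qed.

Lemma CInt_continuous (f : R -> C) (a b : R) :
  (forall x, Rmin a b <= x <= Rmax a b ->
    continuous (U := C_R_CompleteNormedModule) f x) ->
  is_CInt f a b (CInt f a b).
Proof.
intros H. apply (RInt_correct (V := C_R_CompleteNormedModule)).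
now apply ex_RInt_continuous.
Qed.

(** The product norm on pairs is Euclidean, so norm bounds for integrals carry over to [Cmod]
    without loss of a factor. *)
Lemma Cnorm_eq (x : C) : norm (V := C_R_NormedModule) x = Cmod x.
Proof.
unfold norm; simpl. unfold prod_norm, Cmod. f_equal.
unfold norm; simpl; unfold abs; simpl.
rewrite !Rmult_1_r.
rewrite <- !Rabs_mult, !Rabs_pos_eq; auto; apply Rle_0_sqr.
Qed.

Lemma is_CInt_bound (f : R -> C) (g : R -> R) (a b : R) (l : C) (m : R) :
  a <= b -> (forall x, a <= x <= b -> Cmod (f x) <= g x) ->
  is_CInt f a b l -> is_RInt g a b m -> Cmod l <= m.
Proof.
intros Hab Hg Hf Hm. rewrite <- Cnorm_eq.
apply (norm_RInt_le (V := C_R_NormedModule) f g a b l m); auto.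
intros x Hx. rewrite Cnorm_eq. auto.
Qed.

Lemma is_CInt_bound_cst (f : R -> C) (M a b : R) (l : C) :
  a <= b -> (forall x, a <= x <= b -> Cmod (f x) <= M) ->
  is_CInt f a b l -> Cmod l <= (b - a) * M.
Proof.
intros Hab Hg Hf. apply (is_CInt_bound f (fun _ => M) a b l); auto.
apply (is_RInt_const (V := R_NormedModule)).
Qed.

(** * Goursat's theorem for rectangles *)

(** The contour integral of f(z) dz counterclockwise around [a, b] x [c, d]; the factor [Ci] is dz =
    i dy on the vertical sides. *)
Definition Rect_int (f : C -> C) (a b c d : R) : C :=
  (CInt (fun x => f (x, c)) a b - CInt (fun x => f (x, d)) a b
   + Ci * (CInt (fun y => f (b, y)) c d - CInt (fun y => f (a, y)) c d))%C.

Lemma CInt_hor (f : C -> C) (a b c : R) : (forall z, Ccont f z) ->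
  is_CInt (fun x => f (x, c)) a b (CInt (fun x => f (x, c)) a b).
Proof. intros H. apply CInt_continuous. intros; now apply Ccont_hor. Qed.

Lemma CInt_ver (f : C -> C) (a c d : R) : (forall z, Ccont f z) ->
  is_CInt (fun y => f (a, y)) c d (CInt (fun y => f (a, y)) c d).
Proof. intros H. apply CInt_continuous. intros; now apply Ccont_ver. Qed.

Lemma Rect_int_split_x (f : C -> C) (a m b c d : R) : (forall z, Ccont f z) ->
  Rect_int f a b c d = (Rect_int f a m c d + Rect_int f m b c d)%C.
Proof.
intros H. unfold Rect_int.
rewrite (CInt_unique _ a b _ (is_CInt_Chasles _ _ _ _ _ _
  (CInt_hor f a m c H) (CInt_hor f m b c H))).
rewrite (CInt_unique _ a b _ (is_CInt_Chasles _ _ _ _ _ _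
  (CInt_hor f a m d H) (CInt_hor f m b d H))). ring.
Qed.

Lemma Rect_int_split_y (f : C -> C) (a b c m d : R) : (forall z, Ccont f z) ->
  Rect_int f a b c d = (Rect_int f a b c m + Rect_int f a b m d)%C.
Proof.
intros H. unfold Rect_int.
rewrite (CInt_unique _ c d _ (is_CInt_Chasles _ _ _ _ _ _
  (CInt_ver f a c m H) (CInt_ver f a m d H))).
rewrite (CInt_unique _ c d _ (is_CInt_Chasles _ _ _ _ _ _
  (CInt_ver f b c m H) (CInt_ver f b m d H))). ring.
Qed.

Lemma Rect_int_minus (f g : C -> C) (a b c d : R) :
  (forall z, Ccont f z) -> (forall z, Ccont g z) ->
  Rect_int (fun z => f z - g z)%C a b c d
  = (Rect_int f a b c d - Rect_int g a b c d)%C.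
Proof.
intros Hf Hg. unfold Rect_int.
rewrite (CInt_unique _ _ _ _ (is_CInt_minus _ _ _ _ _ _
  (CInt_hor f a b c Hf) (CInt_hor g a b c Hg))).
rewrite (CInt_unique _ _ _ _ (is_CInt_minus _ _ _ _ _ _
  (CInt_hor f a b d Hf) (CInt_hor g a b d Hg))).
rewrite (CInt_unique _ _ _ _ (is_CInt_minus _ _ _ _ _ _
  (CInt_ver f a c d Hf) (CInt_ver g a c d Hg))).
rewrite (CInt_unique _ _ _ _ (is_CInt_minus _ _ _ _ _ _
  (CInt_ver f b c d Hf) (CInt_ver g b c d Hg))). ring.
Qed.

Lemma Rect_int_bound (f : C -> C) (M a b c d : R) :
  a <= b -> c <= d -> (forall z, Ccont f z) ->
  (forall x y, a <= x <= b -> c <= y <= d -> Cmod (f (x, y)) <= M) ->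
  Cmod (Rect_int f a b c d) <= 2 * M * ((b - a) + (d - c)).
Proof.
intros Hab Hcd Hf HM. unfold Rect_int.
assert (Hh : forall e, c <= e <= d -> Cmod (CInt (fun x => f (x, e)) a b) <= (b - a) * M).
{ intros e He. apply (is_CInt_bound_cst (fun x => f (x, e))); auto.
  apply CInt_hor; auto. }
assert (Hv : forall e, a <= e <= b -> Cmod (CInt (fun y => f (e, y)) c d) <= (d - c) * M).
{ intros e He. apply (is_CInt_bound_cst (fun y => f (e, y))); auto.
  apply CInt_ver; auto. }
assert (H1 := Hh c ltac:(lra)). assert (H2 := Hh d ltac:(lra)).
assert (H3 := Hv a ltac:(lra)). assert (H4 := Hv b ltac:(lra)).
eapply Rle_trans; [apply Cmod_triangle|]. rewrite Cmod_mult, Cmod_Ci.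
unfold Cminus.
eapply Rle_trans; [apply Rplus_le_compat; [apply Cmod_triangle|
  apply Rmult_le_compat_l; [lra|apply Cmod_triangle]]|].
rewrite !Cmod_opp. nra.
Qed.

Lemma affine_Ccont (al be p z : C) : Ccont (fun w => al + be * (w - p))%C z.
Proof.
intros eps Heps. assert (Hb := Cmod_ge_0 be).
exists (eps / (1 + Cmod be)). split; [apply Rdiv_lt_0_compat; lra|].
intros w Hw. apply Rlt_div_r in Hw; [|lra].
replace (al + be * (w - p) - (al + be * (z - p)))%C with (be * (w - z))%C by ring.
rewrite Cmod_mult. assert (H := Cmod_ge_0 (w - z)%C). nra.
Qed.

Lemma is_RInt_quad (al be a b : R) :
  is_RInt (fun x => al + be * x) a b (al * (b - a) + be * (b ^ 2 - a ^ 2) / 2).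
Proof.
replace (al * (b - a) + be * (b ^ 2 - a ^ 2) / 2)
  with (minus (al * b + be * b ^ 2 / 2) (al * a + be * a ^ 2 / 2))
  by (unfold minus, plus, opp; simpl; field).
apply (is_RInt_derive (fun x => al * x + be * x ^ 2 / 2)).
- intros x _. auto_derive; auto. field.
- intros x _. apply continuity_pt_filterlim. reg.
Qed.

(** An affine function has a primitive, so its contour integrals vanish; here the four sides are
    computed outright. In Goursat's argument this removes the linear approximation of f. *)
Lemma Rect_int_affine (al be p : C) (a b c d : R) :
  Rect_int (fun w => al + be * (w - p))%C a b c d = 0.
Proof.
destruct al as [a1 a2], be as [b1 b2], p as [p1 p2].
assert (Hh : forall e, is_CInt
  (fun x => (a1, a2) + (b1, b2) * ((x, e) - (p1, p2)))%C a b
  ((a1 - b1 * p1 - b2 * (e - p2)) * (b - a) + b1 * (b ^ 2 - a ^ 2) / 2,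
   (a2 + b1 * (e - p2) - b2 * p1) * (b - a) + b2 * (b ^ 2 - a ^ 2) / 2)).
{ intros e. apply is_CInt_pair.
  - eapply is_RInt_ext; [|apply is_RInt_quad]. intros x _. simpl. ring.
  - eapply is_RInt_ext; [|apply is_RInt_quad]. intros x _. simpl. ring. }
assert (Hv : forall e, is_CInt
  (fun y => (a1, a2) + (b1, b2) * ((e, y) - (p1, p2)))%C c d
  ((a1 + b1 * (e - p1) + b2 * p2) * (d - c) + (- b2) * (d ^ 2 - c ^ 2) / 2,
   (a2 - b1 * p2 + b2 * (e - p1)) * (d - c) + b1 * (d ^ 2 - c ^ 2) / 2)).
{ intros e. apply is_CInt_pair.
  - eapply is_RInt_ext; [|apply is_RInt_quad]. intros x _. simpl. ring.
  - eapply is_RInt_ext; [|apply is_RInt_quad]. intros x _. simpl. ring. }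
unfold Rect_int.
rewrite (CInt_unique _ _ _ _ (Hh c)), (CInt_unique _ _ _ _ (Hh d)),
  (CInt_unique _ _ _ _ (Hv a)), (CInt_unique _ _ _ _ (Hv b)).
unfold Cminus, Cplus, Cmult, Copp, Ci, RtoC; simpl. f_equal; field.
Qed.

(* [(a, c)] is the lower left corner of a rectangle of size 2 w by 2 v, the
   result that of a quarter with the largest boundary integral. *)
Definition Rect_next (f : C -> C) (w v : R) (q : R * R) : R * R :=
  let (a, c) := q in
  let I := fun a c => Cmod (Rect_int f a (a + w) c (c + v)) in
  let best := fun q1 q2 : R * R =>
    if Rle_dec (I (fst q1) (snd q1)) (I (fst q2) (snd q2)) then q2 else q1 in
  best (best (a, c) (a + w, c)) (best (a, c + v) (a + w, c + v)).

(** The inner sides cancel, so the four quarter integrals add up to the whole one and the largest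
    has at least a quarter of its modulus. *)
Lemma Rect_next_spec (f : C -> C) (w v a c : R) : (forall z, Ccont f z) ->
  let q := Rect_next f w v (a, c) in
  (fst q = a \/ fst q = a + w) /\ (snd q = c \/ snd q = c + v) /\
  Cmod (Rect_int f a (a + 2 * w) c (c + 2 * v))
  <= 4 * Cmod (Rect_int f (fst q) (fst q + w) (snd q) (snd q + v)).
Proof.
intros Hf.
assert (E : (Rect_int f a (a + 2 * w) c (c + 2 * v)
  = Rect_int f a (a + w) c (c + v) + Rect_int f (a + w) (a + w + w) c (c + v)
  + (Rect_int f a (a + w) (c + v) (c + v + v)
     + Rect_int f (a + w) (a + w + w) (c + v) (c + v + v)))%C).
{ replace (a + 2 * w) with (a + w + w) by ring.
  replace (c + 2 * v) with (c + v + v) by ring.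
  rewrite (Rect_int_split_y f _ _ c (c + v)) by auto.
  now rewrite (Rect_int_split_x f a (a + w) (a + w + w) c), (Rect_int_split_x f a (a + w) (a + w + w) (c + v)) by auto. }
rewrite E. clear E. simpl.
set (I1 := Rect_int f a (a + w) c (c + v)).
set (I2 := Rect_int f (a + w) (a + w + w) c (c + v)).
set (I3 := Rect_int f a (a + w) (c + v) (c + v + v)).
set (I4 := Rect_int f (a + w) (a + w + w) (c + v) (c + v + v)).
assert (H : Cmod (I1 + I2 + (I3 + I4))%C <= Cmod I1 + Cmod I2 + Cmod I3 + Cmod I4).
{ assert (H1 := Cmod_triangle (I1 + I2)%C (I3 + I4)%C).
  assert (H2 := Cmod_triangle I1 I2). assert (H3 := Cmod_triangle I3 I4). lra. }
destruct (Rle_dec (Cmod I1) (Cmod I2)), (Rle_dec (Cmod I3) (Cmod I4)); simpl;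
  fold I1 I2 I3 I4;
  (match goal with |- context [Rle_dec ?x ?y] => destruct (Rle_dec x y) end); simpl;
  fold I1 I2 I3 I4; repeat split; auto; lra.
Qed.

Fixpoint Rect_seq (f : C -> C) (w v : R) (q : R * R) (n : nat) : R * R :=
  match n with
  | O => q
  | S n => Rect_next f (w / 2 ^ S n) (v / 2 ^ S n) (Rect_seq f w v q n)
  end.

(** The supremum of the left ends lies below every right end, because any two of the nested
    intervals meet. *)
Lemma nested_limit (u : nat -> R) (w : R) : 0 <= w ->
  (forall n, u n <= u (S n) /\ u (S n) + w / 2 ^ S n <= u n + w / 2 ^ n) ->
  exists p, forall n, u n <= p <= u n + w / 2 ^ n.
Proof.
intros Hw Hu.
assert (Hp : forall n, 0 < / 2 ^ n) by (intros; apply Rinv_0_lt_compat, pow_lt; lra).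
assert (Hlt : forall m n, u n <= u (n + m)%nat /\
  u (n + m)%nat + w / 2 ^ (n + m) <= u n + w / 2 ^ n).
{ induction m; intros n.
  - rewrite Nat.add_0_r. lra.
  - rewrite Nat.add_succ_r. specialize (Hu (n + m)%nat). specialize (IHm n). lra. }
assert (Hub : forall m n, u m <= u n + w / 2 ^ n).
{ intros m n. destruct (Nat.le_ge_cases m n) as [H|H].
  - destruct (Hlt (n - m)%nat m) as [H1 _]. replace (m + (n - m))%nat with n in H1 by lia.
    specialize (Hp n). unfold Rdiv. nra.
  - destruct (Hlt (m - n)%nat n) as [_ H1]. replace (n + (m - n))%nat with m in H1 by lia.
    specialize (Hp m). unfold Rdiv in *. nra. }
destruct (completeness (fun x => exists n, x = u n)) as [p [Hp1 Hp2]].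
- exists (u 0%nat + w / 2 ^ 0). intros x [n ->]. apply Hub.
- exists (u 0%nat). now exists 0%nat.
- exists p. intros n. split.
  + apply Hp1. now exists n.
  + apply Hp2. intros x [m ->]. apply Hub.
Qed.

Theorem Goursat (f : C -> C) (a b c d : R) : entire f -> a < b -> c < d ->
  Rect_int f a b c d = 0.
Proof.
intros Hf Hab Hcd.
assert (Hc : forall z, Ccont f z).
{ intros z. destruct (Hf z) as [l Hl]. now apply (is_Cderive_cont f z l). }
set (w := b - a). set (v := d - c).
assert (Hw : 0 < w) by (unfold w; lra). assert (Hv : 0 < v) by (unfold v; lra).
apply Cmod_eq_0. destruct (Req_dec (Cmod (Rect_int f a b c d)) 0) as [|Hne]; auto.
exfalso. set (e := Cmod (Rect_int f a b c d)) in *.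
assert (He : 0 < e) by (assert (H := Cmod_ge_0 (Rect_int f a b c d)); fold e in H; lra).
set (q := Rect_seq f w v (a, c)).
assert (Hpow : forall n, w / 2 ^ n = 2 * (w / 2 ^ S n) /\ v / 2 ^ n = 2 * (v / 2 ^ S n)).
{ intros n. simpl. split; field; apply pow_nonzero; lra. }
assert (Hq : forall n,
  (fst (q (S n)) = fst (q n) \/ fst (q (S n)) = fst (q n) + w / 2 ^ S n) /\
  (snd (q (S n)) = snd (q n) \/ snd (q (S n)) = snd (q n) + v / 2 ^ S n) /\
  Cmod (Rect_int f (fst (q n)) (fst (q n) + w / 2 ^ n) (snd (q n)) (snd (q n) + v / 2 ^ n))
  <= 4 * Cmod (Rect_int f (fst (q (S n))) (fst (q (S n)) + w / 2 ^ S n)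
                 (snd (q (S n))) (snd (q (S n)) + v / 2 ^ S n))).
{ intros n. destruct (Hpow n) as [E1 E2]. rewrite E1, E2.
  unfold q. simpl Rect_seq.
  destruct (Rect_seq f w v (a, c) n) as [an cn].
  exact (Rect_next_spec f _ _ an cn Hc). }
(* Each subdivision costs a factor 4, while a bound from differentiability shrinks like the
   perimeter times the diameter, also by 4; the contradiction lies in the constant. *)
assert (Hbig : forall n, e / 4 ^ n <=
  Cmod (Rect_int f (fst (q n)) (fst (q n) + w / 2 ^ n) (snd (q n)) (snd (q n) + v / 2 ^ n))).
{ induction n.
  - unfold q, e. simpl. rewrite !Rdiv_1_r. unfold w, v.
    replace (a + (b - a)) with b by ring. replace (c + (d - c)) with d by ring. lra.
  - destruct (Hq n) as [_ [_ H]].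
    assert (E : e / 4 ^ n = 4 * (e / 4 ^ S n)) by (simpl; field; apply pow_nonzero; lra).
    lra. }
assert (Hwp : forall n, 0 < w / 2 ^ n) by (intros; apply Rdiv_lt_0_compat; auto; apply pow_lt; lra).
assert (Hvp : forall n, 0 < v / 2 ^ n) by (intros; apply Rdiv_lt_0_compat; auto; apply pow_lt; lra).
destruct (nested_limit (fun n => fst (q n)) w) as [p1 Hp1]; [lra| |].
{ intros n. destruct (Hq n) as [H _]. destruct (Hpow n). specialize (Hwp (S n)). lra. }
destruct (nested_limit (fun n => snd (q n)) v) as [p2 Hp2]; [lra| |].
{ intros n. destruct (Hq n) as [_ [H _]]. destruct (Hpow n). specialize (Hvp (S n)). lra. }
destruct (Hf (p1, p2)) as [l Hl]. rewrite is_Cderive_eps in Hl.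
(* This tolerance makes the upper bound for the n-th contour integral exactly half of the lower
   bound e / 4^n. *)
destruct (Hl (e / (4 * (w + v) ^ 2))) as [r [Hr Hlr]].
{ apply Rdiv_lt_0_compat; auto. nra. }
assert (Hn : exists n, (w + v) / 2 ^ n < r).
{ destruct (pow_lt_1_zero (/ 2) ltac:(rewrite Rabs_pos_eq; lra) (r / (w + v))) as [n Hn].
  - apply Rdiv_lt_0_compat; lra.
  - exists n. specialize (Hn n (le_n n)).
    rewrite Rabs_pos_eq in Hn by (apply pow_le; lra).
    apply Rlt_div_r in Hn; [|lra]. rewrite pow_inv in Hn. unfold Rdiv. lra. }
destruct Hn as [n Hn].
specialize (Hbig n). specialize (Hp1 n). specialize (Hp2 n). specialize (Hwp n). specialize (Hvp n).
simpl in Hp1, Hp2.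
set (an := fst (q n)) in *. set (cn := snd (q n)) in *.
set (g := fun z : C => (f (p1, p2) + l * (z - (p1, p2)))%C).
assert (Hg : forall z, Ccont g z) by (intros; apply affine_Ccont).
(* Subtracting the affine function g tangent to f at the limit point leaves the contour integral
   unchanged. *)
assert (E : Rect_int f an (an + w / 2 ^ n) cn (cn + v / 2 ^ n)
  = Rect_int (fun z => f z - g z)%C an (an + w / 2 ^ n) cn (cn + v / 2 ^ n)).
{ rewrite Rect_int_minus by auto. 
  change (Rect_int g) with (Rect_int (fun w => f (p1, p2) + l * (w - (p1, p2)))%C).
  rewrite Rect_int_affine. ring. }
rewrite E in Hbig. clear E.
assert (Hsm : Cmod (Rect_int (fun z => f z - g z)%C an (an + w / 2 ^ n) cn (cn + v / 2 ^ n))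
  <= 2 * (e / (4 * (w + v) ^ 2) * ((w + v) / 2 ^ n))
     * ((an + w / 2 ^ n - an) + (cn + v / 2 ^ n - cn))).
{ apply Rect_int_bound; try lra.
  - intros z eps Heps. destruct (Hc z (eps / 2) ltac:(lra)) as [d1 [Hd1 H1]].
    destruct (Hg z (eps / 2) ltac:(lra)) as [d2 [Hd2 H2]].
    exists (Rmin d1 d2). split; [now apply Rmin_glb_lt|]. intros z' Hz'.
    specialize (H1 z' (Rlt_le_trans _ _ _ Hz' (Rmin_l _ _))).
    specialize (H2 z' (Rlt_le_trans _ _ _ Hz' (Rmin_r _ _))).
    replace (f z' - g z' - (f z - g z))%C with ((f z' - f z) - (g z' - g z))%C by ring.
    unfold Cminus at 1. eapply Rle_lt_trans; [apply Cmod_triangle|].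
    rewrite Cmod_opp. lra.
  - intros x y Hx Hy.
    assert (Hd : Cmod ((x, y) - (p1, p2))%C <= (w + v) / 2 ^ n).
    { change ((x, y) - (p1, p2))%C with ((x - p1, y - p2) : C).
      eapply Rle_trans; [apply Cmod_pair|].
      replace ((w + v) / 2 ^ n) with (w / 2 ^ n + v / 2 ^ n) by (field; apply pow_nonzero; lra).
      apply Rplus_le_compat; apply Rabs_le; lra. }
    specialize (Hlr ((x, y) - (p1, p2))%C ltac:(lra)).
    replace ((p1, p2) + ((x, y) - (p1, p2)))%C with ((x, y) : C) in Hlr
      by (apply injective_projections; simpl; ring).
    unfold g.
    replace (f (x, y) - (f (p1, p2) + l * ((x, y) - (p1, p2))))%C
      with (f (x, y) - f (p1, p2) - ((x, y) - (p1, p2)) * l)%C by ring.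
    eapply Rle_trans; [exact Hlr|]. apply Rmult_le_compat_l; auto.
    apply Rlt_le, Rdiv_lt_0_compat; auto; nra. }
assert (E : 2 * (e / (4 * (w + v) ^ 2) * ((w + v) / 2 ^ n))
     * ((an + w / 2 ^ n - an) + (cn + v / 2 ^ n - cn)) = / 2 * (e / 4 ^ n)).
{ replace (4 ^ n) with (2 ^ n * 2 ^ n) by (rewrite <- Rpow_mult_distr; f_equal; ring). field.
  split; [apply pow_nonzero; lra|nra]. }
assert (H4 : 0 < e / 4 ^ n) by (apply Rdiv_lt_0_compat; auto; apply pow_lt; lra).
lra.
Qed.

(** * Entire functions vanishing on a vertical segment *)

Lemma exp_le (x y : R) : x <= y -> exp x <= exp y.
Proof. intros [H| ->]; [now apply Rlt_le, exp_increasing|apply Rle_refl]. Qed.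

Lemma Cexp_plus (z w : C) : Cexp (z + w) = (Cexp z * Cexp w)%C.
Proof.
destruct z as [a b], w as [c d]. unfold Cexp, Cplus, Cmult; simpl.
rewrite exp_plus, cos_plus, sin_plus. f_equal; ring.
Qed.

Lemma Cexp_R (x : R) : Cexp x = exp x.
Proof. unfold Cexp, RtoC; simpl. rewrite cos_0, sin_0. f_equal; ring. Qed.

Lemma Cmod_Cexp (z : C) : Cmod (Cexp z) = exp (Re z).
Proof.
unfold Cmod, Cexp; simpl fst; simpl snd.
replace ((exp (Re z) * cos (Im z)) ^ 2 + (exp (Re z) * sin (Im z)) ^ 2)
  with (Rsqr (exp (Re z)) * (Rsqr (sin (Im z)) + Rsqr (cos (Im z)))) by (unfold Rsqr; ring).
rewrite sin2_cos2, Rmult_1_r. apply sqrt_Rsqr. apply Rlt_le, exp_pos.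
Qed.

(** Two applications of the mean value theorem, with K in place of Taylor's K / 2. *)
Lemma second_order_bound (u du ddu : R -> R) (K : R) :
  (forall t, is_derive u t (du t)) -> (forall t, is_derive du t (ddu t)) ->
  (forall t, 0 <= t <= 1 -> Rabs (ddu t) <= K) ->
  Rabs (u 1 - u 0 - du 0) <= K.
Proof.
intros Hu Hdu HK.
destruct (MVT_gen u 0 1 du) as [c [Hc Ec]].
- intros; apply Hu.
- intros x _. apply continuity_pt_filterlim.
  apply (ex_derive_continuous (V := R_NormedModule)). now exists (du x).
- rewrite Rmin_left, Rmax_right in Hc by lra.
  destruct (MVT_gen du 0 c ddu) as [c' [Hc' Ec']].
  + intros; apply Hdu.
  + intros x _. apply continuity_pt_filterlim.
    apply (ex_derive_continuous (V := R_NormedModule)). now exists (ddu x).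
  + rewrite Rmin_left, Rmax_right in Hc' by lra.
    rewrite Ec. replace (du c * (1 - 0) - du 0) with (ddu c' * c) by lra.
    rewrite Rabs_mult, (Rabs_pos_eq c) by lra.
    specialize (HK c' ltac:(lra)). assert (H := Rabs_pos (ddu c')). nra.
Qed.

(** The squares of p cos x - q sin x and p sin x + q cos x add up to p^2 + q^2. *)
Lemma Rabs_rot (p q x : R) : Rabs (p * cos x - q * sin x) <= sqrt (p ^ 2 + q ^ 2).
Proof.
rewrite <- sqrt_Rsqr_abs. apply sqrt_le_1_alt.
assert (H := sin2_cos2 x). unfold Rsqr in *.
assert (H2 := Rle_0_sqr (p * sin x + q * cos x)). unfold Rsqr in H2.
replace (p ^ 2 + q ^ 2) with ((p ^ 2 + q ^ 2) * (sin x * sin x + cos x * cos x)) by (rewrite H; ring).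
nra.
Qed.

(** Along t -> exp(t h) the second derivative is h^2 exp(t h). Its real and imaginary parts have the
    shape treated in [HK], with p and q made from the parts of h^2, whence p^2 + q^2 = |h|^4. The
    factor 2 comes from adding the bounds for the two parts. *)
Lemma Cexp_second_order (h : C) :
  Cmod (Cexp h - 1 - h)%C <= 2 * (Cmod h ^ 2 * exp (Rabs (Re h))).
Proof.
destruct h as [a b]. simpl Re.
set (K := Cmod (a, b) ^ 2 * exp (Rabs a)).
assert (HK : forall t p q, 0 <= t <= 1 -> p ^ 2 + q ^ 2 = (a ^ 2 + b ^ 2) ^ 2 ->
  Rabs (exp (t * a) * (p * cos (t * b) - q * sin (t * b))) <= K).
{ intros t p q Ht Hpq. rewrite Rabs_mult, (Rabs_pos_eq (exp _)) by apply Rlt_le, exp_pos.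
  unfold K. rewrite Rmult_comm. apply Rmult_le_compat.
  - apply Rabs_pos. 
  - apply Rlt_le, exp_pos.
  - eapply Rle_trans; [apply Rabs_rot|]. rewrite Hpq. unfold Cmod; simpl fst; simpl snd.
    rewrite pow2_sqrt by nra. rewrite sqrt_pow2 by nra. lra.
  - apply exp_le. assert (H := Rle_abs a). assert (H' := Rabs_pos a). nra. }
assert (H1 : Rabs (exp a * cos b - 1 - a) <= K).
{ assert (H := second_order_bound (fun t => exp (t * a) * cos (t * b))
    (fun t => exp (t * a) * (a * cos (t * b) - b * sin (t * b)))
    (fun t => exp (t * a) * ((a ^ 2 - b ^ 2) * cos (t * b) - (2 * a * b) * sin (t * b))) K).
  cbv beta in H. rewrite !Rmult_1_l, !Rmult_0_l, exp_0, cos_0, sin_0 in H.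
  replace (exp a * cos b - 1 - a) with (exp a * cos b - 1 * 1 - 1 * (a * 1 - b * 0)) by ring.
  apply H.
  - intros t. auto_derive; auto. ring.
  - intros t. auto_derive; auto. ring.
  - intros t Ht. apply HK; auto. ring. }
assert (H2 : Rabs (exp a * sin b - b) <= K).
{ assert (H := second_order_bound (fun t => exp (t * a) * sin (t * b))
    (fun t => exp (t * a) * (b * cos (t * b) - (- a) * sin (t * b)))
    (fun t => exp (t * a) * ((2 * a * b) * cos (t * b) - (b ^ 2 - a ^ 2) * sin (t * b))) K).
  cbv beta in H. rewrite !Rmult_1_l, !Rmult_0_l, exp_0, cos_0, sin_0 in H.
  replace (exp a * sin b - b) with (exp a * sin b - 1 * 0 - 1 * (b * 1 - (- a) * 0)) by ring.
  apply H.
  - intros t. auto_derive; auto. ring.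
  - intros t. auto_derive; auto. ring.
  - intros t Ht. apply HK; auto. ring. }
replace (Cexp (a, b) - 1 - (a, b))%C with ((exp a * cos b - 1 - a, exp a * sin b - b) : C).
- eapply Rle_trans; [apply Cmod_pair|]. lra.
- unfold Cexp, Cminus, Cplus, Copp, RtoC; simpl. f_equal; ring.
Qed.

Lemma is_Cderive_Cexp (z : C) : is_Cderive Cexp z (Cexp z).
Proof.
apply is_Cderive_eps. intros eps Heps.
set (K := exp (Re z) * (2 * exp 1)).
assert (HK : 0 < K) by (unfold K; assert (H := exp_pos (Re z)); assert (H' := exp_pos 1); nra).
exists (Rmin 1 (eps / K)). split.
{ apply Rmin_glb_lt; [lra|]. now apply Rdiv_lt_0_compat. }
intros h Hh.
assert (H1 : Cmod h < 1) by (eapply Rlt_le_trans; [exact Hh|apply Rmin_l]).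
assert (H2 : Cmod h < eps / K) by (eapply Rlt_le_trans; [exact Hh|apply Rmin_r]).
apply Rlt_div_r in H2; [|lra].
rewrite Cexp_plus.
replace (Cexp z * Cexp h - Cexp z - h * Cexp z)%C with (Cexp z * (Cexp h - 1 - h))%C by ring.
rewrite Cmod_mult, Cmod_Cexp.
assert (H3 := Cexp_second_order h).
assert (H4 : exp (Rabs (Re h)) <= exp 1).
{ apply exp_le. assert (H := re_le_Cmod h). lra. }
assert (H5 := Cmod_ge_0 h).
apply Rle_trans with (exp (Re z) * (2 * (Cmod h ^ 2 * exp 1))).
- apply Rmult_le_compat_l; [apply Rlt_le, exp_pos|]. eapply Rle_trans; [exact H3|].
  apply Rmult_le_compat_l; [lra|]. apply Rmult_le_compat_l; [nra|auto].
- replace (exp (Re z) * (2 * (Cmod h ^ 2 * exp 1))) with (Cmod h * K * Cmod h) by (unfold K; ring).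
  apply Rmult_le_compat_r; lra.
Qed.

(** C is a normed module over itself in two ways: the product and chain rules are stated for the
    structure of the ring, [entire] for [C_NormedModule]. *)
Lemma is_Cderive_AbsRing (f : C -> C) (z l : C) :
  is_derive (K := C_AbsRing) (V := AbsRing_NormedModule C_AbsRing) f z l <->
  is_Cderive f z l.
Proof.
split; intros [_ H]; (split; [apply is_linear_scal_l|exact H]).
Qed.

Lemma is_Cderive_mult (f g : C -> C) (z df dg : C) :
  is_Cderive f z df -> is_Cderive g z dg ->
  is_Cderive (fun w => f w * g w)%C z (df * g z + f z * dg)%C.
Proof.
rewrite <- !is_Cderive_AbsRing. intros Hf Hg.
apply (is_derive_mult (K := C_AbsRing) f g z df dg); auto.
intros; apply Cmult_comm.
Qed.

Lemma is_Cderive_comp (f g : C -> C) (z df dg : C) :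
  is_Cderive f (g z) df -> is_Cderive g z dg ->
  is_Cderive (fun w => f (g w)) z (dg * df)%C.
Proof.
rewrite <- (is_Cderive_AbsRing g). intros Hf Hg.
now apply (is_derive_comp (K := C_AbsRing) (V := C_NormedModule)).
Qed.

Lemma is_Cderive_affine (al be z : C) : is_Cderive (fun w => al + be * w)%C z be.
Proof.
apply is_Cderive_eps. intros eps Heps. exists 1; split; [lra|]. intros h _.
replace (al + be * (z + h) - (al + be * z) - h * be)%C with (RtoC 0) by ring.
rewrite Cmod_0. assert (H := Cmod_ge_0 h). nra.
Qed.

(** * Closure properties of entire functions *)

Lemma entire_mult (f g : C -> C) : entire f -> entire g -> entire (fun z => f z * g z)%C.
Proof.
intros Hf Hg z. destruct (Hf z) as [l Hl], (Hg z) as [m Hm].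
eexists. apply is_Cderive_mult; eassumption.
Qed.

Lemma entire_comp (f g : C -> C) : entire f -> entire g -> entire (fun z => f (g z)).
Proof.
intros Hf Hg z. destruct (Hg z) as [m Hm], (Hf (g z)) as [l Hl].
eexists. apply is_Cderive_comp; eassumption.
Qed.

(** Constants, multiples and sign changes all enter through this shape, which accounts for the
    summands 0 and factors 1 in functions later shown to be entire. *)
Lemma entire_affine (al be : C) : entire (fun w => al + be * w)%C.
Proof. intros z. exists be. apply is_Cderive_affine. Qed.

Lemma entire_plus (f g : C -> C) : entire f -> entire g -> entire (fun z => f z + g z)%C.
Proof.
intros Hf Hg z. now apply (ex_derive_plus (K := C_AbsRing) (V := C_NormedModule)).
Qed.

Lemma entire_ext (f g : C -> C) : (forall z, f z = g z) -> entire f -> entire g.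
Proof. intros E H z. now apply (ex_derive_ext (K := C_AbsRing) (V := C_NormedModule) f). Qed.

Lemma entire_Cexp : entire Cexp.
Proof. intros z. eexists. apply is_Cderive_Cexp. Qed.

Lemma entire_cont (f : C -> C) (z : C) : entire f -> Ccont f z.
Proof. intros H. destruct (H z) as [l Hl]. now apply (is_Cderive_cont f z l). Qed.

(** * Bounds on segments and concentration of Gaussian weights *)

Lemma Ccont_bounded_hor (f : C -> C) (a b c : R) : (forall z, Ccont f z) ->
  exists M, forall x, a <= x <= b -> Cmod (f (x, c)) <= M.
Proof.
intros H.
destruct (bounded_continuity (V := C_R_NormedModule) (fun x => f (x, c)) a b) as [M HM].
- intros x _. apply (Ccont_hor f x c). apply H.
- exists M. intros x Hx. rewrite <- Cnorm_eq. now apply Rlt_le, HM.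
Qed.

Lemma Ccont_bounded_ver (f : C -> C) (a c d : R) : (forall z, Ccont f z) ->
  exists M, forall y, c <= y <= d -> Cmod (f (a, y)) <= M.
Proof.
intros H.
destruct (bounded_continuity (V := C_R_NormedModule) (fun y => f (a, y)) c d) as [M HM].
- intros x _. apply (Ccont_ver f x a). apply H.
- exists M. intros x Hx. rewrite <- Cnorm_eq. now apply Rlt_le, HM.
Qed.

(** Only the interval |y - t0| <= d / 2 is kept, on which the integrand is at least exp(-lam d^2 /
    4). *)
Lemma RInt_gauss_lower (lam t0 Y d : R) : 0 < d <= Y -> 0 < lam ->
  d * exp (- lam * d ^ 2 / 4)
  <= RInt (fun y => exp (- lam * (y - t0) ^ 2)) (t0 - Y) (t0 + Y).
Proof.
intros Hd Hl.
set (g := fun y => exp (- lam * (y - t0) ^ 2)).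
assert (Hc : forall x, continuous g x).
{ intros x. apply (ex_derive_continuous (V := R_NormedModule)). unfold g. auto_derive. auto. }
assert (He : forall a b, ex_RInt g a b).
{ intros. apply (ex_RInt_continuous (V := R_CompleteNormedModule)). auto. }
assert (Hp : forall x, 0 <= g x) by (intros; apply Rlt_le, exp_pos).
rewrite <- (RInt_Chasles (V := R_CompleteNormedModule) g (t0 - Y) (t0 - d / 2) (t0 + Y)) by auto.
rewrite <- (RInt_Chasles (V := R_CompleteNormedModule) g (t0 - d / 2) (t0 + d / 2) (t0 + Y)) by auto.
assert (H1 : 0 <= RInt g (t0 - Y) (t0 - d / 2)) by (apply RInt_ge_0; auto; lra).
assert (H2 : 0 <= RInt g (t0 + d / 2) (t0 + Y)) by (apply RInt_ge_0; auto; lra).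
assert (H3 : d * exp (- lam * d ^ 2 / 4) <= RInt g (t0 - d / 2) (t0 + d / 2)).
{ replace (d * exp (- lam * d ^ 2 / 4))
    with (RInt (fun _ => exp (- lam * d ^ 2 / 4)) (t0 - d / 2) (t0 + d / 2))
    by (rewrite RInt_const; unfold scal; simpl; unfold mult; simpl; field).
  apply RInt_le; auto; [lra|apply ex_RInt_const|].
  intros x Hx. apply exp_le.
  assert ((x - t0) ^ 2 <= d ^ 2 / 4) by nra. nra. }
unfold plus; simpl in *. lra.
Qed.

(** The integral is at least m d exp(-lam d^2 / 4) up to an error of order exp(-lam d^2), and the
    assumed upper bound is also of order exp(-lam d^2) since d^2 <= eta. For large lam the first
    exponential wins. *)
Lemma gauss_concentration (r : R -> R) (t0 Y eta A B m d : R) :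
  0 < d <= Y -> 0 < m -> d ^ 2 <= eta -> 0 <= A ->
  (forall y, continuous r y) ->
  (forall y, Rabs (y - t0) <= d -> m <= r y) ->
  (forall y, t0 - Y <= y <= t0 + Y -> - B <= r y) ->
  (forall lam, 0 < lam ->
    RInt (fun y => r y * exp (- lam * (y - t0) ^ 2)) (t0 - Y) (t0 + Y)
    <= A * exp (- lam * eta)) -> False.
Proof.
intros Hd Hm Heta HA Hr Hrm HrB Hint.
set (B' := Rmax B 0). assert (HB0 : 0 <= B') by apply Rmax_r.
assert (HBB : B <= B') by apply Rmax_l.
set (D := A + 2 * Y * (B' + m)).
assert (HD : 0 < D) by (unfold D; nra).
assert (Hd2 : 0 < d ^ 2) by nra.
assert (Key : forall lam, 0 < lam -> m * d * exp (- lam * d ^ 2 / 4) <= D * exp (- lam * d ^ 2)).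
{ intros lam Hl.
  set (g := fun y => exp (- lam * (y - t0) ^ 2)).
  assert (Hc : forall x, continuous g x).
  { intros x. apply (ex_derive_continuous (V := R_NormedModule)). unfold g. auto_derive. auto. }
  assert (He : ex_RInt g (t0 - Y) (t0 + Y)).
  { apply (ex_RInt_continuous (V := R_CompleteNormedModule)). auto. }
  (* Pointwise, r g >= m g - (B' + m) exp(-lam d^2): within distance d of t0 because r >= m, farther
     out because g <= exp(-lam d^2) and r - m >= -(B' + m). *)
  assert (H1 : RInt (fun y => minus (scal m (g y)) ((B' + m) * exp (- lam * d ^ 2))) (t0 - Y) (t0 + Y)
     <= RInt (fun y => r y * g y) (t0 - Y) (t0 + Y)).
  { apply RInt_le; [lra| | |].
    - apply (ex_RInt_minus (V := R_NormedModule)).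
      + now apply (ex_RInt_scal (V := R_NormedModule)).
      + apply ex_RInt_const.
    - apply (ex_RInt_continuous (V := R_CompleteNormedModule)). intros z _.
      apply (continuous_mult (K := R_AbsRing)); auto.
    - intros y Hy. unfold minus, scal, plus, opp; simpl; unfold mult; simpl.
      assert (Hgy : 0 < g y) by apply exp_pos.
      assert (He0 := exp_pos (- lam * d ^ 2)).
      destruct (Rle_dec (Rabs (y - t0)) d) as [Hin|Hout].
      + specialize (Hrm y Hin). unfold Rminus in *. simpl in *.
        assert (0 <= (B' + m) * exp (- lam * (d * (d * 1)))) by (apply Rmult_le_pos; lra).
        assert (m * g y <= r y * g y) by (apply Rmult_le_compat_r; lra). simpl. lra.
      + assert (Hge : g y <= exp (- lam * d ^ 2)).
        { apply exp_le. assert (Hsq : d ^ 2 <= (y - t0) ^ 2).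
          { rewrite <- (pow2_abs (y - t0)). apply pow_incr. lra. }
          nra. }
        specialize (HrB y ltac:(lra)).
        assert (- (B' + m) * g y <= (r y - m) * g y) by (apply Rmult_le_compat_r; lra).
        assert ((B' + m) * g y <= (B' + m) * exp (- lam * d ^ 2)) by (apply Rmult_le_compat_l; lra).
        simpl in *. lra. }
  assert (H2 : RInt (fun y => minus (scal m (g y)) ((B' + m) * exp (- lam * d ^ 2))) (t0 - Y) (t0 + Y)
     = m * RInt g (t0 - Y) (t0 + Y) - 2 * Y * ((B' + m) * exp (- lam * d ^ 2))).
  { apply is_RInt_unique.
    replace (m * RInt g (t0 - Y) (t0 + Y) - 2 * Y * ((B' + m) * exp (- lam * d ^ 2)))
      with (minus (scal m (RInt g (t0 - Y) (t0 + Y)))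
        (scal (t0 + Y - (t0 - Y)) ((B' + m) * exp (- lam * d ^ 2))))
      by (unfold minus, scal, plus, opp; simpl; unfold mult; simpl; ring).
    apply (is_RInt_minus (V := R_NormedModule)).
    - apply (is_RInt_scal (V := R_NormedModule)).
      now apply (RInt_correct (V := R_CompleteNormedModule)).
    - apply (is_RInt_const (V := R_NormedModule)). }
  assert (H3 := RInt_gauss_lower lam t0 Y d Hd Hl). fold g in H3.
  specialize (Hint lam Hl). fold g in Hint.
  assert (H4 : exp (- lam * eta) <= exp (- lam * d ^ 2)) by (apply exp_le; nra).
  assert (H5 : A * exp (- lam * eta) <= A * exp (- lam * d ^ 2)) by (apply Rmult_le_compat_l; lra).
  assert (H6 : m * (d * exp (- lam * d ^ 2 / 4)) <= m * RInt g (t0 - Y) (t0 + Y))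
    by (apply Rmult_le_compat_l; lra).
  change (RInt (fun y => r y * exp (- lam * (y - t0) ^ 2)) (t0 - Y) (t0 + Y))
    with (RInt (fun y => r y * g y) (t0 - Y) (t0 + Y)) in Hint.
  unfold D. lra. }
(* Chosen so that 3 lam d^2 / 4 = D / (m d); then m d exp(D / (m d)) >= m d + D > D contradicts
   [Key]. *)
set (lam := 4 * D / (3 * d ^ 2 * (m * d))).
assert (Hmd : 0 < m * d) by nra.
assert (Hl : 0 < lam) by (unfold lam; apply Rdiv_lt_0_compat; nra).
specialize (Key lam Hl).
assert (E : exp (- lam * d ^ 2 / 4) = exp (- lam * d ^ 2) * exp (3 * lam * d ^ 2 / 4))
  by (rewrite <- exp_plus; f_equal; field).
rewrite E in Key.
assert (Hx : 3 * lam * d ^ 2 / 4 = D / (m * d)).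
{ unfold lam. field. lra. }
assert (H1 := exp_ineq1_le (3 * lam * d ^ 2 / 4)). rewrite Hx in H1, Key.
assert (H2 := exp_pos (- lam * d ^ 2)).
assert (H3 : m * d * exp (D / (m * d)) <= D).
{ apply Rmult_le_reg_r with (exp (- lam * d ^ 2)); auto. lra. }
assert (H4 : m * d * (1 + D / (m * d)) = m * d + D) by (field; lra).
nra.
Qed.

(* Cauchy's theorem for f(z) exp(lam (z - z0)^2) with z0 = b + i t0: on the
   horizontal sides the weight is at most exp(-lam (Y^2 - (a - b)^2)), while on
   the side through z0 it concentrates at z0 as lam tends to infinity. *)
Theorem entire_zero_segment (f : C -> C) (a b t0 Y : R) :
  entire f -> b < a -> a - b < Y ->
  (forall t, t0 - Y <= t <= t0 + Y -> f (a, t) = 0) -> f (b, t0) = 0.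
Proof.
intros Hf Hba HY Hz.
assert (Hc : forall z, Ccont f z) by (intros; now apply entire_cont).
set (c := f (b, t0)). apply Cmod_eq_0.
destruct (Req_dec (Cmod c) 0) as [|Hne]; auto. exfalso.
assert (Hcp : 0 < Cmod c) by (assert (H := Cmod_ge_0 c); lra).
destruct (Ccont_bounded_hor f b a (t0 - Y) Hc) as [M1 HM1].
destruct (Ccont_bounded_hor f b a (t0 + Y) Hc) as [M2 HM2].
destruct (Ccont_bounded_ver f b (t0 - Y) (t0 + Y) Hc) as [M3 HM3].
set (X := a - b). set (eta := Y ^ 2 - X ^ 2).
assert (Heta : 0 < eta) by (unfold eta, X; nra).
assert (HM1p : 0 <= M1) by (eapply Rle_trans; [apply Cmod_ge_0|apply (HM1 b); lra]).
assert (HM2p : 0 <= M2) by (eapply Rle_trans; [apply Cmod_ge_0|apply (HM2 b); lra]).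
(* Rotation by the conjugate of c makes the value at t0 equal to |c|^2, so that a real integrand
   suffices. *)
set (r := fun y => Re (Cconj c * f (b, y))%C).
destruct (Hc (b, t0) (Cmod c / 2) ltac:(lra)) as [d0 [Hd0 Hfd]].
(* Within d0 the value of f differs from c by less than |c| / 2, which gives r >= |c|^2 / 2; the
   bound by [sqrt eta] is the condition d^2 <= eta of the concentration lemma. *)
set (d := Rmin (d0 / 2) (Rmin Y (sqrt eta))).
assert (Hsq := sqrt_lt_R0 eta Heta).
assert (Hd1 : d <= d0 / 2) by apply Rmin_l.
assert (Hd2 : d <= Y) by (eapply Rle_trans; [apply Rmin_r|apply Rmin_l]).
assert (Hd3 : d <= sqrt eta) by (eapply Rle_trans; [apply Rmin_r|apply Rmin_r]).
assert (Hdp : 0 < d) by (repeat apply Rmin_glb_lt; lra).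
apply (gauss_concentration r t0 Y eta (Cmod c * (X * M1 + X * M2)) (Cmod c * M3) (Cmod c ^ 2 / 2) d);
  try split; auto.
- nra.
- rewrite <- (pow2_sqrt eta) by lra. apply pow_incr; lra.
- apply Rmult_le_pos; [lra|]. unfold X; nra.
- intros y.
  assert (H : continuous (U := C_R_CompleteNormedModule) (fun t => f (b, t)) y)
    by (apply Ccont_ver; auto).
  assert (Hre : forall y, r y = Re c * Re (f (b, y)) + Im c * Im (f (b, y))).
  { intros t. unfold r. destruct c, (f (b, t)); simpl. ring. }
  apply (continuous_ext (fun t => Re c * Re (f (b, t)) + Im c * Im (f (b, t)))).
  { intros; now rewrite Hre. }
  apply (continuous_plus (V := R_NormedModule)).
  + apply (continuous_scal_r (V := R_NormedModule) (Re c)).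
    apply (continuous_comp (fun t => f (b, t)) (fun z : R * R => fst z)); auto.
    apply continuous_fst.
  + apply (continuous_scal_r (V := R_NormedModule) (Im c)).
    apply (continuous_comp (fun t => f (b, t)) (fun z : R * R => snd z)); auto.
    apply continuous_snd.
- intros y Hy.
  assert (Hlt : Cmod ((b, y) - (b, t0))%C < d0).
  { replace ((b, y) - (b, t0))%C with (Ci * RtoC (y - t0))%C
      by (unfold Cminus, Cplus, Cmult, Copp, Ci, RtoC; simpl; f_equal; ring).
    rewrite Cmod_mult, Cmod_Ci, Cmod_R. lra. }
  specialize (Hfd _ Hlt). fold c in Hfd.
  assert (Hre : r y = Cmod c ^ 2 + Re (Cconj c * (f (b, y) - c))%C).
  { rewrite Cmod2_alt. unfold r. destruct c as [c1 c2], (f (b, y)) as [f1 f2]; simpl. ring. }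
  rewrite Hre. assert (H := re_le_Cmod (Cconj c * (f (b, y) - c))%C).
  rewrite Cmod_mult, Cmod_conj in H. apply Rabs_le_between in H. nra.
- intros y Hy. assert (H := re_le_Cmod (Cconj c * f (b, y))%C). fold (r y) in H.
  rewrite Cmod_mult, Cmod_conj in H. apply Rabs_le_between in H.
  specialize (HM3 y Hy). nra.
- intros lam Hl.
  set (k := fun z : C => Cexp ((0 + lam * (((- (b, t0)) + 1 * z) * ((- (b, t0)) + 1 * z))))%C).
  assert (Hk : entire k).
  { unfold k. apply (entire_comp Cexp (fun z => 0 + lam * ((- (b, t0) + 1 * z) * (- (b, t0) + 1 * z)))%C).
    - apply entire_Cexp.
    - apply (entire_comp (fun w => 0 + lam * w)%C).
      + apply entire_affine.
      + apply entire_mult; apply entire_affine. }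
  assert (Hkm : forall x y, Cmod (k (x, y)) = exp (lam * ((x - b) ^ 2 - (y - t0) ^ 2))).
  { intros x y. unfold k. rewrite Cmod_Cexp. f_equal. simpl. ring. }
  assert (HH : entire (fun z => f z * k z)%C) by now apply entire_mult.
  assert (Hcc : forall z, Ccont (fun z => f z * k z)%C z) by (intros; now apply entire_cont).
  assert (G := Goursat _ b a (t0 - Y) (t0 + Y) HH Hba ltac:(lra)).
  unfold Rect_int in G.
  assert (I0 : CInt (fun y => f (a, y) * k (a, y))%C (t0 - Y) (t0 + Y) = RtoC 0).
  { apply Cmod_eq_0. apply Rle_antisym; [|apply Cmod_ge_0].
    replace 0 with ((t0 + Y - (t0 - Y)) * 0) by ring.
    apply (is_CInt_bound_cst (fun y => f (a, y) * k (a, y))%C); [lra| |].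
    - intros x Hx. rewrite Hz by lra. rewrite Cmult_0_l, Cmod_0. lra.
    - exact (CInt_ver (fun z => f z * k z)%C a (t0 - Y) (t0 + Y) Hcc). }
  assert (Hh : forall e M, (e - t0) ^ 2 = Y ^ 2 -> (forall x, b <= x <= a -> Cmod (f (x, e)) <= M) ->
    Cmod (CInt (fun x => f (x, e) * k (x, e))%C b a) <= X * (M * exp (- lam * eta))).
  { intros e M He HM. apply (is_CInt_bound_cst (fun x => f (x, e) * k (x, e))%C); [lra| |].
    - intros x Hx. rewrite Cmod_mult, Hkm. apply Rmult_le_compat; auto; [apply Cmod_ge_0|apply Rlt_le, exp_pos|].
      apply exp_le. rewrite He. unfold eta, X.
      assert ((x - b) ^ 2 <= (a - b) ^ 2) by (apply pow_incr; lra). nra.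
    - exact (CInt_hor (fun z => f z * k z)%C b a e Hcc). }
  assert (J1 := Hh (t0 - Y) M1 ltac:(ring) HM1).
  assert (J2 := Hh (t0 + Y) M2 ltac:(ring) HM2).
  set (h1 := CInt (fun x => f (x, (t0 - Y)%R) * k (x, (t0 - Y)%R))%C b a) in *.
  set (h2 := CInt (fun x => f (x, (t0 + Y)%R) * k (x, (t0 + Y)%R))%C b a) in *.
  set (v2 := CInt (fun y => f (b, y) * k (b, y))%C (t0 - Y) (t0 + Y)) in *.
  assert (Hv2 : is_CInt (fun y => f (b, y) * k (b, y))%C (t0 - Y) (t0 + Y) v2)
    by exact (CInt_ver (fun z => f z * k z)%C b (t0 - Y) (t0 + Y) Hcc).
  rewrite I0 in G.
  assert (E : (Ci * v2 = h1 - h2)%C).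
  { replace (Ci * v2)%C with (h1 - h2 - (h1 - h2 + Ci * (0 - v2)))%C by ring. rewrite G. ring. }
  assert (Bd : Cmod v2 <= (X * M1 + X * M2) * exp (- lam * eta)).
  { replace (Cmod v2) with (Cmod (Ci * v2)%C) by (rewrite Cmod_mult, Cmod_Ci; ring).
    rewrite E. unfold Cminus. eapply Rle_trans; [apply Cmod_triangle|]. rewrite Cmod_opp. lra. }
  assert (Hi := is_CInt_Re _ _ _ _ (is_CInt_scal _ _ _ (Cconj c) _ Hv2)).
  rewrite (is_RInt_unique (V := R_CompleteNormedModule) _ _ _ (Re (Cconj c * v2)%C)).
  + eapply Rle_trans; [apply Rle_abs|]. eapply Rle_trans; [apply re_le_Cmod|].
    rewrite Cmod_mult, Cmod_conj, Rmult_assoc. apply Rmult_le_compat_l; lra.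
  + eapply is_RInt_ext; [|exact Hi]. intros y _. unfold r.
    (* On the vertical line through z0 the square (z - z0)^2 is real and negative or zero, so the
       weight is a real Gaussian. *)
    assert (Ek : k (b, y) = RtoC (exp (- lam * (y - t0) ^ 2))).
    { rewrite <- Cexp_R. unfold k. f_equal.
      unfold Cplus, Cmult, Copp, RtoC; simpl. f_equal; ring. }
    rewrite Ek. destruct c as [c1 c2], (f (b, y)) as [f1 f2]. simpl. ring.
Qed.

(** * Polya's finite identity *)

Fixpoint bsum (f : nat -> R) (n : nat) : R :=
  match n with O => 0 | S n => bsum f n + f n end.

Lemma bsum_ext (f g : nat -> R) (n : nat) :
  (forall i, (i < n)%nat -> f i = g i) -> bsum f n = bsum g n.
Proof.
induction n; intros H; simpl; auto. rewrite (H n) by lia. rewrite IHn; auto.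
Qed.

Lemma bsum_plus (f g : nat -> R) (n : nat) :
  bsum (fun i => f i + g i) n = bsum f n + bsum g n.
Proof. induction n; simpl; lra. Qed.

Lemma bsum_scal (c : R) (f : nat -> R) (n : nat) :
  bsum (fun i => c * f i) n = c * bsum f n.
Proof. induction n; simpl; lra. Qed.

Lemma bsum_const (c : R) (n : nat) : bsum (fun _ => c) n = INR n * c.
Proof. induction n; [simpl; ring|]. rewrite S_INR. simpl. lra. Qed.

Lemma bsum_zero (f : nat -> R) (n : nat) :
  (forall i, (i < n)%nat -> f i = 0) -> bsum f n = 0.
Proof.
intros H. rewrite (bsum_ext _ (fun _ => 0)) by auto. rewrite bsum_const. ring.
Qed.

Lemma bsum_add (f : nat -> R) (n p : nat) :
  bsum f (n + p) = bsum f n + bsum (fun i => f (n + i)%nat) p.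
Proof.
induction p; simpl.
- rewrite Nat.add_0_r. ring.
- rewrite Nat.add_succ_r. simpl. lra.
Qed.

Lemma bsum_S_l (f : nat -> R) (n : nat) :
  bsum f (S n) = f 0%nat + bsum (fun i => f (S i)) n.
Proof. change (S n) with (1 + n)%nat. rewrite bsum_add. simpl. ring. Qed.

Lemma bsum_rev (f : nat -> R) (n : nat) :
  bsum f n = bsum (fun i => f (n - 1 - i)%nat) n.
Proof.
revert f; induction n; intros f; auto.
rewrite bsum_S_l. change (bsum (fun i => f (S n - 1 - i)%nat) (S n))
  with (bsum (fun i => f (S n - 1 - i)%nat) n + f (S n - 1 - n)%nat).
replace (S n - 1 - n)%nat with 0%nat by lia. rewrite Rplus_comm. f_equal.
rewrite (IHn (fun i => f (S i))). apply bsum_ext. intros i Hi. f_equal. lia.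
Qed.

Lemma bsum_exchange (f : nat -> nat -> R) (n p : nat) :
  bsum (fun i => bsum (fun j => f i j) p) n = bsum (fun j => bsum (fun i => f i j) n) p.
Proof.
induction n; simpl.
- symmetry. apply bsum_zero. auto.
- now rewrite IHn, bsum_plus.
Qed.

(** Among the numbers l N + 1, ..., l N + l only the last is a multiple of l. *)
Lemma bsum_multiples (g : nat -> R) (l N : nat) : (0 < l)%nat ->
  bsum (fun i => if (S i mod l =? 0)%nat then g (S i) else 0) (l * N)
  = bsum (fun j => g (S j * l)%nat) N.
Proof.
intros Hl. induction N.
- rewrite Nat.mul_0_r. reflexivity.
- rewrite Nat.mul_succ_r, bsum_add, IHN. 
  change (bsum (fun j => g (S j * l)%nat) (S N))
    with (bsum (fun j => g (S j * l)%nat) N + g (S N * l)%nat).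
  f_equal. destruct l as [|l]; [lia|]. cbn [bsum]. rewrite bsum_zero.
  + replace (S (S l * N + l))%nat with (S N * S l)%nat by lia.
    rewrite Nat.Div0.mod_mul, Nat.eqb_refl. ring.
  + intros i Hi.
    replace (S (S l * N + i))%nat with (S i + N * S l)%nat by lia.
    rewrite Nat.Div0.mod_add, Nat.mod_small by lia. reflexivity.
Qed.

(* [cbin m nu] is the binomial coefficient C(2m, m + nu), i.e. the coefficient
   of z^nu in (z^(1/2) + z^(-1/2))^(2m). *)
Fixpoint cbin (m nu : nat) : R :=
  match m with
  | O => match nu with O => 1 | S _ => 0 end
  | S m => match nu with
           | O => 2 * cbin m 0 + 2 * cbin m 1
           | S nu' => cbin m nu' + 2 * cbin m nu + cbin m (S nu)
           end
  end.

Lemma cbin_pos (m nu : nat) : 0 <= cbin m nu.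
Proof.
revert nu; induction m; intros [|nu]; simpl; try lra.
- assert (H := IHm 0%nat); assert (H1 := IHm 1%nat); lra.
- assert (H := IHm nu); assert (H1 := IHm (S nu)); assert (H2 := IHm (S (S nu))); lra.
Qed.

Lemma cbin_0_pos (m : nat) : 0 < cbin m 0.
Proof. induction m; simpl; [lra|]. assert (H := cbin_pos m 1). lra. Qed.

Lemma cbin_zero (m nu : nat) : (m < nu)%nat -> cbin m nu = 0.
Proof.
revert nu; induction m; intros [|nu] H; simpl; try lia; auto.
rewrite !IHm by lia. ring.
Qed.

(** The ratio (m - nu) / (m + nu + 1) of neighbouring binomial coefficients, cleared of denominators
    so that it also holds beyond nu = m, where both vanish. All asymptotics of [cbin] come from
    it. *)
Lemma cbin_succ (m nu : nat) :
  (INR m + INR nu + 1) * cbin m (S nu) = (INR m - INR nu) * cbin m nu.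
Proof.
revert nu; induction m; intros nu.
- destruct nu; simpl; ring.
- rewrite S_INR. destruct nu as [|nu].
  + cbn [cbin]. assert (H0 := IHm 0%nat). assert (H1 := IHm 1%nat). simpl INR in *.
    assert (H2 : (INR m + 1) * cbin m 1 = INR m * cbin m 0) by lra.
    assert (H3 : (INR m + 2) * cbin m 2 = (INR m - 1) * cbin m 1) by lra.
    lra.
  + cbn [cbin]. assert (H0 := IHm nu). assert (H1 := IHm (S nu)).
    assert (H2 := IHm (S (S nu))). rewrite !S_INR in *. lra.
Qed.

(** Reindexing moves the neighbours from c to a; in the application the boundary terms at N
    vanish. *)
Lemma cbin_cos_telescope (a c : nat -> R) (N : nat) :
  bsum (fun i => a (S i) * (c (S (S i)) + c i)) N + c 1%nat * a 0%nat + a (S N) * c N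
  = a 1%nat * c 0%nat + bsum (fun i => (a i + a (S (S i))) * c (S i)) N + a N * c (S N).
Proof. induction N; simpl bsum; [ring|]. lra. Qed.

(** The binomial expansion of (e^(i phi) + e^(-i phi))^(2m) with the terms for nu and -nu paired. In
    the induction, multiplying by (2 cos phi)^2 = 2 + 2 cos(2 phi) reproduces the recurrence of
    [cbin]. *)
Lemma cos_pow_cbin (phi : R) (m N : nat) : (m <= N)%nat ->
  (2 * cos phi) ^ (2 * m)
  = cbin m 0 + 2 * bsum (fun i => cbin m (S i) * cos (2 * INR (S i) * phi)) N.
Proof.
induction m; intros HN.
- rewrite bsum_zero; [simpl; ring|]. intros; simpl; ring.
- replace (2 * S m)%nat with (2 + 2 * m)%nat by lia. rewrite pow_add, IHm by lia.
  set (c := fun i : nat => cos (2 * INR i * phi)).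
  set (a := cbin m).
  assert (Hc0 : c 0%nat = 1) by (unfold c; simpl; rewrite Rmult_0_r, Rmult_0_l, cos_0; auto).
  assert (Hsq : (2 * cos phi) ^ 2 = 2 + 2 * c 1%nat).
  { unfold c. simpl INR. rewrite Rmult_1_r, cos_2a_cos. ring. }
  assert (Hc : forall i, 2 * c 1%nat * c (S i) = c (S (S i)) + c i).
  { intros i. unfold c. rewrite !S_INR. simpl INR.
    replace (2 * (INR i + 1 + 1) * phi) with (2 * (INR i + 1) * phi + 2 * phi) by ring.
    replace (2 * INR i * phi) with (2 * (INR i + 1) * phi - 2 * phi) by ring.
    rewrite cos_plus, cos_minus.
    replace (2 * (0 + 1) * phi) with (2 * phi) by ring. ring. }
  rewrite Hsq. cbn [cbin]. fold a.
  assert (E1 : 2 * c 1%nat * bsum (fun i => a (S i) * c (S i)) N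
    = bsum (fun i => a (S i) * (c (S (S i)) + c i)) N).
  { rewrite <- bsum_scal. apply bsum_ext. intros i _. rewrite <- Hc. ring. }
  assert (E2 : bsum (fun i => (a i + 2 * a (S i) + a (S (S i))) * c (S i)) N
    = bsum (fun i => (a i + a (S (S i))) * c (S i)) N + 2 * bsum (fun i => a (S i) * c (S i)) N).
  { rewrite <- bsum_scal, <- bsum_plus. apply bsum_ext. intros; ring. }
  fold c.
  change (bsum (fun i => a (S i) * cos (2 * INR (S i) * phi)) N) with (bsum (fun i => a (S i) * c (S i)) N).
  change (bsum (fun i => (a i + 2 * a (S i) + a (S (S i))) * cos (2 * INR (S i) * phi)) N)
    with (bsum (fun i => (a i + 2 * a (S i) + a (S (S i))) * c (S i)) N).
  rewrite E2. assert (T := cbin_cos_telescope a c N).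
  assert (Z1 : a N = 0) by (apply cbin_zero; lia).
  assert (Z2 : a (S N) = 0) by (apply cbin_zero; lia).
  rewrite Z1, Z2, Hc0 in T.
  replace ((2 + 2 * c 1%nat) * (a 0%nat + 2 * bsum (fun i => a (S i) * c (S i)) N))
    with (2 * a 0%nat + 4 * bsum (fun i => a (S i) * c (S i)) N + 2 * c 1%nat * a 0%nat
      + 2 * (2 * c 1%nat * bsum (fun i => a (S i) * c (S i)) N)) by ring.
  rewrite E1. lra.
Qed.

(** Each product 2 sin(t/2) cos(k t) is sin((k + 1/2) t) - sin((k - 1/2) t). *)
Lemma sum_cos_telescope (t : R) (n : nat) :
  2 * sin (t / 2) * bsum (fun k => cos (INR k * t)) n
  = sin ((INR n - / 2) * t) + sin (t / 2).
Proof.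
induction n.
- simpl. replace ((0 - / 2) * t) with (- (t / 2)) by field. rewrite sin_neg. ring.
- simpl bsum. rewrite Rmult_plus_distr_l, IHn, S_INR.
  replace ((INR n + 1 - / 2) * t) with (INR n * t + t / 2) by field.
  replace ((INR n - / 2) * t) with (INR n * t - t / 2) by field.
  rewrite sin_plus, sin_minus. ring.
Qed.

(** The real part of the sum of the nu-th powers of the l-th roots of unity. *)
Lemma sum_cos_roots_of_unity (l nu : nat) : (0 < l)%nat ->
  bsum (fun k => cos (2 * INR nu * (PI * INR k / INR l))) l
  = if (nu mod l =? 0)%nat then INR l else 0.
Proof.
intros Hl. assert (HL : INR l <> 0) by (apply not_0_INR; lia).
destruct (Nat.eqb_spec (nu mod l) 0) as [H|H].
- rewrite (bsum_ext _ (fun _ => 1)); [rewrite bsum_const; ring|].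
  intros k _. apply Nat.Lcm0.mod_divide in H. destruct H as [j ->]. rewrite mult_INR.
  replace (2 * (INR j * INR l) * (PI * INR k / INR l)) with (0 + 2 * INR (j * k) * PI)
    by (rewrite mult_INR; field; auto).
  rewrite cos_period, cos_0. auto.
- set (t := 2 * INR nu * PI / INR l).
  rewrite (bsum_ext _ (fun k => cos (INR k * t))).
  2: { intros k _. f_equal. unfold t. field. auto. }
  assert (T := sum_cos_telescope t l).
  replace ((INR l - / 2) * t) with (- (t / 2) + 2 * INR nu * PI) in T by (unfold t; field; auto).
  rewrite sin_period, sin_neg in T.
  (* By periodicity the telescoped sum is zero; it remains to divide by sin(t/2), which vanishes
     only if l divides nu. *)
  assert (Hs : sin (t / 2) <> 0).
  { intros Hs. apply sin_eq_0_0 in Hs. destruct Hs as [k Hk].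
    assert (E : INR nu = IZR k * INR l).
    { apply Rmult_eq_reg_r with PI; [|apply PI_neq0].
      apply Rmult_eq_reg_r with (/ INR l); [|now apply Rinv_neq_0_compat].
      replace (INR nu * PI * / INR l) with (t / 2) by (unfold t; field; auto).
      rewrite Hk. field; auto. }
    rewrite !INR_IZR_INZ, <- mult_IZR in E. apply eq_IZR in E.
    apply H. apply Nat2Z.inj. rewrite Nat2Z.inj_mod, E. simpl.
    apply Z_mod_mult. }
  apply Rmult_eq_reg_l with (2 * sin (t / 2)); [lra|]. lra.
Qed.

Theorem Polya_identity (l m N : nat) : (0 < l)%nat -> (m <= l * N)%nat ->
  bsum (fun k => (2 * cos (PI * INR k / INR l)) ^ (2 * m)) l
  = INR l * (cbin m 0 + 2 * bsum (fun j => cbin m (S j * l)) N).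
Proof.
intros Hl HN.
rewrite (bsum_ext _ (fun k => cbin m 0 + bsum (fun i =>
  2 * (cbin m (S i) * cos (2 * INR (S i) * (PI * INR k / INR l)))) (l * N))).
2: { intros k _. rewrite (cos_pow_cbin _ m (l * N)) by auto. now rewrite bsum_scal. }
rewrite bsum_plus, bsum_const, bsum_exchange, Rmult_plus_distr_l. f_equal.
rewrite <- (bsum_multiples (cbin m)) by auto.
rewrite <- Rmult_assoc, <- bsum_scal. apply bsum_ext. intros i _.
rewrite !bsum_scal, sum_cos_roots_of_unity by auto.
destruct (S i mod l =? 0)%nat; ring.
Qed.

(** The residues k and l - k contribute equal even powers, so the l - 1 nonzero ones fold onto 1,
    ..., q. Dividing by 4^m and by the central coefficient prepares both sums for a termwise
    limit. *)
Lemma Polya_identity_odd (q m : nat) :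
  1 + 2 * bsum (fun k => cos (PI * INR (S k) / INR (2 * q + 1)) ^ (2 * m)) q
  = INR (2 * q + 1) * (cbin m 0 / 4 ^ m)
    * (1 + 2 * bsum (fun j => cbin m (S j * (2 * q + 1)) / cbin m 0) m).
Proof.
set (l := (2 * q + 1)%nat).
assert (HL : INR l <> 0) by (apply not_0_INR; unfold l; lia).
assert (H4 : 4 ^ m <> 0) by (apply pow_nonzero; lra).
assert (P := Polya_identity l m m ltac:(unfold l; lia) ltac:(unfold l; nia)).
set (g := fun k : nat => cos (PI * INR k / INR l) ^ (2 * m)).
assert (E1 : bsum (fun k => (2 * cos (PI * INR k / INR l)) ^ (2 * m)) l = 4 ^ m * bsum g l).
{ rewrite <- bsum_scal. apply bsum_ext. intros k _. unfold g.
  rewrite Rpow_mult_distr, pow_mult. f_equal. f_equal. ring. }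
assert (Hsym : forall k, (k <= l)%nat -> g (l - k)%nat = g k).
{ intros k Hk. unfold g. rewrite !pow_mult. f_equal. rewrite minus_INR by auto.
  replace (PI * (INR l - INR k) / INR l) with (PI - PI * INR k / INR l) by (field; auto).
  rewrite cos_minus, cos_PI, sin_PI. ring. }
assert (E2 : bsum g l = 1 + 2 * bsum (fun k => g (S k)) q).
{ replace l with (S (q + q)) by (unfold l; lia).
  rewrite bsum_S_l, bsum_add.
  rewrite (bsum_rev (fun i => g (S (q + i)))).
  rewrite (bsum_ext (fun i => g (S (q + (q - 1 - i)))) (fun i => g (S i))).
  - unfold g at 1. simpl INR. rewrite Rmult_0_r. unfold Rdiv. rewrite Rmult_0_l, cos_0, pow1. ring.
  - intros i Hi. rewrite <- (Hsym (S i)) by (unfold l; lia). f_equal. unfold l. lia. }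
rewrite E1, E2 in P.
change (bsum (fun k => cos (PI * INR (S k) / INR l) ^ (2 * m)) q) with (bsum (fun k => g (S k)) q).
apply Rmult_eq_reg_l with (4 ^ m); auto. rewrite P.
rewrite (bsum_ext (fun j => cbin m (S j * l) / cbin m 0) (fun j => / cbin m 0 * cbin m (S j * l)))
  by (intros; unfold Rdiv; ring).
rewrite bsum_scal. field. split; auto. assert (H := cbin_0_pos m). lra.
Qed.

(** * Passage to the limit *)

Lemma bsum_sum_n (f : nat -> R) (n : nat) : sum_n f n = bsum f (S n).
Proof.
induction n; [rewrite sum_O; simpl; ring|].
rewrite sum_Sn, IHn. reflexivity.
Qed.

Lemma is_series_bsum (f : nat -> R) (N : nat) :
  (forall i, (N <= i)%nat -> f i = 0) -> is_series f (bsum f N).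
Proof.
intros H. change (is_lim_seq (sum_n f) (bsum f N)).
apply (is_lim_seq_ext_loc (fun _ => bsum f N)); [|apply is_lim_seq_const].
exists N. intros n Hn. rewrite bsum_sum_n.
replace (S n) with (N + (S n - N))%nat by lia. rewrite bsum_add.
rewrite (bsum_zero (fun i => f (N + i)%nat)); [ring|]. intros; apply H; lia.
Qed.

Lemma Series_bsum (f : nat -> R) (N : nat) :
  (forall i, (N <= i)%nat -> f i = 0) -> Series f = bsum f N.
Proof. intros H. now apply is_series_unique, is_series_bsum. Qed.

Lemma Series_bsum_tail (f : nat -> R) (N : nat) : ex_series f ->
  Series f = bsum f N + Series (fun i => f (N + i)%nat).
Proof.
intros H. destruct N as [|N].
- simpl. rewrite Rplus_0_l. now apply Series_ext.
- rewrite (Series_incr_n f (S N)) by (auto; lia). f_equal.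
  simpl pred. rewrite <- sum_n_Reals. apply bsum_sum_n.
Qed.

Lemma ex_series_Rabs_le (a b : nat -> R) :
  (forall n, Rabs (a n) <= b n) -> ex_series b -> ex_series a.
Proof.
intros H Hb. apply (ex_series_le (K := R_AbsRing) (V := R_CompleteNormedModule) a b); auto.
Qed.

Lemma Series_Rabs_le (a b : nat -> R) :
  (forall n, Rabs (a n) <= b n) -> ex_series b -> Rabs (Series a) <= Series b.
Proof.
intros H Hb. eapply Rle_trans; [apply Series_Rabs|].
- apply (ex_series_Rabs_le _ b); auto. intros n. now rewrite Rabs_Rabsolu.
- apply Series_le; auto. intros n; split; auto. apply Rabs_pos.
Qed.

Lemma is_lim_seq_bsum (a : nat -> nat -> R) (l : nat -> R) (N : nat) :
  (forall k, is_lim_seq (fun n => a n k) (l k)) ->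
  is_lim_seq (fun n => bsum (a n) N) (bsum l N).
Proof.
intros H. induction N; simpl; [apply is_lim_seq_const|]. now apply is_lim_seq_plus'.
Qed.

Lemma Tannery (a : nat -> nat -> R) (l b : nat -> R) :
  (forall k, is_lim_seq (fun n => a n k) (l k)) ->
  (forall n k, Rabs (a n k) <= b k) -> ex_series b ->
  is_lim_seq (fun n => Series (a n)) (Series l).
Proof.
intros Hl Hb Hs.
assert (Hlb : forall k, Rabs (l k) <= b k).
{ intros k. assert (H := is_lim_seq_abs _ _ (Hl k)). simpl in H.
  apply (is_lim_seq_le (fun n => Rabs (a n k)) (fun _ => b k) (Rabs (l k)) (b k)); auto.
  apply is_lim_seq_const. }
apply is_lim_seq_spec. intros eps.
assert (Ht : is_lim_seq (fun N => Series (fun i => b (N + i)%nat)) 0).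
{ apply (is_lim_seq_ext (fun N => Series b - bsum b N)).
  - intros N. rewrite (Series_bsum_tail b N) by auto. ring.
  - replace 0 with (Series b - Series b) by ring.
    apply is_lim_seq_minus'; [apply is_lim_seq_const|].
    apply is_lim_seq_incr_1. apply (is_lim_seq_ext (sum_n b)).
    + intros n. apply bsum_sum_n.
    + now apply Series_correct. }
assert (He : 0 < eps / 3) by (assert (H := cond_pos eps); lra).
apply is_lim_seq_spec in Ht. destruct (Ht (mkposreal _ He)) as [N HN].
specialize (HN N (le_n N)). simpl in HN. rewrite Rminus_0_r in HN.
assert (HbN : ex_series (fun i => b (N + i)%nat)) by now apply ex_series_incr_n.
assert (Hf := is_lim_seq_bsum a l N Hl). apply is_lim_seq_spec in Hf.
destruct (Hf (mkposreal _ He)) as [n0 Hn0]. exists n0. intros n Hn. specialize (Hn0 n Hn). simpl in Hn0.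
rewrite (Series_bsum_tail (a n) N) by (apply (ex_series_Rabs_le _ b); auto).
rewrite (Series_bsum_tail l N) by (apply (ex_series_Rabs_le _ b); auto).
assert (H1 := Series_Rabs_le (fun i => a n (N + i)%nat) _ ltac:(intros; apply Hb) HbN).
assert (H2 := Series_Rabs_le (fun i => l (N + i)%nat) _ ltac:(intros; apply Hlb) HbN).
assert (H3 := Rle_abs (Series (fun i => b (N + i)%nat))).
apply Rabs_lt_between. apply Rabs_lt_between in Hn0.
apply Rabs_le_between in H1, H2. lra.
Qed.

(** * Exponential, trigonometric and binomial estimates *)

Lemma exp_mult_INR (x : R) (n : nat) : exp (INR n * x) = exp x ^ n.
Proof.
induction n; [simpl; rewrite Rmult_0_l; apply exp_0|].
rewrite S_INR. simpl. rewrite <- IHn, <- exp_plus. f_equal. ring.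
Qed.

Lemma ex_series_exp (c : R) : 0 < c -> ex_series (fun k => exp (- c * INR (S k))).
Proof.
intros Hc. apply (ex_series_ext (fun k => exp (- c) ^ S k)).
- intros k. rewrite <- exp_mult_INR. f_equal. ring.
- rewrite <- (ex_series_incr_1 (fun k => exp (- c) ^ k)). apply ex_series_geom.
  rewrite Rabs_pos_eq by apply Rlt_le, exp_pos. rewrite <- exp_0.
  apply exp_increasing. lra.
Qed.

Lemma sqr_ge_self (k : nat) : INR (S k) <= INR (S k) ^ 2.
Proof. assert (H := pos_INR k). rewrite S_INR. nra. Qed.

Lemma ex_series_gauss (c : R) : 0 < c -> ex_series (fun k => exp (- c * INR (S k) ^ 2)).
Proof.
intros Hc. apply (ex_series_Rabs_le _ (fun k => exp (- c * INR (S k)))); [|now apply ex_series_exp].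
intros k. rewrite Rabs_pos_eq by apply Rlt_le, exp_pos. apply exp_le.
assert (H := sqr_ge_self k). nra.
Qed.

(** Here (1 - w) (1 + w + 2 w^2) = 1 + w^2 (1 - 2 w) >= 1, and exp(w + 2 w^2) dominates the second
    factor. *)
Lemma exp_neg_lower (w : R) : 0 <= w <= 1 / 2 -> exp (- w - 2 * w ^ 2) <= 1 - w.
Proof.
intros Hw. assert (H1 := exp_ineq1_le (w + 2 * w ^ 2)).
replace (- w - 2 * w ^ 2) with (- (w + 2 * w ^ 2)) by ring. rewrite exp_Ropp.
assert (H2 : 1 <= (1 - w) * (1 + (w + 2 * w ^ 2))) by nra.
assert (H3 := exp_pos (w + 2 * w ^ 2)).
apply Rmult_le_reg_r with (exp (w + 2 * w ^ 2)); auto. rewrite Rinv_l by lra. nra.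
Qed.

(** Squeezed between exp(-m w - 2 m w^2) and exp(-m w), where m w^2 = (m w) w tends to 0. *)
Lemma pow_limit_exp (w : nat -> R) (m : nat -> nat) (c : R) :
  (forall n, 0 <= w n) -> is_lim_seq w 0 ->
  is_lim_seq (fun n => INR (m n) * w n) c ->
  is_lim_seq (fun n => (1 - w n) ^ m n) (exp (- c)).
Proof.
intros Hw Hw0 Hc.
apply (is_lim_seq_le_le_loc (fun n => exp (- (INR (m n) * w n) - 2 * ((INR (m n) * w n) * w n))) _
  (fun n => exp (- (INR (m n) * w n)))).
- apply is_lim_seq_spec in Hw0. destruct (Hw0 (mkposreal (1 / 2) ltac:(lra))) as [N HN].
  exists N. intros n Hn. specialize (HN n Hn). simpl in HN.
  rewrite Rminus_0_r, Rabs_pos_eq in HN by auto. specialize (Hw n).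
  replace (- (INR (m n) * w n) - 2 * (INR (m n) * w n * w n)) with (INR (m n) * (- w n - 2 * w n ^ 2)) by ring.
  replace (- (INR (m n) * w n)) with (INR (m n) * (- w n)) by ring.
  rewrite !exp_mult_INR. split; apply pow_incr; split.
  + apply Rlt_le, exp_pos.
  + apply exp_neg_lower; lra.
  + lra.
  + assert (H := exp_ineq1_le (- w n)). lra.
- apply (is_lim_seq_continuous exp).
  + apply derivable_continuous_pt, derivable_pt_exp.
  + replace (- c) with (- c - 2 * (c * 0)) by ring. apply is_lim_seq_minus'.
    * apply (proj1 (is_lim_seq_opp _ c) Hc).
    * apply is_lim_seq_mult'; [apply is_lim_seq_const|now apply is_lim_seq_mult'].
- apply (is_lim_seq_continuous exp).
  + apply derivable_continuous_pt, derivable_pt_exp.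
  + apply (proj1 (is_lim_seq_opp _ c) Hc).
Qed.

Lemma sin_ge_half (u : R) : 0 <= u <= PI / 2 -> u / 2 <= sin u.
Proof.
intros Hu. assert (HPI := PI_4). assert (HP0 := PI_RGT_0).
destruct (sin_bound u 0) as [H _]; try lra.
unfold sin_approx, sin_term in H. simpl in H.
assert (H' : u - u ^ 3 / 6 <= sin u).
{ eapply Rle_trans; [|exact H]. apply Req_le. field. }
(* Only PI <= 4 is at hand, so u ranges up to 2. Up to 17/10 one has u^2 <= 3 and the cubic bound is
   enough; above it the cosine is expanded about PI / 2. *)
destruct (Rle_dec u (17 / 10)) as [Hs|Hs].
- assert (u ^ 3 <= 3 * u) by nra. lra.
- assert (E : 0 <= (u - 17 / 10)) by lra.
  assert (Hc : cos (PI / 2 - u) = sin u) by apply cos_shift.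
  assert (H2 : u / 2 <= 1) by lra.
  assert (H3 : u <= 2) by lra.
  destruct (cos_bound (PI / 2 - u) 0) as [H4 _]; try lra.
  unfold cos_approx, cos_term in H4. simpl in H4.
  assert (H5 : 1 - (PI / 2 - u) ^ 2 / 2 <= sin u).
  { rewrite <- Hc. eapply Rle_trans; [|exact H4]. apply Req_le. field. }
  nra.
Qed.

(** From cos^2 u = 1 - sin^2 u <= 1 - u^2 / 4 <= exp(-u^2 / 4). *)
Lemma cos_pow_bound (u : R) (m : nat) : 0 <= u <= PI / 2 ->
  Rabs (cos u ^ (2 * m)) <= exp (- (INR m * u ^ 2 / 4)).
Proof.
intros Hu. rewrite pow_mult.
replace (- (INR m * u ^ 2 / 4)) with (INR m * (- (u ^ 2 / 4))) by field.
rewrite exp_mult_INR, Rabs_pos_eq by (apply pow_le, pow2_ge_0).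
apply pow_incr. split; [apply pow2_ge_0|].
assert (H := sin2_cos2 u). unfold Rsqr in H.
assert (H1 := sin_ge_half u Hu). assert (H2 := exp_ineq1_le (- (u ^ 2 / 4))).
nra.
Qed.

(** Each factor (m - nu) / (m + nu + 1) = 1 - (2 nu + 1) / (m + nu + 1) is at most exp(-(2 nu + 1) /
    (m + N)), and the odd numbers sum to a square. Taking N = nu gives the sharp limit, N = m a
    majorant for all indices up to m. *)
Lemma cbin_ratio_upper (m N nu : nat) : (nu <= N)%nat -> (N <= m)%nat ->
  cbin m nu / cbin m 0 <= exp (- (INR nu ^ 2 / INR (m + N))).
Proof.
intros Hn HN. assert (Hp := cbin_0_pos m).
induction nu.
- simpl INR. unfold Rdiv. rewrite Rinv_r by lra.
  replace (- (0 ^ 2 * / INR (m + N))) with 0 by ring. rewrite exp_0. lra.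
- assert (Hd : 0 < INR (m + N)) by (apply lt_0_INR; lia).
  specialize (IHnu ltac:(lia)). assert (HS := cbin_succ m nu).
  assert (Hnu := pos_INR nu). assert (Hm := pos_INR m).
  assert (Hle : INR nu + 1 <= INR N) by (rewrite <- S_INR; apply le_INR; lia).
  assert (HNm : INR N <= INR m) by (now apply le_INR).
  rewrite plus_INR in *. rewrite S_INR.
  replace (- ((INR nu + 1) ^ 2 / (INR m + INR N)))
    with (- (INR nu ^ 2 / (INR m + INR N)) + - ((2 * INR nu + 1) / (INR m + INR N))) by (field; lra).
  rewrite exp_plus.
  replace (cbin m (S nu) / cbin m 0)
    with (cbin m nu / cbin m 0 * ((INR m - INR nu) / (INR m + INR nu + 1))).
  2: { replace (cbin m (S nu)) with ((INR m - INR nu) * cbin m nu / (INR m + INR nu + 1)).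
       - field. lra.
       - rewrite <- HS. field. lra. }
  apply Rmult_le_compat; auto.
  + apply Rdiv_le_0_compat; auto. apply cbin_pos.
  + apply Rdiv_le_0_compat; lra.
  + assert (H := exp_ineq1_le (- ((2 * INR nu + 1) / (INR m + INR N)))).
    eapply Rle_trans; [|exact H].
    replace ((INR m - INR nu) / (INR m + INR nu + 1)) with (1 + - ((2 * INR nu + 1) / (INR m + INR nu + 1)))
      by (field; lra).
    apply Rplus_le_compat_l, Ropp_le_contravar. apply Rmult_le_compat_l; [lra|].
    apply Rinv_le_contravar; lra.
Qed.

(** The same product bounded below by [exp_neg_lower]: the condition 4 N <= m keeps each w below 2 N
    / m <= 1/2, and each factor costs at most 2 (2 N / m)^2 in the exponent. *)
Lemma cbin_ratio_lower (m N nu : nat) : (nu <= N)%nat -> (4 * N <= m)%nat ->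
  exp (- (INR nu ^ 2 / INR m) - INR nu * (2 * (2 * INR N / INR m) ^ 2)) <= cbin m nu / cbin m 0.
Proof.
intros Hn HN. assert (Hp := cbin_0_pos m).
induction nu.
- simpl INR. unfold Rdiv. rewrite Rinv_r by lra.
  replace (- (0 ^ 2 * / INR m) - 0 * (2 * (2 * INR N * / INR m) ^ 2)) with 0 by ring. rewrite exp_0. lra.
- assert (Hd : 0 < INR m) by (apply lt_0_INR; lia).
  specialize (IHnu ltac:(lia)). assert (HS := cbin_succ m nu).
  assert (Hnu := pos_INR nu).
  assert (Hle : INR nu + 1 <= INR N) by (rewrite <- S_INR; apply le_INR; lia).
  assert (HNm : 4 * INR N <= INR m).
  { apply le_INR in HN. rewrite mult_INR in HN. simpl in HN. lra. }
  rewrite S_INR.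
  replace (- ((INR nu + 1) ^ 2 / INR m) - (INR nu + 1) * (2 * (2 * INR N / INR m) ^ 2))
    with ((- (INR nu ^ 2 / INR m) - INR nu * (2 * (2 * INR N / INR m) ^ 2))
      + (- ((2 * INR nu + 1) / INR m) - 2 * (2 * INR N / INR m) ^ 2)) by (field; lra).
  rewrite exp_plus.
  replace (cbin m (S nu) / cbin m 0)
    with (cbin m nu / cbin m 0 * ((INR m - INR nu) / (INR m + INR nu + 1))).
  2: { replace (cbin m (S nu)) with ((INR m - INR nu) * cbin m nu / (INR m + INR nu + 1)).
       - field. lra.
       - rewrite <- HS. field. lra. }
  apply Rmult_le_compat; auto; try (apply Rlt_le, exp_pos).
  set (w := (2 * INR nu + 1) / (INR m + INR nu + 1)).
  assert (Hw0 : 0 <= w) by (apply Rdiv_le_0_compat; lra).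
  assert (Hw1 : w <= (2 * INR nu + 1) / INR m).
  { apply Rmult_le_compat_l; [lra|]. apply Rinv_le_contravar; lra. }
  assert (Hw2 : (2 * INR nu + 1) / INR m <= 2 * INR N / INR m).
  { apply Rmult_le_compat_r; [|lra]. apply Rlt_le, Rinv_0_lt_compat; lra. }
  assert (Hw3 : 2 * INR N / INR m <= 1 / 2) by (apply Rle_div_l; lra).
  replace ((INR m - INR nu) / (INR m + INR nu + 1)) with (1 - w) by (unfold w; field; lra).
  eapply Rle_trans; [|apply exp_neg_lower; lra]. apply exp_le.
  assert (w ^ 2 <= (2 * INR N / INR m) ^ 2) by (apply pow_incr; lra). lra.
Qed.

(** The sequence decreases since (2m + 3) (2m + 1) <= (2m + 2)^2. This is Wallis' product; only the
    existence of the limit is recorded. *)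
Lemma central_cbin_limit : exists b : R,
  is_lim_seq (fun m => INR (2 * m + 1) * (cbin m 0 / 4 ^ m) ^ 2) b.
Proof.
set (u := fun m => INR (2 * m + 1) * (cbin m 0 / 4 ^ m) ^ 2).
destruct (ex_finite_lim_seq_decr u 0) as [b Hb].
- intros m. assert (H1 := cbin_succ m 0). simpl INR in H1.
  assert (Hm := pos_INR m). assert (Hp := cbin_0_pos m).
  assert (H4 : 4 ^ m <> 0) by (apply pow_nonzero; lra).
  assert (E1 : cbin m 1 = INR m * cbin m 0 / (INR m + 1)).
  { apply Rmult_eq_reg_l with (INR m + 1); [|lra].
    replace ((INR m + 1) * (INR m * cbin m 0 / (INR m + 1))) with (INR m * cbin m 0) by (field; lra).
    lra. }
  assert (E : cbin (S m) 0 / 4 ^ S m = cbin m 0 / 4 ^ m * ((2 * INR m + 1) / (2 * INR m + 2))).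
  { cbn [cbin pow]. rewrite E1. field. repeat split; auto; lra. }
  unfold u. rewrite E. set (x := cbin m 0 / 4 ^ m).
  rewrite !plus_INR, !mult_INR, (S_INR m). change (INR 2) with (1 + 1). change (INR 1) with 1.
  replace ((x * ((2 * INR m + 1) / (2 * INR m + 2))) ^ 2)
    with (x ^ 2 * ((2 * INR m + 1) ^ 2 / (2 * INR m + 2) ^ 2)) by (field; lra).
  assert (Hx := pow2_ge_0 x).
  replace (((1 + 1) * (INR m + 1) + 1) * (x ^ 2 * ((2 * INR m + 1) ^ 2 / (2 * INR m + 2) ^ 2)))
    with (x ^ 2 * ((2 * INR m + 1) * ((2 * INR m + 3) * (2 * INR m + 1) / (2 * INR m + 2) ^ 2))) by (field; lra).
  replace (((1 + 1) * INR m + 1) * x ^ 2) with (x ^ 2 * ((2 * INR m + 1) * 1)) by ring.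
  apply Rmult_le_compat_l; auto. apply Rmult_le_compat_l; [lra|].
  apply Rle_div_l; nra.
- intros m. apply Rmult_le_pos; [apply pos_INR|apply pow2_ge_0].
- now exists b.
Qed.

(** * The theta transformation *)

Lemma is_lim_seq_inv_odd : is_lim_seq (fun q => / INR (2 * q + 1)) 0.
Proof.
apply (is_lim_seq_le_le (fun _ => 0) _ (fun q => / INR (S q))).
- intros q. assert (H : 0 < INR (S q)) by (apply lt_0_INR; lia).
  assert (H' : INR (S q) <= INR (2 * q + 1)) by (apply le_INR; lia). split.
  + apply Rlt_le, Rinv_0_lt_compat. lra.
  + apply Rinv_le_contravar; lra.
- apply is_lim_seq_const.
- apply (is_lim_seq_incr_1 (fun q => / INR q)).
  apply (is_lim_seq_inv INR p_infty); [apply is_lim_seq_INR|discriminate].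
Qed.

Lemma odd_pos (q : nat) : 1 <= INR (2 * q + 1).
Proof. rewrite plus_INR, mult_INR. simpl. assert (H := pos_INR q). lra. Qed.

Lemma is_lim_seq_cmult (u : nat -> R) (c l : R) :
  is_lim_seq u l -> is_lim_seq (fun n => c * u n) (c * l).
Proof. intros H. apply is_lim_seq_mult'; [apply is_lim_seq_const|auto]. Qed.

(** With l = 2q + 1 this says m ~ y l^2; the one-sided bound m >= y l^2 and the slack 1 also yield
    majorants uniform in q. *)
Definition scaled_by (y : R) (m : nat -> nat) : Prop :=
  forall q, y * INR (2 * q + 1) ^ 2 <= INR (m q) <= y * INR (2 * q + 1) ^ 2 + 1.

Lemma scaled_by_exists (y : R) : 0 < y -> exists m, scaled_by y m.
Proof.
intros Hy. exists (fun q => Z.to_nat (up (y * INR (2 * q + 1) ^ 2))). intros q.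
destruct (archimed (y * INR (2 * q + 1) ^ 2)) as [H1 H2].
assert (H := odd_pos q).
assert (H3 : 0 < y * INR (2 * q + 1) ^ 2) by (apply Rmult_lt_0_compat, pow_lt; lra).
rewrite (INR_IZR_INZ (Z.to_nat _)), Z2Nat.id; [lra|]. apply le_IZR. lra.
Qed.

Lemma scaled_by_pos (y : R) (m : nat -> nat) (q : nat) :
  0 < y -> scaled_by y m -> 0 < INR (m q).
Proof.
intros Hy Hm. specialize (Hm q). assert (H := odd_pos q).
assert (H2 : 0 < y * INR (2 * q + 1) ^ 2) by (apply Rmult_lt_0_compat, pow_lt; lra). lra.
Qed.

Lemma scaled_by_lim (y : R) (m : nat -> nat) : scaled_by y m ->
  is_lim_seq (fun q => INR (m q) / INR (2 * q + 1) ^ 2) y.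
Proof.
intros Hm.
apply (is_lim_seq_le_le (fun _ => y) _ (fun q => y + / INR (2 * q + 1) * / INR (2 * q + 1))).
- intros q. specialize (Hm q). assert (H := odd_pos q). set (L := INR (2 * q + 1)) in *.
  split.
  + apply Rle_div_r; nra.
  + apply Rle_div_l; [nra|]. replace ((y + / L * / L) * L ^ 2) with (y * L ^ 2 + 1) by (field; lra). lra.
- apply is_lim_seq_const.
- replace (Finite y) with (Finite (y + 0 * 0)) by (f_equal; ring).
  apply is_lim_seq_plus'; [apply is_lim_seq_const|].
  apply is_lim_seq_mult'; apply is_lim_seq_inv_odd.
Qed.

Lemma cos_sum_limit (y : R) (m : nat -> nat) : 0 < y -> scaled_by y m ->
  is_lim_seq (fun q => bsum (fun k => cos (PI * INR (S k) / INR (2 * q + 1)) ^ (2 * m q)) q)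
    (Series (fun k => exp (- (PI ^ 2 * y) * INR (S k) ^ 2))).
Proof.
intros Hy Hm. assert (HPI := PI_RGT_0).
set (a := fun q k : nat =>
  if (k <? q)%nat then cos (PI * INR (S k) / INR (2 * q + 1)) ^ (2 * m q) else 0).
apply (is_lim_seq_ext (fun q => Series (a q))).
{ intros q. rewrite (Series_bsum _ q).
  - apply bsum_ext. intros i Hi. unfold a. apply Nat.ltb_lt in Hi. now rewrite Hi.
  - intros i Hi. unfold a. apply Nat.ltb_ge in Hi. now rewrite Hi. }
apply (Tannery a _ (fun k => exp (- (PI ^ 2 * y / 4) * INR (S k)))).
- intros k.
  (* Half the angle: cos(2x) = 1 - 2 sin^2 x puts the power in the form of [pow_limit_exp], and sin
     x / x -> 1 gives the exponent. *)
  set (x := fun q => PI * INR (S k) / 2 * / INR (2 * q + 1)).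
  assert (Hk : 0 < INR (S k)) by (apply lt_0_INR; lia).
  assert (Hxp : forall q, 0 < x q).
  { intros q. assert (H := odd_pos q). unfold x.
    apply Rmult_lt_0_compat; [nra|]. apply Rinv_0_lt_compat. lra. }
  assert (Hx0 : is_lim_seq x 0).
  { replace 0 with (PI * INR (S k) / 2 * 0) by ring.
    apply is_lim_seq_cmult, is_lim_seq_inv_odd. }
  assert (Hsinc : is_lim_seq (fun q => sin (x q) / x q) 1).
  { apply (is_lim_comp_seq (fun t => sin t / t) x 0 1).
    - apply is_lim_sinc_0.
    - exists 0%nat. intros q _ E. injection E. specialize (Hxp q). lra.
    - exact Hx0. }
  apply (is_lim_seq_ext_loc (fun q => (1 - 2 * (sin (x q)) ^ 2) ^ (2 * m q))).
  { exists (S k). intros q Hq. unfold a.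
    replace (k <? q)%nat with true by (symmetry; apply Nat.ltb_lt; lia).
    f_equal. assert (H := odd_pos q).
    replace (PI * INR (S k) / INR (2 * q + 1)) with (2 * x q) by (unfold x; field; lra).
    rewrite cos_2a_sin. ring. }
  replace (- (PI ^ 2 * y) * INR (S k) ^ 2) with (- (4 * y * (PI * INR (S k) / 2) ^ 2 * 1 ^ 2)) by field.
  apply (pow_limit_exp (fun q => 2 * sin (x q) ^ 2) (fun q => (2 * m q)%nat)).
  + intros q. assert (H := pow2_ge_0 (sin (x q))). lra.
  + replace 0 with (2 * (sin 0 * (sin 0 * 1))) by (rewrite sin_0; ring).
    apply is_lim_seq_cmult.
    assert (Hs : is_lim_seq (fun q => sin (x q)) (sin 0)).
    { apply (is_lim_seq_continuous sin); auto. apply continuity_sin. }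
    apply is_lim_seq_mult'; auto. apply is_lim_seq_mult'; auto. apply is_lim_seq_const.
  + apply (is_lim_seq_ext (fun q => 4 * (INR (m q) / INR (2 * q + 1) ^ 2) * (PI * INR (S k) / 2) ^ 2
      * (sin (x q) / x q * (sin (x q) / x q * 1)))).
    * intros q. specialize (Hxp q). assert (H := odd_pos q).
      rewrite (mult_INR 2 (m q)). change (INR 2) with 2. unfold x at 2 4. field. lra.
    * apply is_lim_seq_mult'.
      2: { apply is_lim_seq_mult'; [exact Hsinc|].
           apply is_lim_seq_mult'; [exact Hsinc|apply is_lim_seq_const]. }
      apply is_lim_seq_mult'; [|apply is_lim_seq_const].
      apply is_lim_seq_cmult. now apply scaled_by_lim.
- intros q k. unfold a. destruct (Nat.ltb_spec k q) as [Hk|Hk].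
  + assert (H := odd_pos q). assert (Hk0 : 0 < INR (S k)) by (apply lt_0_INR; lia).
    eapply Rle_trans; [apply cos_pow_bound|].
    * split.
      -- apply Rdiv_le_0_compat; nra.
      -- apply Rle_div_l; [lra|].
         (* The folding to k < q is what keeps the angle in [0, PI / 2]. *)
         assert (H2 : 2 * INR (S k) <= INR (2 * q + 1)).
         { change 2 with (INR 2) at 1. rewrite <- mult_INR. apply le_INR. lia. }
         nra.
    * apply exp_le. specialize (Hm q).
      set (L := INR (2 * q + 1)) in *. set (K := INR (S k)) in *.
      assert (HK : K <= K ^ 2) by apply sqr_ge_self.
      assert (HyM : y <= INR (m q) / L ^ 2) by (apply Rle_div_r; nra).
      replace (INR (m q) * (PI * K / L) ^ 2 / 4) with (PI ^ 2 / 4 * (INR (m q) / L ^ 2 * K ^ 2)) by (field; lra).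
      replace (- (PI ^ 2 * y / 4) * K) with (- (PI ^ 2 / 4 * (y * K))) by field.
      apply Ropp_le_contravar. apply Rmult_le_compat_l; [nra|].
      apply Rmult_le_compat; lra.
  + rewrite Rabs_R0. apply Rlt_le, exp_pos.
- apply ex_series_exp. assert (0 < PI ^ 2 * y) by (apply Rmult_lt_0_compat; nra). lra.
Qed.

(** With nu = J l the two ratio bounds have exponents J^2 l^2 / (m + J l) and J^2 l^2 / m plus the
    error 8 nu^3 / m^2, which is of order 1 / l. The majorant uses J^2 l^2 / (2m) and m <= (y + 1)
    l^2. *)
Lemma cbin_sum_limit (y : R) (m : nat -> nat) : 0 < y -> scaled_by y m ->
  is_lim_seq (fun q => bsum (fun j => cbin (m q) (S j * (2 * q + 1)) / cbin (m q) 0) (m q))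
    (Series (fun k => exp (- / y * INR (S k) ^ 2))).
Proof.
intros Hy Hm.
set (a := fun q j : nat => cbin (m q) (S j * (2 * q + 1)) / cbin (m q) 0).
apply (is_lim_seq_ext (fun q => Series (a q))).
{ intros q. apply (Series_bsum _ (m q)).
  intros i Hi. unfold a. rewrite cbin_zero by nia. unfold Rdiv. ring. }
assert (HMp : forall q, 0 < INR (m q)) by (intros; now apply (scaled_by_pos y)).
assert (HML := scaled_by_lim y m Hm).
assert (HLM : is_lim_seq (fun q => 1 / (INR (m q) / INR (2 * q + 1) ^ 2)) (1 / y)).
{ apply is_lim_seq_div'; [apply is_lim_seq_const|auto|lra]. }
apply (Tannery a _ (fun k => exp (- (1 / (2 * (y + 1))) * INR (S k)))).
- intros j. set (J := INR (S j)).
  assert (HJ : 0 < J) by (apply lt_0_INR; lia).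
  apply (is_lim_seq_le_le_loc
    (fun q => exp (- (J ^ 2 * (1 / (INR (m q) / INR (2 * q + 1) ^ 2)))
       - (8 * J ^ 3) * ((1 / (INR (m q) / INR (2 * q + 1) ^ 2)) * (1 / (INR (m q) / INR (2 * q + 1) ^ 2))
           * / INR (2 * q + 1)))) _
    (fun q => exp (- (J ^ 2 / (INR (m q) / INR (2 * q + 1) ^ 2 + J * / INR (2 * q + 1)))))).
  (* Once 1 / l < y / (4 J), the index J l satisfies 4 J l <= y l^2 <= m, as the lower bound
     requires. *)
  + assert (Hd : 0 < y / (4 * J)) by (apply Rdiv_lt_0_compat; lra).
    assert (Hi := is_lim_seq_inv_odd). apply is_lim_seq_spec in Hi.
    destruct (Hi (mkposreal _ Hd)) as [q0 Hq0]. exists q0. intros q Hq.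
    specialize (Hq0 q Hq). change (Rabs (/ INR (2 * q + 1) - 0) < y / (4 * J)) in Hq0.
    unfold a. clear Hi.
    assert (Hl := odd_pos q). specialize (HMp q). specialize (Hm q).
    replace (/ INR (2 * q + 1) - 0) with (/ INR (2 * q + 1)) in Hq0 by ring.
    rewrite Rabs_pos_eq in Hq0 by (apply Rlt_le, Rinv_0_lt_compat; lra).
    set (L := INR (2 * q + 1)) in *. set (M := INR (m q)) in *.
    assert (HJL : 4 * J <= y * L).
    { apply Rmult_lt_compat_r with (r := 4 * J * L) in Hq0; [|nra].
      replace (/ L * (4 * J * L)) with (4 * J) in Hq0 by (field; lra).
      replace (y / (4 * J) * (4 * J * L)) with (y * L) in Hq0 by (field; lra). lra. }
    assert (Hnu : (4 * (S j * (2 * q + 1)) <= m q)%nat).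
    { apply INR_le. rewrite !mult_INR. fold L M J. simpl. nra. }
    assert (E : INR (S j * (2 * q + 1)) = J * L) by (rewrite mult_INR; auto).
    split.
    * eapply Rle_trans; [|apply (cbin_ratio_lower (m q) (S j * (2 * q + 1))); auto; lia].
      apply Req_le. f_equal. rewrite E. fold M. field. lra.
    * eapply Rle_trans; [apply (cbin_ratio_upper (m q) (S j * (2 * q + 1))); lia|].
      apply Req_le. f_equal. rewrite plus_INR, E. fold M. field.
      assert (0 < M + J * L * 1) by nra. assert (0 < J * L) by nra. repeat split; nra.
  + apply (is_lim_seq_continuous exp).
    { apply derivable_continuous_pt, derivable_pt_exp. }
    replace (- / y * J ^ 2) with (- (J ^ 2 * (1 / y)) - (8 * J ^ 3) * ((1 / y) * (1 / y) * 0)) by (field; lra).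
    apply is_lim_seq_minus'.
    * apply (proj1 (is_lim_seq_opp _ (J ^ 2 * (1 / y)))).
      now apply is_lim_seq_cmult.
    * apply is_lim_seq_cmult. apply is_lim_seq_mult'; [apply is_lim_seq_mult'; exact HLM|apply is_lim_seq_inv_odd].
  + apply (is_lim_seq_continuous exp).
    { apply derivable_continuous_pt, derivable_pt_exp. }
    replace (- / y * J ^ 2) with (- (J ^ 2 / (y + J * 0))) by (field; lra).
    apply (proj1 (is_lim_seq_opp _ (J ^ 2 / (y + J * 0)))).
    apply is_lim_seq_div'; [apply is_lim_seq_const| |lra].
    apply is_lim_seq_plus'; auto. apply is_lim_seq_cmult, is_lim_seq_inv_odd.
- intros q j. unfold a. assert (Hp := cbin_0_pos (m q)).
  rewrite Rabs_pos_eq by (apply Rdiv_le_0_compat; auto; apply cbin_pos).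
  destruct (Nat.le_gt_cases (S j * (2 * q + 1)) (m q)) as [H|H].
  + eapply Rle_trans; [apply (cbin_ratio_upper (m q) (m q)); auto|]. apply exp_le.
    assert (HJ := sqr_ge_self j). assert (HJ0 : 0 < INR (S j)) by (apply lt_0_INR; lia).
    rewrite mult_INR, (plus_INR (m q)). specialize (HMp q). specialize (Hm q). assert (Hl := odd_pos q).
    set (L := INR (2 * q + 1)) in *. set (M := INR (m q)) in *. set (J := INR (S j)) in *.
    replace (- (1 / (2 * (y + 1))) * J) with (- (J / (2 * (y + 1)))) by (field; lra).
    apply Ropp_le_contravar. apply Rle_div_l; [lra|].
    replace ((J * L) ^ 2 / (M + M) * (2 * (y + 1))) with (J ^ 2 * ((y + 1) * L ^ 2) / M) by (field; lra).
    apply Rle_div_r; auto. apply Rmult_le_compat; try lra. nra.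
  + rewrite cbin_zero by auto. unfold Rdiv. rewrite Rmult_0_l. apply Rlt_le, exp_pos.
- apply ex_series_exp. apply Rdiv_lt_0_compat; lra.
Qed.

Lemma filterlim_scaled_by (y : R) (m : nat -> nat) : 0 < y -> scaled_by y m ->
  filterlim m eventually eventually.
Proof.
intros Hy Hm P [N HN].
destruct (nfloor_ex (INR N / y) ltac:(apply Rdiv_le_0_compat; [apply pos_INR|auto])) as [q0 Hq0].
exists (S q0). intros q Hq. apply HN. apply INR_le.
eapply Rle_trans; [|apply Hm]. destruct Hq0 as [_ Hq0].
apply Rlt_div_l in Hq0; auto. assert (H : INR q0 + 1 <= INR (2 * q + 1)).
{ rewrite <- S_INR. apply le_INR. lia. }
assert (H0 := pos_INR q0).
assert (H1 : y * (INR q0 + 1) <= y * INR (2 * q + 1) ^ 2) by (apply Rmult_le_compat_l; nra).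
lra.
Qed.

Theorem gauss_sum_reflection : exists c : R, forall y : R, 0 < y ->
  1 + 2 * Series (fun k => exp (- (PI ^ 2 * y) * INR (S k) ^ 2))
  = c * sqrt (/ y) * (1 + 2 * Series (fun k => exp (- / y * INR (S k) ^ 2))).
Proof.
destruct central_cbin_limit as [b Hb].
exists (sqrt b * sqrt (/ 2)). intros y Hy.
destruct (scaled_by_exists y Hy) as [m Hm].
assert (HMp : forall q, 0 < INR (m q)) by (intros; now apply (scaled_by_pos y)).
assert (HL := cos_sum_limit y m Hy Hm). assert (HR := cbin_sum_limit y m Hy Hm).
assert (Hl := is_lim_seq_plus' _ _ _ _ (is_lim_seq_const 1) (is_lim_seq_cmult _ 2 _ HL)).
assert (Hr := is_lim_seq_plus' _ _ _ _ (is_lim_seq_const 1) (is_lim_seq_cmult _ 2 _ HR)).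
(* Since (2m + 1) / l^2 = 2 (m / l^2) + (1/l) (1/l), the prefactor is the square root of the Wallis
   sequence divided by this; the summand 0 * 0 is the limit of (1/l) (1/l). *)
assert (HU : is_lim_seq (fun q => INR (2 * q + 1) * (cbin (m q) 0 / 4 ^ m q))
  (sqrt (b * (1 / (2 * y + 0 * 0))))).
{ apply (is_lim_seq_ext (fun q => sqrt ((INR (2 * m q + 1) * (cbin (m q) 0 / 4 ^ m q) ^ 2)
    * (1 / (2 * (INR (m q) / INR (2 * q + 1) ^ 2) + / INR (2 * q + 1) * / INR (2 * q + 1)))))).
  - intros q. specialize (HMp q). assert (H := odd_pos q).
    assert (H0 : 0 <= cbin (m q) 0 / 4 ^ m q).
    { apply Rdiv_le_0_compat; [apply cbin_pos|apply pow_lt; lra]. }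
    rewrite <- (sqrt_pow2 (INR (2 * q + 1) * (cbin (m q) 0 / 4 ^ m q))) by (apply Rmult_le_pos; lra).
    f_equal. rewrite (plus_INR (2 * m q)), mult_INR. change (INR 2) with 2. change (INR 1) with 1.
    assert (H4 : 4 ^ m q <> 0) by (apply pow_nonzero; lra).
    field. repeat split; auto; try lra.
  - apply (is_lim_seq_continuous sqrt).
    { apply continuity_pt_filterlim, continuous_sqrt. }
    apply is_lim_seq_mult'.
    + apply (is_lim_seq_subseq _ b m (filterlim_scaled_by y m Hy Hm) Hb).
    + apply is_lim_seq_div'; [apply is_lim_seq_const| |lra].
      apply is_lim_seq_plus'.
      * apply is_lim_seq_cmult. now apply scaled_by_lim.
      * apply is_lim_seq_mult'; apply is_lim_seq_inv_odd. }
assert (Hp := is_lim_seq_mult' _ _ _ _ HU Hr).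
apply is_lim_seq_unique in Hl. apply is_lim_seq_unique in Hp.
rewrite (Lim_seq_ext _ _ (fun q => Polya_identity_odd q (m q))) in Hl.
rewrite Hp in Hl. apply Rbar_finite_eq in Hl. rewrite <- Hl. f_equal.
assert (Hb0 : 0 <= b).
{ apply (is_lim_seq_le (fun _ => 0) (fun m => INR (2 * m + 1) * (cbin m 0 / 4 ^ m) ^ 2) 0 b).
  - intros n. apply Rmult_le_pos; [apply pos_INR|apply pow2_ge_0].
  - apply is_lim_seq_const.
  - exact Hb. }
assert (Hiy := Rinv_0_lt_compat y Hy).
rewrite <- !sqrt_mult by lra. f_equal. field. lra.
Qed.

(* psi(x) = sum_{n >= 1} exp (- pi n^2 x) in the variable v = ln x. *)
Definition theta_tail (v : R) : R := Series (fun k => exp (- (PI * exp v) * INR (S k) ^ 2)).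

Lemma theta_tail_pos (v : R) : 0 <= theta_tail v.
Proof.
unfold theta_tail. rewrite <- (Rmult_0_l (Series (fun k => exp (- (PI * exp v) * INR (S k) ^ 2)))).
rewrite <- Series_scal_l. apply Series_le.
- intros n. rewrite Rmult_0_l. split; [lra|apply Rlt_le, exp_pos].
- apply ex_series_gauss. apply Rmult_lt_0_compat; [apply PI_RGT_0|apply exp_pos].
Qed.

Theorem theta_reflection (v : R) :
  1 + 2 * theta_tail (- v) = exp (v / 2) * (1 + 2 * theta_tail v).
Proof.
destruct gauss_sum_reflection as [c Hc]. assert (HPI := PI_RGT_0).
assert (H : forall v, 1 + 2 * theta_tail (- v) = c * sqrt PI * exp (v / 2) * (1 + 2 * theta_tail v)).
{ intros u. assert (Hu := exp_pos u). assert (Hu2 := exp_pos (u / 2)).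
  specialize (Hc (/ (PI * exp u)) ltac:(apply Rinv_0_lt_compat; nra)).
  rewrite !Rinv_inv in Hc.
  replace (PI ^ 2 * / (PI * exp u)) with (PI * exp (- u)) in Hc by (rewrite exp_Ropp; field; lra).
  change (1 + 2 * theta_tail (- u) = c * sqrt (PI * exp u) * (1 + 2 * theta_tail u)) in Hc.
  rewrite Hc. replace (exp u) with (exp (u / 2) * exp (u / 2)) by (rewrite <- exp_plus; f_equal; field).
  rewrite sqrt_mult by nra. rewrite sqrt_square by lra. ring. }
(* At v = 0, that is x = 1, both sides contain the same positive number 1 + 2 psi(1). *)
assert (E : c * sqrt PI = 1).
{ specialize (H 0). rewrite Ropp_0 in H. replace (0 / 2) with 0 in H by field. rewrite exp_0 in H.
  assert (Hp := theta_tail_pos 0). apply Rmult_eq_reg_r with (1 + 2 * theta_tail 0); lra. }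
rewrite H, E. ring.
Qed.

(** * Integrals over a half-line *)

Notation Rcont f x := (continuous (T := R_UniformSpace) (U := C_R_CompleteNormedModule) f x).

(* [ring] does not see C behind the carrier of [C_R_CompleteNormedModule]. *)
Ltac Cring := match goal with |- ?a = ?b => change (@eq C a b); ring end.

Lemma Rcont_pair (f : R -> C) (x : R) :
  continuous (fun t => Re (f t)) x -> continuous (fun t => Im (f t)) x -> Rcont f x.
Proof.
intros H1 H2. apply continuous_C_eps. intros eps Heps.
assert (He : 0 < eps / 2) by lra.
destruct (proj1 (filterlim_locally _ _) H2 (mkposreal _ He)) as [d2 Hd2].
destruct (proj1 (filterlim_locally _ _) H1 (mkposreal _ He)) as [d1 Hd1].
exists (Rmin d1 d2). split; [apply Rmin_glb_lt; apply cond_pos|].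
intros y Hy.
specialize (Hd1 y (Rlt_le_trans _ _ _ Hy (Rmin_l _ _))).
specialize (Hd2 y (Rlt_le_trans _ _ _ Hy (Rmin_r _ _))).
change (Rabs (Re (f y) - Re (f x)) < eps / 2) in Hd1.
change (Rabs (Im (f y) - Im (f x)) < eps / 2) in Hd2.
replace (f y - f x)%C with ((Re (f y) - Re (f x), Im (f y) - Im (f x)) : C)
  by (destruct (f y), (f x); reflexivity).
eapply Rle_lt_trans; [apply Cmod_pair|]. lra.
Qed.

Lemma Rcont_Re (f : R -> C) (x : R) : Rcont f x -> continuous (fun t => Re (f t)) x.
Proof.
intros H. apply (continuous_comp f (fun z : R * R => fst z)); auto. apply continuous_fst.
Qed.

Lemma Rcont_Im (f : R -> C) (x : R) : Rcont f x -> continuous (fun t => Im (f t)) x.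
Proof.
intros H. apply (continuous_comp f (fun z : R * R => snd z)); auto. apply continuous_snd.
Qed.

Lemma Rcont_plus (f g : R -> C) (x : R) :
  Rcont f x -> Rcont g x -> Rcont (fun t => f t + g t)%C x.
Proof. intros; now apply (continuous_plus (V := C_R_NormedModule)). Qed.

Lemma Rcont_mult (f g : R -> C) (x : R) :
  Rcont f x -> Rcont g x -> Rcont (fun t => f t * g t)%C x.
Proof.
intros Hf Hg.
assert (H1 := Rcont_Re _ _ Hf). assert (H2 := Rcont_Im _ _ Hf).
assert (H3 := Rcont_Re _ _ Hg). assert (H4 := Rcont_Im _ _ Hg).
apply Rcont_pair; simpl.
- apply (continuous_minus (V := R_NormedModule));
    apply (continuous_mult (K := R_AbsRing)); auto.
- apply (continuous_plus (V := R_NormedModule));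
    apply (continuous_mult (K := R_AbsRing)); auto.
Qed.

Lemma Rcont_RtoC (u : R -> R) (x : R) : continuous u x -> Rcont (fun t => RtoC (u t)) x.
Proof. intros H. apply Rcont_pair; simpl; auto. apply continuous_const. Qed.

Lemma Rcont_const (c : C) (x : R) : Rcont (fun _ => c) x.
Proof. apply continuous_const. Qed.

Lemma Rcont_Cexp (z : C) (x : R) : Rcont (fun t => Cexp (z * RtoC t)) x.
Proof.
destruct z as [a b]. apply Rcont_pair; simpl;
  apply (ex_derive_continuous (V := R_NormedModule)); auto_derive; auto.
Qed.

Lemma Rcont_comp_affine (f : R -> C) (a b x : R) :
  Rcont f (a * x + b) -> Rcont (fun t => f (a * t + b)) x.
Proof.
intros H. apply (continuous_comp (fun t => a * t + b) f); auto.
apply (ex_derive_continuous (V := R_NormedModule)). auto_derive. auto.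
Qed.

Lemma CInt_cont (f : R -> C) (a b : R) : (forall x, Rcont f x) -> is_CInt f a b (CInt f a b).
Proof. intros H. apply CInt_continuous. intros; apply H. Qed.

Lemma CInt_chasles (f : R -> C) (a b c : R) : (forall x, Rcont f x) ->
  CInt f a c = (CInt f a b + CInt f b c)%C.
Proof.
intros H. apply CInt_unique. apply is_CInt_Chasles with b; now apply CInt_cont.
Qed.

Lemma CInt_add (f g : R -> C) (a b : R) : (forall x, Rcont f x) -> (forall x, Rcont g x) ->
  CInt (fun t => f t + g t)%C a b = (CInt f a b + CInt g a b)%C.
Proof. intros. apply CInt_unique, is_CInt_plus; now apply CInt_cont. Qed.

Lemma CInt_cmult (f : R -> C) (c : C) (a b : R) : (forall x, Rcont f x) ->
  CInt (fun t => c * f t)%C a b = (c * CInt f a b)%C.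
Proof. intros. apply CInt_unique, is_CInt_scal; now apply CInt_cont. Qed.

Lemma CInt_affine (f : R -> C) (u v a b : R) : (forall x, Rcont f x) ->
  CInt (fun t => RtoC u * f (u * t + v)%R)%C a b = CInt f (u * a + v) (u * b + v).
Proof.
intros H. apply CInt_unique.
eapply (is_RInt_ext (V := C_R_NormedModule)).
2: { apply (is_RInt_comp_lin (V := C_R_NormedModule) f u v a b). now apply CInt_cont. }
intros x _. unfold scal; simpl. unfold prod_scal, scal; simpl. unfold mult; simpl.
destruct (f (u * x + v)) as [p q]. unfold Cmult, RtoC; simpl. f_equal; ring.
Qed.

Lemma CInt_shift (f : R -> C) (c a b : R) : (forall x, Rcont f x) ->
  CInt (fun t => f (t + c)) a b = CInt f (a + c) (b + c).
Proof.
intros H. assert (E := CInt_affine f 1 c a b H). rewrite !Rmult_1_l in E. rewrite <- E.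
apply (RInt_ext (V := C_R_CompleteNormedModule)). intros x _. rewrite Rmult_1_l.
apply injective_projections; simpl; ring.
Qed.

Lemma CInt_neg (f : R -> C) (a : R) : (forall x, Rcont f x) ->
  CInt (fun t => f (- t)) 0 a = CInt f (- a) 0.
Proof.
intros H. assert (E := CInt_affine f (-1) 0 0 a H).
replace (-1 * 0 + 0) with 0 in E by ring. replace (-1 * a + 0) with (- a) in E by ring.
assert (S1 : (CInt f (- a) 0 + CInt f 0 (- a) = RtoC 0)%C).
{ rewrite <- CInt_chasles by auto. apply CInt_unique. apply (is_RInt_point (V := C_R_NormedModule)). }
assert (H' : forall x, Rcont (fun t => f (- t)) x).
{ intros x. apply (continuous_ext (fun t => f (-1 * t + 0))).
  - intros t. f_equal. ring.
  - apply Rcont_comp_affine. auto. }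
assert (S2 : CInt (fun t => RtoC (-1) * f (-1 * t + 0)%R)%C 0 a = (RtoC (-1) * CInt (fun t => f (- t)%R) 0 a)%C).
{ rewrite <- CInt_cmult by auto. apply (RInt_ext (V := C_R_CompleteNormedModule)). intros x _.
  do 2 f_equal. ring. }
rewrite S2 in E. rewrite <- E in S1.
replace (CInt (fun t => f (- t)) 0 a) with (CInt f (- a) 0
  - (CInt f (- a) 0 + RtoC (-1) * CInt (fun t => f (- t)%R) 0 a))%C by Cring.
rewrite S1. Cring.
Qed.

(** * Convergence of half-line integrals under exponential decay *)

Lemma is_RInt_exp_decay (K al a b : R) : al <> 0 ->
  is_RInt (fun v => K * exp (- al * v)) a b (K / al * exp (- al * a) - K / al * exp (- al * b)).
Proof.
intros H.
replace (K / al * exp (- al * a) - K / al * exp (- al * b))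
  with (minus (- (K / al * exp (- al * b))) (- (K / al * exp (- al * a))))
  by (unfold minus, plus, opp; simpl; ring).
apply (is_RInt_derive (fun v => - (K / al * exp (- al * v)))).
- intros x _. auto_derive; auto. field. auto.
- intros x _. apply (ex_derive_continuous (V := R_NormedModule)). auto_derive. auto.
Qed.

Lemma CInt_decay_bound (f : R -> C) (K al a b : R) :
  (forall v, Rcont f v) -> 0 < al -> 0 <= a <= b ->
  (forall v, 0 <= v -> Cmod (f v) <= K * exp (- al * v)) ->
  Cmod (CInt f a b) <= K / al * exp (- al * a).
Proof.
intros Hf Hal Hab HK.
assert (HK0 : 0 <= K).
{ specialize (HK 0 (Rle_refl 0)). rewrite Rmult_0_r, exp_0 in HK.
  assert (H := Cmod_ge_0 (f 0)). lra. }
apply Rle_trans with (K / al * exp (- al * a) - K / al * exp (- al * b)).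
- apply (is_CInt_bound f (fun v => K * exp (- al * v)) a b); [lra| | |].
  + intros x Hx. apply HK. lra.
  + now apply CInt_cont.
  + apply is_RInt_exp_decay. lra.
- assert (H := exp_pos (- al * b)).
  assert (H1 : 0 <= K / al) by (apply Rdiv_le_0_compat; lra). nra.
Qed.

Lemma exp_decay_small (K al eps : R) : 0 < al -> 0 <= K -> 0 < eps ->
  exists T, 0 <= T /\ forall x, T <= x -> K * exp (- al * x) < eps.
Proof.
intros Hal HK He. exists (K / (al * eps)). split.
- apply Rdiv_le_0_compat; nra.
- intros x Hx. apply Rle_div_l in Hx; [|nra].
  replace (- al * x) with (- (al * x)) by ring. rewrite exp_Ropp.
  assert (H := exp_ineq1_le (al * x)).
  apply Rlt_div_l; [apply Rlt_gt, exp_pos|]. nra.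
Qed.

(** Continuity is part of the predicate, so all truncated integrals exist and linearity and
    substitution need no further side conditions. *)
Definition is_HInt (f : R -> C) (L : C) : Prop :=
  (forall v, Rcont f v) /\
  forall eps, 0 < eps -> exists T, 0 <= T /\
    forall B, T <= B -> Cmod (CInt f 0 B - L)%C < eps.

(** A total function, taking the limit along integer upper bounds; it is the integral only where
    [is_HInt] holds. *)
Definition HInt (f : R -> C) : C :=
  (real (Lim_seq (fun n => Re (CInt f 0 (INR n)))),
   real (Lim_seq (fun n => Im (CInt f 0 (INR n))))).

Lemma Im_le_Cmod (z : C) : Rabs (Im z) <= Cmod z.
Proof. eapply Rle_trans; [|apply Rmax_Cmod]. apply Rmax_r. Qed.

Lemma Cmod_eq (z w : C) : (forall eps, 0 < eps -> Cmod (z - w)%C < eps) -> z = w.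
Proof.
intros H. assert (E : (z - w)%C = RtoC 0).
{ apply Cmod_eq_0. destruct (Cmod_ge_0 (z - w)%C) as [Hp|]; auto.
  specialize (H _ Hp). lra. }
replace z with (z - w + w)%C by Cring. rewrite E. ring.
Qed.

Lemma is_HInt_HInt (f : R -> C) (L : C) : is_HInt f L -> HInt f = L.
Proof.
intros [_ H].
(* Here g stands for [Re] and [Im] at once: both respect differences and are bounded by the
   modulus. *)
assert (HR : forall g : C -> R, (forall z w, g (z - w)%C = g z - g w) ->
  (forall z, Rabs (g z) <= Cmod z) ->
  is_lim_seq (fun n => g (CInt f 0 (INR n))) (g L)).
{ intros g Hg Hgb. apply is_lim_seq_spec. intros eps.
  destruct (H eps (cond_pos eps)) as [T [HT0 HT]].
  destruct (nfloor_ex T HT0) as [N [_ HN]]. exists (S N). intros n Hn.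
  assert (Hn' : INR N + 1 <= INR n) by (rewrite <- S_INR; now apply le_INR).
  rewrite <- Hg. eapply Rle_lt_trans; [apply Hgb|]. apply HT. lra. }
unfold HInt.
rewrite (is_lim_seq_unique _ _ (HR Re (fun z w => eq_refl) re_le_Cmod)).
rewrite (is_lim_seq_unique _ _ (HR Im (fun z w => eq_refl) Im_le_Cmod)).
simpl. now destruct L.
Qed.

Lemma is_HInt_decay (f : R -> C) (K al : R) :
  (forall v, Rcont f v) -> 0 < al ->
  (forall v, 0 <= v -> Cmod (f v) <= K * exp (- al * v)) ->
  is_HInt f (HInt f).
Proof.
intros Hf Hal HK.
assert (HK0 : 0 <= K).
{ specialize (HK 0 (Rle_refl 0)). rewrite Rmult_0_r, exp_0 in HK.
  assert (H := Cmod_ge_0 (f 0)). lra. }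
assert (HKa : 0 <= K / al) by (apply Rdiv_le_0_compat; lra).
assert (Hcau : forall T B B', 0 <= T <= B -> T <= B' ->
  Cmod (CInt f 0 B - CInt f 0 B')%C <= K / al * exp (- al * T)).
{ assert (Hlt : forall T B B', 0 <= T <= B -> B <= B' ->
    Cmod (CInt f 0 B - CInt f 0 B')%C <= K / al * exp (- al * T)).
  { intros T B B' HT HB. rewrite (CInt_chasles f 0 B B') by auto.
    replace (CInt f 0 B - (CInt f 0 B + CInt f B B'))%C with (- CInt f B B')%C by Cring.
    rewrite Cmod_opp. eapply Rle_trans.
    - apply (CInt_decay_bound f K al B B'); auto; lra.
    - apply Rmult_le_compat_l; auto. apply exp_le. nra. }
  intros T B B' HT HB. destruct (Rle_dec B B') as [H|H].
  - now apply Hlt.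
  - replace (CInt f 0 B - CInt f 0 B')%C with (- (CInt f 0 B' - CInt f 0 B))%C by Cring.
    rewrite Cmod_opp. apply Hlt; lra. }
assert (HR : forall g : C -> R, (forall z w, g (z - w)%C = g z - g w) ->
  (forall z, Rabs (g z) <= Cmod z) ->
  is_lim_seq (fun n => g (CInt f 0 (INR n))) (real (Lim_seq (fun n => g (CInt f 0 (INR n)))))).
{ intros g Hg Hgb. apply Lim_seq_correct'. apply ex_lim_seq_cauchy_corr.
  intros eps. destruct (exp_decay_small (K / al) al eps Hal HKa (cond_pos eps)) as [T [HT0 HT]].
  destruct (nfloor_ex T HT0) as [N [_ HN]]. exists (S N). intros n m Hn Hm.
  assert (Hn' : INR N + 1 <= INR n) by (rewrite <- S_INR; now apply le_INR).
  assert (Hm' : INR N + 1 <= INR m) by (rewrite <- S_INR; now apply le_INR).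
  rewrite <- Hg. eapply Rle_lt_trans; [apply Hgb|].
  eapply Rle_lt_trans; [apply (Hcau T); lra|]. apply HT. lra. }
assert (H1 := HR Re (fun z w => eq_refl) re_le_Cmod).
assert (H2 := HR Im (fun z w => eq_refl) Im_le_Cmod).
split; auto. intros eps He.
destruct (exp_decay_small (K / al) al (eps / 3) Hal HKa ltac:(lra)) as [T [HT0 HT]].
exists T. split; auto. intros B HB.
apply is_lim_seq_spec in H1, H2. assert (He3 : 0 < eps / 3) by lra.
destruct (H1 (mkposreal _ He3)) as [n1 Hn1]. destruct (H2 (mkposreal _ He3)) as [n2 Hn2].
destruct (nfloor_ex T HT0) as [N [_ HN]].
set (n := (S N + n1 + n2)%nat).
assert (Hn' : INR N + 1 <= INR n) by (rewrite <- S_INR; apply le_INR; unfold n; lia).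
specialize (Hn1 n ltac:(unfold n; lia)). specialize (Hn2 n ltac:(unfold n; lia)).
change (Rabs (Re (CInt f 0 (INR n)) - Re (HInt f)) < eps / 3) in Hn1.
change (Rabs (Im (CInt f 0 (INR n)) - Im (HInt f)) < eps / 3) in Hn2.
replace (CInt f 0 B - HInt f)%C
  with ((CInt f 0 B - CInt f 0 (INR n)) + (CInt f 0 (INR n) - HInt f))%C by Cring.
eapply Rle_lt_trans; [apply Cmod_triangle|].
assert (Hd : Cmod (CInt f 0 (INR n) - HInt f)%C <= Rabs (Re (CInt f 0 (INR n)) - Re (HInt f))
  + Rabs (Im (CInt f 0 (INR n)) - Im (HInt f))).
{ destruct (CInt f 0 (INR n)) as [p q], (HInt f) as [p' q']. apply Cmod_pair. }
assert (Hc := Hcau T B (INR n) ltac:(lra) ltac:(lra)). specialize (HT T (Rle_refl T)).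
lra.
Qed.

Lemma is_HInt_bound (f : R -> C) (L : C) (K al B : R) :
  is_HInt f L -> 0 < al -> 0 <= B ->
  (forall v, 0 <= v -> Cmod (f v) <= K * exp (- al * v)) ->
  Cmod (CInt f 0 B - L)%C <= K / al * exp (- al * B).
Proof.
intros [Hf H] Hal HB HK. apply Rnot_lt_le. intros Hlt.
set (e := Cmod (CInt f 0 B - L)%C - K / al * exp (- al * B)) in *.
destruct (H e ltac:(unfold e; lra)) as [T [HT0 HT]].
specialize (HT (Rmax T B) (Rmax_l _ _)). assert (HM := Rmax_r T B).
rewrite (CInt_chasles f 0 B) in HT by auto.
assert (H1 := CInt_decay_bound f K al B (Rmax T B) Hf Hal ltac:(lra) HK).
assert (H2 : Cmod (CInt f 0 B - L)%C <= Cmod (CInt f 0 B + CInt f B (Rmax T B) - L)%C + Cmod (CInt f B (Rmax T B))).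
{ rewrite <- (Cmod_opp (CInt f B (Rmax T B))). eapply Rle_trans; [|apply Cmod_triangle].
  apply Req_le. f_equal. ring. }
unfold e in HT. lra.
Qed.

Lemma is_HInt_norm (f : R -> C) (L : C) (K al : R) :
  is_HInt f L -> 0 < al ->
  (forall v, 0 <= v -> Cmod (f v) <= K * exp (- al * v)) -> Cmod L <= K / al.
Proof.
intros H Hal HK. assert (Hb := is_HInt_bound f L K al 0 H Hal (Rle_refl 0) HK).
assert (E : CInt f 0 0 = RtoC 0).
{ apply CInt_unique. apply (is_RInt_point (V := C_R_NormedModule)). }
rewrite E, Rmult_0_r, exp_0 in Hb. replace (RtoC 0 - L)%C with (- L)%C in Hb by Cring.
rewrite Cmod_opp in Hb. lra.
Qed.

Lemma is_HInt_unique (f : R -> C) (L M : C) : is_HInt f L -> is_HInt f M -> L = M.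
Proof. intros H1 H2. apply is_HInt_HInt in H1, H2. congruence. Qed.

Lemma is_HInt_plus (f g : R -> C) (L M : C) :
  is_HInt f L -> is_HInt g M -> is_HInt (fun v => f v + g v)%C (L + M)%C.
Proof.
intros [Hf HL] [Hg HM]. split; [intros; now apply Rcont_plus|].
intros eps He. destruct (HL (eps / 2) ltac:(lra)) as [T1 [HT1 H1]].
destruct (HM (eps / 2) ltac:(lra)) as [T2 [HT2 H2]].
exists (Rmax T1 T2). split; [eapply Rle_trans; [exact HT1|apply Rmax_l]|].
intros B HB. specialize (H1 B (Rle_trans _ _ _ (Rmax_l _ _) HB)).
specialize (H2 B (Rle_trans _ _ _ (Rmax_r _ _) HB)).
rewrite CInt_add by auto.
replace (CInt f 0 B + CInt g 0 B - (L + M))%C with ((CInt f 0 B - L) + (CInt g 0 B - M))%C by Cring.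
eapply Rle_lt_trans; [apply Cmod_triangle|]. lra.
Qed.

Lemma is_HInt_scal (f : R -> C) (c L : C) :
  is_HInt f L -> is_HInt (fun v => c * f v)%C (c * L)%C.
Proof.
intros [Hf HL]. split; [intros; apply Rcont_mult; auto; apply Rcont_const|].
intros eps He. assert (Hc := Cmod_ge_0 c).
destruct (HL (eps / (1 + Cmod c)) ltac:(apply Rdiv_lt_0_compat; lra)) as [T [HT H]].
exists T. split; auto. intros B HB. specialize (H B HB).
rewrite CInt_cmult by auto.
replace (c * CInt f 0 B - c * L)%C with (c * (CInt f 0 B - L))%C by Cring.
rewrite Cmod_mult. apply Rlt_div_r in H; [|lra].
assert (H0 := Cmod_ge_0 (CInt f 0 B - L)%C). nra.
Qed.

Lemma is_HInt_ext (f g : R -> C) (L : C) :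
  (forall v, f v = g v) -> is_HInt f L -> is_HInt g L.
Proof.
intros E [Hf HL]. split.
- intros v. now apply (continuous_ext f).
- intros eps He. destruct (HL eps He) as [T [HT H]]. exists T. split; auto.
  intros B HB. rewrite <- (RInt_ext (V := C_R_CompleteNormedModule) f) by auto. auto.
Qed.

Lemma CInt_Cexp (w : C) (B : R) : w <> 0 ->
  CInt (fun v => Cexp (w * RtoC v)) 0 B = ((Cexp (w * RtoC B) - 1) / w)%C.
Proof.
intros Hw.
assert (H : is_CInt (fun v => w * Cexp (w * RtoC v))%C 0 B (Cexp (w * RtoC B) - 1)%C).
{ destruct w as [a b].
  replace (Cexp ((a, b) * RtoC B) - 1)%C with
    ((minus (exp (a * B) * cos (b * B)) (exp (a * 0) * cos (b * 0)),
      minus (exp (a * B) * sin (b * B)) (exp (a * 0) * sin (b * 0))) : C).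
  2: { unfold minus, plus, opp; simpl. rewrite !Rmult_0_r, exp_0, cos_0, sin_0.
       unfold Cexp, Cminus, Cplus, Copp, Cmult, RtoC; simpl.
       replace (a * B - b * 0) with (a * B) by ring. replace (a * 0 + b * B) with (b * B) by ring.
       f_equal; ring. }
  apply is_CInt_pair.
  - apply (is_RInt_ext (fun v => exp (a * v) * (a * cos (b * v) - b * sin (b * v)))).
    { intros v _. simpl. replace (a * v - b * 0) with (a * v) by ring.
      replace (a * 0 + b * v) with (b * v) by ring. ring. }
    apply (is_RInt_derive (fun v => exp (a * v) * cos (b * v))).
    + intros v _. auto_derive; auto. ring.
    + intros v _. apply (ex_derive_continuous (V := R_NormedModule)). auto_derive. auto.
  - apply (is_RInt_ext (fun v => exp (a * v) * (a * sin (b * v) + b * cos (b * v)))).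
    { intros v _. simpl. replace (a * v - b * 0) with (a * v) by ring.
      replace (a * 0 + b * v) with (b * v) by ring. ring. }
    apply (is_RInt_derive (fun v => exp (a * v) * sin (b * v))).
    + intros v _. auto_derive; auto. ring.
    + intros v _. apply (ex_derive_continuous (V := R_NormedModule)). auto_derive. auto. }
apply CInt_unique in H. rewrite CInt_cmult in H by (intros; apply Rcont_Cexp).
rewrite <- H.
assert (F : forall x : C, x = (w * x / w)%C) by (intros; field; auto). apply F.
Qed.

Lemma is_HInt_Cexp (w : C) : 0 < Re w -> is_HInt (fun v => Cexp (- w * RtoC v)) (/ w)%C.
Proof.
intros Hw. assert (Hw0 : w <> 0) by (intros E; rewrite E in Hw; simpl in Hw; lra).
assert (Hw1 : (- w)%C <> 0).
{ intros E. apply Hw0. replace w with (- - w)%C by Cring. rewrite E. ring. }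
split; [intros; apply Rcont_Cexp|]. intros eps He.
assert (Hm : 0 < Cmod w) by now apply Cmod_gt_0.
destruct (exp_decay_small (/ Cmod w) (Re w) eps Hw) as [T [HT0 HT]]; auto.
{ apply Rlt_le, Rinv_0_lt_compat; auto. }
exists T. split; auto. intros B HB. rewrite CInt_Cexp by auto.
replace ((Cexp (- w * RtoC B) - 1) / - w - / w)%C with (- / w * Cexp (- w * RtoC B))%C by (field; auto).
rewrite Cmod_mult, Cmod_opp, Cmod_inv, Cmod_Cexp by auto.
replace (Re (- w * RtoC B)%C) with (- Re w * B) by (destruct w; simpl; ring).
now apply HT.
Qed.

(** * The symmetric formula for Xi *)

Lemma theta_rate_pos (v : R) : 0 < PI * exp v.
Proof. apply Rmult_lt_0_compat; [apply PI_RGT_0|apply exp_pos]. Qed.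

Lemma PI_ge_2 : 2 <= PI.
Proof. assert (H := PI2_1). lra. Qed.

(** The convex function e^v lies above its tangent of slope K, which touches it at v = ln K. *)
Lemma exp_exp_decay (K v : R) : 0 < K -> exp (- exp v) <= exp (- (K * (1 - ln K))) * exp (- K * v).
Proof.
intros HK. rewrite <- exp_plus. apply exp_le.
assert (H := exp_ineq1_le (v - ln K)).
replace (exp v) with (K * exp (v - ln K)).
- apply Rmult_le_compat_l with (r := K) in H; lra.
- unfold Rminus. rewrite exp_plus, exp_Ropp, exp_ln by auto. field. lra.
Qed.

(** For v >= 0 and n >= 1, pi e^v n^2 >= 2 e^v n >= e^v + n, so the series is at most exp(-e^v)
    times a convergent geometric series, and the double exponential beats every rate K. *)
Lemma theta_tail_decay (K : R) : 0 < K ->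
  exists C, 0 <= C /\ forall v, 0 <= v -> theta_tail v <= C * exp (- K * v).
Proof.
intros HK. set (S0 := Series (fun k => exp (- (1) * INR (S k)))).
assert (HS : ex_series (fun k => exp (- (1) * INR (S k)))) by (apply ex_series_exp; lra).
assert (HS0 : 0 <= S0).
{ unfold S0. rewrite <- (Rmult_0_l (Series (fun k => exp (- (1) * INR (S k))))).
  rewrite <- Series_scal_l. apply Series_le; auto.
  intros n. rewrite Rmult_0_l. split; [lra|apply Rlt_le, exp_pos]. }
exists (exp (- (K * (1 - ln K))) * S0). split.
{ apply Rmult_le_pos; auto. apply Rlt_le, exp_pos. }
intros v Hv. apply Rle_trans with (exp (- exp v) * S0).
- unfold theta_tail, S0. rewrite <- Series_scal_l. apply Series_le.
  + intros k. split; [apply Rlt_le, exp_pos|]. rewrite <- exp_plus. apply exp_le.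
    assert (H1 := sqr_ge_self k). assert (H2 := exp_ineq1_le v). assert (H3 := PI_ge_2).
    assert (H4 : 1 <= INR (S k)) by (rewrite S_INR; assert (H := pos_INR k); lra).
    set (e := exp v) in *. set (n := INR (S k)) in *.
    assert (2 * e <= PI * e) by nra.
    assert (2 * e * n <= PI * e * n ^ 2) by (apply Rmult_le_compat; nra).
    nra.
  + apply (ex_series_scal_l (K := R_AbsRing) (V := R_NormedModule)); auto.
- assert (H := exp_exp_decay K v HK). nra.
Qed.

(** Read off from the reflection formula; this growth is what confines the Mellin integral to Re z >
    1/2. *)
Lemma theta_tail_growth : exists C, 0 <= C /\
  forall v, 0 <= v -> theta_tail (- v) <= C * exp (v / 2).
Proof.
destruct (theta_tail_decay 1 Rlt_0_1) as [C [HC H]].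
exists (1 / 2 + C). split; [lra|]. intros v Hv.
assert (E := theta_reflection v). specialize (H v Hv).
assert (H1 := exp_pos (v / 2)).
assert (H2 : exp (- (1) * v) <= 1) by (rewrite <- exp_0 at 2; apply exp_le; lra).
assert (H3 : theta_tail v <= C) by nra. nra.
Qed.

(** * Partial sums and continuity of the theta tail *)

Definition theta_partial (N : nat) (v : R) : R :=
  bsum (fun k => exp (- (PI * exp v) * INR (S k) ^ 2)) N.

Lemma theta_tail_split (N : nat) (v : R) :
  theta_tail v = theta_partial N v
    + Series (fun k => exp (- (PI * exp v) * INR (S (N + k)) ^ 2)).
Proof.
apply (Series_bsum_tail (fun k => exp (- (PI * exp v) * INR (S k) ^ 2))).
apply ex_series_gauss, theta_rate_pos.
Qed.

(** Every term decreases in v, so the remainder at v = -T controls all remainders to its right. *)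
Lemma theta_partial_approx (T eps : R) : 0 < eps ->
  exists N0, forall N v, (N0 <= N)%nat -> - T <= v ->
    0 <= theta_tail v - theta_partial N v <= eps.
Proof.
intros He. set (c := PI * exp (- T)). assert (Hc : 0 < c) by apply theta_rate_pos.
set (b := fun k => exp (- c * INR (S k) ^ 2)).
assert (Hb : ex_series b) by (now apply ex_series_gauss).
assert (Hl : is_lim_seq (fun N => Series b - bsum b N) 0).
{ replace 0 with (Series b - Series b) by ring.
  apply is_lim_seq_minus'; [apply is_lim_seq_const|].
  apply is_lim_seq_incr_1. apply (is_lim_seq_ext (sum_n b)).
  - intros n. apply bsum_sum_n.
  - now apply Series_correct. }
apply is_lim_seq_spec in Hl. destruct (Hl (mkposreal eps He)) as [N0 HN0]. exists N0.
intros N v HN Hv. specialize (HN0 N HN).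
change (Rabs (Series b - bsum b N - 0) < eps) in HN0.
rewrite (Series_bsum_tail b N) in HN0 by auto.
replace (bsum b N + Series (fun i => b (N + i)%nat) - bsum b N - 0)
  with (Series (fun i => b (N + i)%nat)) in HN0 by ring.
rewrite (theta_tail_split N v).
set (r := fun k => exp (- (PI * exp v) * INR (S (N + k)) ^ 2)).
replace (theta_partial N v + Series r - theta_partial N v) with (Series r) by ring.
assert (Hle : forall k, 0 <= r k <= b (N + k)%nat).
{ intros k. split; [apply Rlt_le, exp_pos|]. apply exp_le.
  assert (H1 : exp (- T) <= exp v) by (now apply exp_le).
  assert (H2 := PI_RGT_0). assert (H3 := pow2_ge_0 (INR (S (N + k)))).
  assert (H4 : c <= PI * exp v) by (unfold c; nra). nra. }
assert (HbN : ex_series (fun i => b (N + i)%nat)) by now apply ex_series_incr_n.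
split.
- rewrite <- (Rmult_0_l (Series r)), <- Series_scal_l. apply Series_le.
  + intros k. rewrite Rmult_0_l. split; [lra|apply Hle].
  + apply (ex_series_Rabs_le _ (fun i => b (N + i)%nat)); auto.
    intros k. rewrite Rabs_pos_eq; apply Hle.
- assert (H := Series_le r _ Hle HbN). assert (H' := Rle_abs (Series (fun i => b (N + i)%nat))). lra.
Qed.

Lemma theta_partial_cont (N : nat) (v : R) : continuous (theta_partial N) v.
Proof.
unfold theta_partial. induction N; simpl.
- apply continuous_const.
- apply (continuous_plus (V := R_NormedModule)); auto.
  apply (ex_derive_continuous (V := R_NormedModule)). auto_derive. auto.
Qed.

Lemma theta_partial_bound (N : nat) (v : R) : 0 <= theta_partial N v <= theta_tail v.
Proof.
split.
- unfold theta_partial. induction N; simpl; [lra|].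
  apply Rplus_le_le_0_compat; auto. apply Rlt_le, exp_pos.
- rewrite (theta_tail_split N v).
  assert (H : 0 <= Series (fun k => exp (- (PI * exp v) * INR (S (N + k)) ^ 2))).
  { set (r := fun k => exp (- (PI * exp v) * INR (S (N + k)) ^ 2)).
    rewrite <- (Rmult_0_l (Series r)), <- Series_scal_l. apply Series_le.
    - intros k. rewrite Rmult_0_l. split; [lra|apply Rlt_le, exp_pos].
    - apply (ex_series_incr_n (fun k => exp (- (PI * exp v) * INR (S k) ^ 2)) N).
      apply ex_series_gauss, theta_rate_pos. }
  lra.
Qed.

Lemma theta_tail_cont (v : R) : continuous theta_tail v.
Proof.
apply filterlim_locally. intros eps.
assert (He : 0 < eps / 3) by (assert (H := cond_pos eps); lra).
(* The approximation is uniform to the right of v - 1, hence on the unit neighbourhood of v. *)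
destruct (theta_partial_approx (1 - v) (eps / 3) He) as [N HN].
destruct (proj1 (filterlim_locally _ _) (theta_partial_cont N v) (mkposreal _ He)) as [d Hd].
exists (mkposreal (Rmin 1 d) (Rmin_stable_in_posreal (mkposreal 1 Rlt_0_1) d)).
intros w Hw. change (Rabs (w - v) < Rmin 1 d) in Hw.
change (Rabs (theta_tail w - theta_tail v) < eps).
assert (H1 := Rlt_le_trans _ _ _ Hw (Rmin_l _ _)).
assert (H2 := Rlt_le_trans _ _ _ Hw (Rmin_r _ _)).
specialize (Hd w H2). change (Rabs (theta_partial N w - theta_partial N v) < eps / 3) in Hd.
apply Rabs_lt_between in H1.
assert (H3 := HN N w (le_n N) ltac:(lra)). assert (H4 := HN N v (le_n N) ltac:(lra)).
apply Rabs_lt_between in Hd. apply Rabs_lt_between. lra.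
Qed.

(** The integrand left after the Mellin integral is folded at v = 0 by the theta reflection. Its
    invariance under z -> 1/2 - z is the functional equation s -> 1 - s. *)
Definition Xi_kernel (z : C) (v : R) : C :=
  (RtoC (theta_tail v) * (Cexp (z * RtoC v) + Cexp ((RtoC (1 / 2) - z) * RtoC v)))%C.

Definition Xi_kernel_deriv (z : C) (v : R) : C :=
  (RtoC (theta_tail v) * (RtoC v * (Cexp (z * RtoC v) - Cexp ((RtoC (1 / 2) - z) * RtoC v))))%C.

Lemma Xi_kernel_cont (z : C) (v : R) : Rcont (Xi_kernel z) v.
Proof.
apply Rcont_mult; [apply Rcont_RtoC, theta_tail_cont|].
apply Rcont_plus; apply Rcont_Cexp.
Qed.

Lemma Xi_kernel_deriv_cont (z : C) (v : R) : Rcont (Xi_kernel_deriv z) v.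
Proof.
apply Rcont_mult; [apply Rcont_RtoC, theta_tail_cont|].
apply Rcont_mult; [apply Rcont_RtoC; apply continuous_id|].
apply (continuous_minus (V := C_R_NormedModule)); apply Rcont_Cexp.
Qed.

Lemma Cexp_line_bound (z : C) (v : R) : 0 <= v ->
  Cmod (Cexp (z * RtoC v)) <= exp ((Rabs (Re z) + 1) * v) /\
  Cmod (Cexp ((RtoC (1 / 2) - z) * RtoC v)) <= exp ((Rabs (Re z) + 1) * v).
Proof.
intros Hv. rewrite !Cmod_Cexp. destruct z as [a b]. simpl.
assert (H1 := Rle_abs a). assert (H2 := Rle_abs (- a)). rewrite Rabs_Ropp in H2.
split; apply exp_le; nra.
Qed.

Lemma Cmod_RtoC_pos (x : R) : 0 <= x -> Cmod (RtoC x) = x.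
Proof. intros H. rewrite Cmod_R. now apply Rabs_pos_eq. Qed.

Lemma is_HInt_Xi_kernel (z : C) : is_HInt (Xi_kernel z) (HInt (Xi_kernel z)).
Proof.
(* One more than the growth rate |Re z| + 1 of the exponentials, which leaves the decay exp(-v). *)
destruct (theta_tail_decay (Rabs (Re z) + 2)) as [C [HC H]].
{ assert (H := Rabs_pos (Re z)). lra. }
apply (is_HInt_decay _ (2 * C) 1); [apply Xi_kernel_cont|lra|].
intros v Hv. specialize (H v Hv). destruct (Cexp_line_bound z v Hv) as [H1 H2].
unfold Xi_kernel. rewrite Cmod_mult, Cmod_RtoC_pos by apply theta_tail_pos.
assert (H3 := Cmod_triangle (Cexp (z * RtoC v)) (Cexp ((RtoC (1 / 2) - z) * RtoC v))).
assert (E : exp (- (Rabs (Re z) + 2) * v) * exp ((Rabs (Re z) + 1) * v) = exp (- (1) * v))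
  by (rewrite <- exp_plus; f_equal; ring).
rewrite <- E.
apply Rle_trans with (C * exp (- (Rabs (Re z) + 2) * v) * (2 * exp ((Rabs (Re z) + 1) * v))).
- apply Rmult_le_compat; auto; [apply theta_tail_pos|apply Cmod_ge_0|lra].
- apply Req_le. ring.
Qed.

Lemma is_HInt_Xi_kernel_deriv (z : C) :
  is_HInt (Xi_kernel_deriv z) (HInt (Xi_kernel_deriv z)).
Proof.
destruct (theta_tail_decay (Rabs (Re z) + 3)) as [C [HC H]].
{ assert (H := Rabs_pos (Re z)). lra. }
apply (is_HInt_decay _ (2 * C) 1); [apply Xi_kernel_deriv_cont|lra|].
intros v Hv. specialize (H v Hv). destruct (Cexp_line_bound z v Hv) as [H1 H2].
unfold Xi_kernel_deriv. rewrite !Cmod_mult, !Cmod_RtoC_pos by (auto; apply theta_tail_pos).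
assert (H3 := Cmod_triangle (Cexp (z * RtoC v)) (- Cexp ((RtoC (1 / 2) - z) * RtoC v))).
rewrite Cmod_opp in H3. fold (Cexp (z * RtoC v) - Cexp ((RtoC (1 / 2) - z) * RtoC v))%C in H3.
assert (Hve : v <= exp v) by (assert (H4 := exp_ineq1_le v); lra).
assert (E : exp (- (Rabs (Re z) + 3) * v) * (exp v * exp ((Rabs (Re z) + 1) * v)) = exp (- (1) * v))
  by (rewrite <- !exp_plus; f_equal; ring).
rewrite <- E.
apply Rle_trans with (C * exp (- (Rabs (Re z) + 3) * v) * (exp v * (2 * exp ((Rabs (Re z) + 1) * v)))).
- apply Rmult_le_compat; auto; [apply theta_tail_pos| |].
  + apply Rmult_le_pos; auto. apply Cmod_ge_0.
  + apply Rmult_le_compat; auto; [apply Cmod_ge_0|lra].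
- apply Req_le. ring.
Qed.

(** Differentiation under the integral sign: the second-order estimate of the exponential bounds the
    integrand of the error by 4 C |h|^2 exp(-v). *)
Lemma is_Cderive_Xi_integral (z : C) :
  is_Cderive (fun z => HInt (Xi_kernel z)) z (HInt (Xi_kernel_deriv z)).
Proof.
set (A := Rabs (Re z)). assert (HA : 0 <= A) by apply Rabs_pos.
(* The exponentials use A + 1 of this rate and the factor v^2 exp(|h| v), with |h| < 1, uses 3; the
   decay exp(-v) remains. *)
destruct (theta_tail_decay (A + 5) ltac:(lra)) as [C [HC H]].
apply is_Cderive_eps. intros eps Heps.
exists (Rmin 1 (eps / (4 * C + 1))). split.
{ apply Rmin_glb_lt; [lra|]. apply Rdiv_lt_0_compat; lra. }
intros h Hh.
assert (Hh1 := Rlt_le_trans _ _ _ Hh (Rmin_l _ _)).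
assert (Hh2 := Rlt_le_trans _ _ _ Hh (Rmin_r _ _)).
apply Rlt_div_r in Hh2; [|lra]. assert (Hh0 := Cmod_ge_0 h).
assert (HI := is_HInt_plus _ _ _ _ (is_HInt_plus _ _ _ _ (is_HInt_Xi_kernel (z + h))
  (is_HInt_scal _ (- (1))%C _ (is_HInt_Xi_kernel z)))
  (is_HInt_scal _ (- h)%C _ (is_HInt_Xi_kernel_deriv z))).
assert (Hb := is_HInt_norm _ _ (4 * C * Cmod h ^ 2) 1 HI Rlt_0_1).
replace (HInt (Xi_kernel (z + h)) - HInt (Xi_kernel z) - h * HInt (Xi_kernel_deriv z))%C
  with (HInt (Xi_kernel (z + h)) + - (1) * HInt (Xi_kernel z) + - h * HInt (Xi_kernel_deriv z))%C
  by ring.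
eapply Rle_trans; [apply Hb|].
2: { replace (4 * C * Cmod h ^ 2 / 1) with (4 * C * Cmod h * Cmod h) by field.
     apply Rmult_le_compat_r; lra. }
intros v Hv. specialize (H v Hv). destruct (Cexp_line_bound z v Hv) as [H1 H2]. fold A in H1, H2.
set (w := (h * RtoC v)%C).
assert (Hw : Cmod (Cexp w - 1 - w)%C <= 2 * Cmod h ^ 2 * exp (3 * v) /\
  Cmod (Cexp (- w) - 1 - - w)%C <= 2 * Cmod h ^ 2 * exp (3 * v)).
{ assert (Hg : forall u, Cmod u = Cmod w -> Cmod (Cexp u - 1 - u)%C <= 2 * Cmod h ^ 2 * exp (3 * v)).
  { intros u Hu. eapply Rle_trans; [apply Cexp_second_order|].
    assert (Hw1 : Cmod w = Cmod h * v) by (unfold w; rewrite Cmod_mult, Cmod_RtoC_pos; auto).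
    rewrite Hu, Hw1, Rmult_assoc. apply Rmult_le_compat_l; [lra|].
    replace (3 * v) with (v + v + v) by ring. rewrite !exp_plus.
    replace ((Cmod h * v) ^ 2) with (Cmod h ^ 2 * (v * v)) by ring. rewrite Rmult_assoc.
    apply Rmult_le_compat_l; [nra|].
    assert (Hve : v <= exp v) by (assert (H4 := exp_ineq1_le v); lra).
    apply Rmult_le_compat; [nra|apply Rlt_le, exp_pos|nra|].
    apply exp_le. eapply Rle_trans; [apply re_le_Cmod|]. rewrite Hu, Hw1. nra. }
  split; apply Hg; auto. apply Cmod_opp. }
destruct Hw as [Hw1 Hw2].
assert (E1 : Cexp ((z + h) * RtoC v) = (Cexp (z * RtoC v) * Cexp w)%C).
{ rewrite <- Cexp_plus. f_equal. unfold w. ring. }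
assert (E2 : Cexp ((RtoC (1 / 2) - (z + h)) * RtoC v) = (Cexp ((RtoC (1 / 2) - z) * RtoC v) * Cexp (- w))%C).
{ rewrite <- Cexp_plus. f_equal. unfold w. ring. }
replace (Xi_kernel (z + h) v + - (1) * Xi_kernel z v + - h * Xi_kernel_deriv z v)%C
  with (RtoC (theta_tail v) * (Cexp (z * RtoC v) * (Cexp w - 1 - w)
    + Cexp ((RtoC (1 / 2) - z) * RtoC v) * (Cexp (- w) - 1 - - w)))%C.
2: { unfold Xi_kernel, Xi_kernel_deriv. rewrite E1, E2. unfold w. ring. }
rewrite Cmod_mult, Cmod_RtoC_pos by apply theta_tail_pos.
assert (E : exp (- (A + 5) * v) * (exp ((A + 1) * v) * exp (3 * v)) = exp (- (1) * v))
  by (rewrite <- !exp_plus; f_equal; ring).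
rewrite <- E.
apply Rle_trans with (C * exp (- (A + 5) * v) * (exp ((A + 1) * v) * (2 * Cmod h ^ 2 * exp (3 * v))
  + exp ((A + 1) * v) * (2 * Cmod h ^ 2 * exp (3 * v)))).
- apply Rmult_le_compat; auto; [apply theta_tail_pos|apply Cmod_ge_0|].
  eapply Rle_trans; [apply Cmod_triangle|]. rewrite !Cmod_mult.
  apply Rplus_le_compat; apply Rmult_le_compat; auto; apply Cmod_ge_0.
- apply Req_le. ring.
Qed.

(* Riemann's xi(s) = 1/2 + s (s - 1) / 2 * int_1^oo psi(x) (x^(s/2) + x^((1-s)/2)) dx/x,
   with z = s/2 and x = e^v. *)
Definition Xi_formula (s : C) : C :=
  (RtoC (1 / 2) + RtoC (1 / 2) * s * (s - 1) * HInt (Xi_kernel (s / 2)))%C.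

Lemma entire_Xi_formula : entire Xi_formula.
Proof.
assert (HG : entire (fun s => HInt (Xi_kernel (0 + / 2 * s)%C))).
{ apply (entire_comp (fun z => HInt (Xi_kernel z)) (fun s => 0 + / 2 * s)%C).
  - intros z. eexists. apply is_Cderive_Xi_integral.
  - apply entire_affine. }
apply (entire_ext (fun s => RtoC (1 / 2) + 1 * (((0 + RtoC (1 / 2) * s) * (- (1) + 1 * s))
  * HInt (Xi_kernel (0 + / 2 * s))))%C).
{ intros s. unfold Xi_formula. replace (s / 2)%C with (0 + / 2 * s)%C by (unfold Cdiv; ring). ring. }
apply (entire_comp (fun w => RtoC (1 / 2) + 1 * w)%C); [apply entire_affine|].
apply entire_mult; auto. apply entire_mult; apply entire_affine.
Qed.

Lemma HInt_real (f : R -> C) : (forall v, Rcont f v) ->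
  (forall v, Im (f v) = 0) -> Im (HInt f) = 0.
Proof.
intros Hf H. unfold HInt. simpl.
rewrite (Lim_seq_ext _ (fun _ => 0)); [now rewrite Lim_seq_const|].
intros n. assert (Hi := is_CInt_Im _ _ _ _ (CInt_cont f 0 (INR n) Hf)).
change (Im (CInt f 0 (INR n)) = 0).
rewrite <- (is_RInt_unique _ _ _ _ Hi).
rewrite (RInt_ext (V := R_CompleteNormedModule) _ (fun _ => 0)) by auto.
rewrite RInt_const. apply Rmult_0_r.
Qed.

(** On this line z = 1/4 + i t / 2 and 1/2 - z are conjugate, so the kernel is real, and s (s - 1) =
    -1/4 - t^2. *)
Lemma Xi_formula_critical_line (t : R) : Im (Xi_formula (1 / 2, t)) = 0.
Proof.
set (G := HInt (Xi_kernel (((1 / 2)%R, t) / 2)%C)).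
assert (HG : Im G = 0).
{ apply HInt_real; [apply Xi_kernel_cont|]. intros v. unfold Xi_kernel, Cexp. simpl.
  match goal with |- ?l = 0 => replace l with
    (theta_tail v * (exp (v / 4) * sin (t * v / 2) + exp (v / 4) * sin (- (t * v / 2)))) end.
  - rewrite sin_neg. ring.
  - rewrite !Rmult_0_l, Rplus_0_r. f_equal. f_equal; f_equal; f_equal; field. }
unfold Xi_formula. fold G. destruct G as [g1 g2]. simpl in *. rewrite HG. field.
Qed.

(** * The Mellin transform of theta *)

Lemma is_HInt_shift (f : R -> C) (c : R) (L : C) :
  is_HInt f L -> is_HInt (fun v => f (v + c)) (L - CInt f 0 c)%C.
Proof.
intros [Hf HL]. split.
- intros v. apply (continuous_ext (fun t => f (1 * t + c))).
  + intros t. now rewrite Rmult_1_l.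
  + apply Rcont_comp_affine. auto.
- intros eps He. destruct (HL eps He) as [T [HT H]].
  exists (Rmax 0 (T - c)). split; [apply Rmax_l|]. intros B HB.
  assert (HB' := Rle_trans _ _ _ (Rmax_r 0 (T - c)) HB).
  specialize (H (B + c) ltac:(lra)). rewrite CInt_shift by auto.
  rewrite (CInt_chasles f 0 c (B + c)) in H by auto. rewrite Rplus_0_l.
  replace (CInt f c (B + c)%R - (L - CInt f 0 c))%C with (CInt f 0 c + CInt f c (B + c)%R - L)%C by Cring.
  exact H.
Qed.

(** Integral over the whole line, each half converging separately. *)
Definition is_DInt (f : R -> C) (L : C) : Prop :=
  exists L1 L2 : C, is_HInt f L1 /\ is_HInt (fun v => f (- v)) L2 /\ L = (L1 + L2)%C.

Lemma is_DInt_plus (f g : R -> C) (L M : C) :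
  is_DInt f L -> is_DInt g M -> is_DInt (fun v => f v + g v)%C (L + M)%C.
Proof.
intros [L1 [L2 [H1 [H2 ->]]]] [M1 [M2 [H3 [H4 ->]]]].
exists (L1 + M1)%C, (L2 + M2)%C. split; [|split].
- now apply is_HInt_plus.
- now apply (is_HInt_plus (fun v => f (- v)) (fun v => g (- v))).
- ring.
Qed.

Lemma is_DInt_scal (f : R -> C) (c L : C) :
  is_DInt f L -> is_DInt (fun v => c * f v)%C (c * L)%C.
Proof.
intros [L1 [L2 [H1 [H2 ->]]]]. exists (c * L1)%C, (c * L2)%C. split; [|split].
- now apply is_HInt_scal.
- now apply (is_HInt_scal (fun v => f (- v))).
- ring.
Qed.

Lemma is_DInt_ext (f g : R -> C) (L : C) :
  (forall v, f v = g v) -> is_DInt f L -> is_DInt g L.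
Proof.
intros E [L1 [L2 [H1 [H2 ->]]]]. exists L1, L2. split; [|split; [|reflexivity]].
- now apply (is_HInt_ext f).
- now apply (is_HInt_ext (fun v => f (- v))).
Qed.

(** In x = e^v this is the invariance of dx / x under dilations. The piece that one half-line loses
    is gained by the other. *)
Lemma is_DInt_shift (f : R -> C) (c : R) (L : C) :
  is_DInt f L -> is_DInt (fun v => f (v + c)) L.
Proof.
intros [L1 [L2 [H1 [H2 ->]]]].
exists (L1 - CInt f 0 c)%C, (L2 - CInt (fun v => f (- v)%R) 0 (- c))%C. split; [|split].
- now apply is_HInt_shift.
- apply (is_HInt_ext (fun v => f (- (v + - c)))).
  + intros v. f_equal. ring.
  + now apply (is_HInt_shift (fun v => f (- v))).
- destruct H1 as [Hf _]. rewrite CInt_neg by auto. rewrite Ropp_involutive.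
  assert (E : (CInt f 0 c + CInt f c 0 = RtoC 0)%C).
  { rewrite <- CInt_chasles by auto. apply CInt_unique. apply (is_RInt_point (V := C_R_NormedModule)). }
  replace (L1 - CInt f 0 c + (L2 - CInt f c 0))%C with (L1 + L2 - (CInt f 0 c + CInt f c 0))%C by Cring.
  rewrite E. ring.
Qed.

Lemma is_DInt_unique (f : R -> C) (L M : C) : is_DInt f L -> is_DInt f M -> L = M.
Proof.
intros [L1 [L2 [H1 [H2 ->]]]] [M1 [M2 [H3 [H4 ->]]]].
now rewrite (is_HInt_unique _ _ _ H1 H3), (is_HInt_unique _ _ _ H2 H4).
Qed.

Lemma HInt_dominated (f : nat -> R -> C) (g : R -> C) (L : nat -> C) (M : C) (K al : R) :
  0 < al -> (forall N, is_HInt (f N) (L N)) -> is_HInt g M ->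
  (forall N v, 0 <= v -> Cmod (f N v) <= K * exp (- al * v)) ->
  (forall v, 0 <= v -> Cmod (g v) <= K * exp (- al * v)) ->
  (forall T eps, 0 <= T -> 0 < eps -> exists N0, forall N v, (N0 <= N)%nat -> 0 <= v <= T ->
     Cmod (f N v - g v)%C <= eps) ->
  forall eps, 0 < eps -> exists N0, forall N, (N0 <= N)%nat -> Cmod (L N - M)%C < eps.
Proof.
intros Hal HL HM HfK HgK Hu eps He.
assert (HK0 : 0 <= K).
{ specialize (HgK 0 (Rle_refl 0)). rewrite Rmult_0_r, exp_0 in HgK.
  assert (H := Cmod_ge_0 (g 0)). lra. }
destruct (exp_decay_small (K / al) al (eps / 3) Hal) as [T [HT0 HT]]; [|lra|].
{ apply Rdiv_le_0_compat; lra. }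
specialize (HT T (Rle_refl T)).
(* Over [0, T] this tolerance integrates to less than eps / 3; the two tails beyond T account for
   the rest. *)
destruct (Hu T (eps / (4 * (T + 1))) HT0 ltac:(apply Rdiv_lt_0_compat; lra)) as [N0 HN0].
exists N0. intros N HN.
assert (H1 := is_HInt_bound _ _ K al T (HL N) Hal HT0 (HfK N)).
assert (H2 := is_HInt_bound _ _ K al T HM Hal HT0 HgK).
assert (H3 : Cmod (CInt (f N) 0 T - CInt g 0 T)%C <= (T - 0) * (eps / (4 * (T + 1)))).
{ apply (is_CInt_bound_cst (fun v => f N v - g v)%C); auto.
  apply is_CInt_minus; apply CInt_cont; [apply HL|apply HM]. }
assert (H4 : (T - 0) * (eps / (4 * (T + 1))) < eps / 3).
{ replace ((T - 0) * (eps / (4 * (T + 1)))) with (eps * T / (4 * (T + 1))) by (field; lra).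
  apply Rlt_div_l; nra. }
replace (L N - M)%C with (- (CInt (f N) 0 T - L N) + (CInt g 0 T - M)
  + (CInt (f N) 0 T - CInt g 0 T))%C by Cring.
eapply Rle_lt_trans; [apply Cmod_triangle|].
eapply Rle_lt_trans; [apply Rplus_le_compat_r, Cmod_triangle|].
rewrite Cmod_opp. lra.
Qed.

(* [exp (z v) exp (- exp v)] is Euler's integrand in the variable v = ln x. *)
Definition Euler_log (z : C) (v : R) : C := (Cexp (z * RtoC v) * RtoC (exp (- exp v)))%C.

Lemma Euler_log_cont (z : C) (v : R) : Rcont (Euler_log z) v.
Proof.
apply Rcont_mult; [apply Rcont_Cexp|]. apply Rcont_RtoC.
apply (ex_derive_continuous (V := R_NormedModule)). auto_derive. auto.
Qed.

Lemma Re_mult_R (z : C) (v : R) : Re (z * RtoC v)%C = Re z * v.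
Proof. destruct z; simpl; ring. Qed.

Lemma Euler_log_neg_cont (z : C) (v : R) : Rcont (fun v => Euler_log z (- v)) v.
Proof.
apply (continuous_ext (fun t => Euler_log z (-1 * t + 0))).
- intros t. f_equal. ring.
- apply Rcont_comp_affine, Euler_log_cont.
Qed.

Lemma is_HInt_Euler_log (z : C) : 0 < Re z -> is_HInt (Euler_log z) (HInt (Euler_log z)).
Proof.
intros Hz. set (K := Re z + 1).
apply (is_HInt_decay _ (exp (- (K * (1 - ln K)))) 1); [apply Euler_log_cont|lra|].
intros v Hv. unfold Euler_log.
rewrite Cmod_mult, Cmod_Cexp, Re_mult_R, Cmod_RtoC_pos by apply Rlt_le, exp_pos.
assert (H := exp_exp_decay K v ltac:(unfold K; lra)).
replace (exp (- (1) * v)) with (exp (Re z * v) * exp (- K * v))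
  by (rewrite <- exp_plus; f_equal; unfold K; ring).
replace (exp (- (K * (1 - ln K))) * (exp (Re z * v) * exp (- K * v)))
  with (exp (Re z * v) * (exp (- (K * (1 - ln K))) * exp (- K * v))) by ring.
apply Rmult_le_compat_l; auto. apply Rlt_le, exp_pos.
Qed.

Lemma is_HInt_Euler_log_neg (z : C) : 0 < Re z ->
  is_HInt (fun v => Euler_log z (- v)) (HInt (fun v => Euler_log z (- v))).
Proof.
intros Hz.
apply (is_HInt_decay _ 1 (Re z)); [apply Euler_log_neg_cont|lra|].
intros v Hv. unfold Euler_log.
rewrite Cmod_mult, Cmod_Cexp, Re_mult_R, Cmod_RtoC_pos by apply Rlt_le, exp_pos.
replace (Re z * - v) with (- Re z * v) by ring. rewrite Rmult_comm.
apply Rmult_le_compat_r; [apply Rlt_le, exp_pos|].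
rewrite <- exp_0. apply exp_le. assert (H := exp_pos (- v)). lra.
Qed.

Lemma Euler_integrand_cont (w : C) (x : R) : 0 < x ->
  Rcont (fun x => (Rcpower x w * RtoC (exp (- x)))%C) x.
Proof.
intros Hx. apply Rcont_mult.
- destruct w as [a b]. apply Rcont_pair; simpl;
    apply (ex_derive_continuous (V := R_NormedModule)); auto_derive; auto.
- apply Rcont_RtoC. apply (ex_derive_continuous (V := R_NormedModule)). auto_derive. auto.
Qed.

(** The substitution x = e^v turns x^(z - 1) dx into e^(z v) dv. *)
Lemma is_CInt_Euler_integrand (z : C) (a b : R) : 0 < a -> 0 < b ->
  is_CInt (fun x => (Rcpower x (z - 1) * RtoC (exp (- x)))%C) a b
    (CInt (Euler_log z) (ln a) (ln b)).
Proof.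
intros Ha Hb. set (f := fun x : R => (Rcpower x (z - 1) * RtoC (exp (- x)))%C).
assert (E : CInt (Euler_log z) (ln a) (ln b) = CInt f a b).
{ rewrite <- (exp_ln a) at 2 by auto. rewrite <- (exp_ln b) at 2 by auto.
  rewrite <- (RInt_comp (V := C_R_CompleteNormedModule) f exp exp).
  - apply (RInt_ext (V := C_R_CompleteNormedModule)). intros v _.
    unfold f, Rcpower, Euler_log. rewrite ln_exp.
    replace (z * RtoC v)%C with ((z - 1) * RtoC v + RtoC v)%C by ring.
    rewrite Cexp_plus, Cexp_R.
    destruct (Cexp ((z - 1) * RtoC v)) as [p q].
    apply injective_projections; unfold scal; simpl; unfold prod_scal, scal; simpl;
      unfold mult; simpl; ring.
  - intros v _. apply Euler_integrand_cont, exp_pos.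
  - intros v _. split; [auto_derive; auto; ring|].
    apply (ex_derive_continuous (V := R_NormedModule)). auto_derive. auto. }
rewrite E. apply CInt_continuous. intros x Hx. apply Euler_integrand_cont.
assert (H : 0 < Rmin a b) by (now apply Rmin_glb_lt). lra.
Qed.

Lemma is_DInt_Gamma (z : C) : 0 < Re z -> is_DInt (Euler_log z) (Gamma z).
Proof.
intros Hz.
assert (H1 := is_HInt_Euler_log z Hz). assert (H2 := is_HInt_Euler_log_neg z Hz).
set (L1 := HInt (Euler_log z)) in *. set (L2 := HInt (fun v => Euler_log z (- v))) in *.
exists L1, L2. split; [auto|split; auto].
unfold Gamma.
apply (is_RInt_gen_unique (V := C_R_CompleteNormedModule)).
intros P [eps HP].
destruct H1 as [_ H1]. destruct H2 as [_ H2].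
destruct (H1 (eps / 2) ltac:(assert (H := cond_pos eps); lra)) as [T1 [HT1 K1]].
destruct (H2 (eps / 2) ltac:(assert (H := cond_pos eps); lra)) as [T2 [HT2 K2]].
apply (Filter_prod _ _ _ (fun a => 0 < a < exp (- T2)) (fun b => exp T1 < b)).
- exists (mkposreal _ (exp_pos (- T2))). intros a Ha Ha0. split; auto.
  change (Rabs (a - 0) < exp (- T2)) in Ha. rewrite Rminus_0_r, Rabs_pos_eq in Ha; lra.
- exists (exp T1). auto.
- intros a b Ha Hb. simpl. assert (Hb0 := exp_pos T1).
  exists (CInt (Euler_log z) (ln a) (ln b)). split.
  + apply is_CInt_Euler_integrand; lra.
  + apply HP. apply C_NormedModule_mixin_compat1.
    change (Cmod (CInt (Euler_log z) (ln a) (ln b) - (L1 + L2))%C < eps).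
    rewrite (CInt_chasles _ (ln a) 0 (ln b)) by apply Euler_log_cont.
    assert (Ea : CInt (Euler_log z) (ln a) 0 = CInt (fun v => Euler_log z (- v)) 0 (- ln a)).
    { rewrite CInt_neg by apply Euler_log_cont. now rewrite Ropp_involutive. }
    rewrite Ea.
    assert (Hlb : T1 <= ln b) by (rewrite <- (ln_exp T1); apply Rlt_le, ln_increasing; auto).
    assert (Hla : T2 <= - ln a).
    { assert (H : ln a < ln (exp (- T2))) by (apply ln_increasing; lra). rewrite ln_exp in H. lra. }
    specialize (K1 _ Hlb). specialize (K2 _ Hla).
    replace (CInt (fun v => Euler_log z (- v)%R) 0 (- ln a) + CInt (Euler_log z) 0 (ln b) - (L1 + L2))%C
      with ((CInt (fun v => Euler_log z (- v)%R) 0 (- ln a) - L2) + (CInt (Euler_log z) 0 (ln b) - L1))%C by Cring.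
    eapply Rle_lt_trans; [apply Cmod_triangle|]. lra.
Qed.

(** * Termwise Mellin transform and the Dirichlet series *)

Definition zeta_partial (s : C) (N : nat) : C :=
  (bsum (fun n => Re (Rcpower (INR (S n)) (- s))) N,
   bsum (fun n => Im (Rcpower (INR (S n)) (- s))) N).

Lemma zeta_partial_S (s : C) (N : nat) :
  zeta_partial s (S N) = (zeta_partial s N + Rcpower (INR (S N)) (- s))%C.
Proof. unfold zeta_partial, Cplus. simpl. reflexivity. Qed.

(** The n-th term of theta is Euler's integrand translated by c = ln(pi n^2) and multiplied by
    exp(-z c) = pi^(-z) n^(-2z). *)
Lemma is_DInt_theta_partial (z : C) (N : nat) : 0 < Re z ->
  is_DInt (fun v => Cexp (z * RtoC v) * RtoC (theta_partial N v))%C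
    (Rcpower PI (- z) * Gamma z * zeta_partial (2 * z) N)%C.
Proof.
intros Hz. assert (HG := is_DInt_Gamma z Hz).
induction N.
- apply (is_DInt_ext (fun v => 0 * Euler_log z v)%C).
  + intros v. unfold theta_partial. simpl. ring.
  + replace (Rcpower PI (- z) * Gamma z * zeta_partial (2 * z) 0)%C with (0 * Gamma z)%C.
    * now apply is_DInt_scal.
    * unfold zeta_partial. simpl. change ((0, 0) : C) with (RtoC 0). ring.
- set (c := ln PI + 2 * ln (INR (S N))).
  assert (HN : 0 < INR (S N)) by (apply lt_0_INR; lia).
  apply (is_DInt_ext (fun v => Cexp (z * RtoC v) * RtoC (theta_partial N v)
    + Cexp (- z * RtoC c) * Euler_log z (v + c)%R)%C).
  + intros v. unfold theta_partial. cbn [bsum]. rewrite RtoC_plus. unfold Euler_log.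
    replace (exp (v + c)) with (PI * exp v * INR (S N) ^ 2).
    2: { unfold c. replace (v + (ln PI + 2 * ln (INR (S N))))
           with (ln PI + v + ln (INR (S N)) + ln (INR (S N))) by ring.
         rewrite !exp_plus, !exp_ln by (auto; apply PI_RGT_0). ring. }
    replace (- (PI * exp v) * INR (S N) ^ 2) with (- (PI * exp v * INR (S N) ^ 2)) by ring.
    rewrite Cmult_assoc, <- Cexp_plus, RtoC_plus.
    replace (- z * RtoC c + z * (RtoC v + RtoC c))%C with (z * RtoC v)%C by ring. ring.
  + rewrite zeta_partial_S.
    replace (Rcpower PI (- z) * Gamma z * (zeta_partial (2 * z) N + Rcpower (INR (S N)) (- (2 * z))))%C
      with (Rcpower PI (- z) * Gamma z * zeta_partial (2 * z) N
        + (Rcpower PI (- z) * Rcpower (INR (S N)) (- (2 * z))) * Gamma z)%C by ring.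
    apply is_DInt_plus; auto.
    replace (Rcpower PI (- z) * Rcpower (INR (S N)) (- (2 * z)))%C with (Cexp (- z * RtoC c)).
    * apply is_DInt_scal. now apply is_DInt_shift.
    * unfold Rcpower. rewrite <- Cexp_plus. f_equal. unfold c.
      rewrite RtoC_plus, RtoC_mult. ring.
Qed.

(** The function u stands for the theta tail and for all its partial sums, so one majorant serves
    every limit. The rate Re z - 1/2 is dictated by the growth e^(v/2) on the negative side. *)
Lemma theta_Mellin_bound (z : C) : 1 / 2 < Re z -> exists K al, 0 < al /\
  forall u : R -> R, (forall v, 0 <= u v <= theta_tail v) -> forall v, 0 <= v ->
    Cmod (Cexp (z * RtoC v) * RtoC (u v))%C <= K * exp (- al * v) /\
    Cmod (Cexp (z * RtoC (- v)) * RtoC (u (- v)%R))%C <= K * exp (- al * v).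
Proof.
intros Hz. set (al := Re z - 1 / 2). assert (Hal : 0 < al) by (unfold al; lra).
destruct (theta_tail_decay (Re z + al)) as [C1 [HC1 H1]]; [lra|].
destruct theta_tail_growth as [C2 [HC2 H2]].
exists (C1 + C2), al. split; auto. intros u Hu v Hv.
rewrite !Cmod_mult, !Cmod_Cexp, !Re_mult_R, !Cmod_RtoC_pos by apply Hu.
specialize (H1 v Hv). specialize (H2 v Hv).
assert (Hu1 := Hu v). assert (Hu2 := Hu (- v)).
assert (He := exp_pos (- al * v)).
assert (E1 := exp_pos (Re z * v)). assert (E2 := exp_pos (Re z * - v)). split.
- apply Rle_trans with (exp (Re z * v) * (C1 * exp (- (Re z + al) * v))).
  + apply Rmult_le_compat_l; lra.
  + replace (exp (Re z * v) * (C1 * exp (- (Re z + al) * v)))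
      with (C1 * (exp (Re z * v) * exp (- (Re z + al) * v))) by ring.
    rewrite <- exp_plus. replace (Re z * v + - (Re z + al) * v) with (- al * v) by ring. nra.
- apply Rle_trans with (exp (Re z * - v) * (C2 * exp (v / 2))).
  + apply Rmult_le_compat_l; lra.
  + replace (exp (Re z * - v) * (C2 * exp (v / 2)))
      with (C2 * (exp (Re z * - v) * exp (v / 2))) by ring.
    rewrite <- exp_plus. replace (Re z * - v + v / 2) with (- al * v) by (unfold al; field). nra.
Qed.

Lemma theta_Mellin_cont (z : C) (u : R -> R) (v : R) : (forall v, continuous u v) ->
  Rcont (fun v => Cexp (z * RtoC v) * RtoC (u v))%C v /\
  Rcont (fun v => Cexp (z * RtoC (- v)) * RtoC (u (- v)%R))%C v.
Proof.
intros Hu. assert (H : forall v, Rcont (fun v => Cexp (z * RtoC v) * RtoC (u v))%C v).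
{ intros w. apply Rcont_mult; [apply Rcont_Cexp|now apply Rcont_RtoC]. }
split; auto.
apply (continuous_ext (fun t => (fun v => Cexp (z * RtoC v) * RtoC (u v))%C (-1 * t + 0))).
- intros t. cbv beta. now replace (-1 * t + 0) with (- t) by ring.
- apply (Rcont_comp_affine (fun v => Cexp (z * RtoC v) * RtoC (u v))%C (-1) 0 v). apply H.
Qed.

(** The exchange of sum and integral. The limit is stated on partial sums, so that convergence of
    the Dirichlet series can be supplied separately. *)
Lemma Mellin_theta_limit (z : C) : 1 / 2 < Re z -> exists M,
  is_DInt (fun v => Cexp (z * RtoC v) * RtoC (theta_tail v))%C M /\
  forall eps, 0 < eps -> exists N0, forall N, (N0 <= N)%nat ->
    Cmod (Rcpower PI (- z) * Gamma z * zeta_partial (2 * z) N - M)%C < eps.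
Proof.
intros Hz. destruct (theta_Mellin_bound z Hz) as [K [al [Hal HB]]].
assert (Ht : forall v, 0 <= theta_tail v <= theta_tail v)
  by (intros; split; [apply theta_tail_pos|lra]).
set (f := fun v => (Cexp (z * RtoC v) * RtoC (theta_tail v))%C).
set (fN := fun N v => (Cexp (z * RtoC v) * RtoC (theta_partial N v))%C).
assert (H1 : is_HInt f (HInt f)).
{ apply (is_HInt_decay f K al); auto.
  - intros v. apply (proj1 (theta_Mellin_cont z theta_tail v theta_tail_cont)).
  - intros v Hv. apply (HB _ Ht v Hv). }
assert (H2 : is_HInt (fun v => f (- v)) (HInt (fun v => f (- v)))).
{ apply (is_HInt_decay _ K al); auto.
  - intros v. apply (proj2 (theta_Mellin_cont z theta_tail v theta_tail_cont)).
  - intros v Hv. apply (HB _ Ht v Hv). }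
exists (HInt f + HInt (fun v => f (- v)%R))%C. split.
{ exists (HInt f), (HInt (fun v => f (- v))). split; [exact H1|split; [exact H2|reflexivity]]. }
assert (HN1 : forall N, is_HInt (fN N) (HInt (fN N))).
{ intros N. apply (is_HInt_decay _ K al); auto.
  - intros v. apply (proj1 (theta_Mellin_cont z _ v (theta_partial_cont N))).
  - intros v Hv. apply (HB _ (theta_partial_bound N) v Hv). }
assert (HN2 : forall N, is_HInt (fun v => fN N (- v)) (HInt (fun v => fN N (- v)))).
{ intros N. apply (is_HInt_decay _ K al); auto.
  - intros v. apply (proj2 (theta_Mellin_cont z _ v (theta_partial_cont N))).
  - intros v Hv. apply (HB _ (theta_partial_bound N) v Hv). }
assert (Hunif : forall T eps, 0 <= T -> 0 < eps -> exists N0, forall N v, (N0 <= N)%nat ->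
  - T <= v <= T -> Cmod (fN N v - f v)%C <= eps).
{ intros T eps HT He.
  destruct (theta_partial_approx T (eps / exp (Re z * T))) as [N0 HN0].
  { apply Rdiv_lt_0_compat; auto. apply exp_pos. }
  exists N0. intros N v HN Hv. specialize (HN0 N v HN ltac:(lra)).
  replace (fN N v - f v)%C with (- (Cexp (z * RtoC v) * RtoC (theta_tail v - theta_partial N v)))%C
    by (unfold fN, f; rewrite RtoC_minus; ring).
  rewrite Cmod_opp, Cmod_mult, Cmod_Cexp, Re_mult_R, Cmod_RtoC_pos by lra.
  replace eps with (exp (Re z * T) * (eps / exp (Re z * T)))
    by (field; apply Rgt_not_eq, exp_pos).
  apply Rmult_le_compat; try lra; [apply Rlt_le, exp_pos|]. apply exp_le. nra. }
intros eps He.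
destruct (HInt_dominated fN f (fun N => HInt (fN N)) (HInt f) K al Hal HN1 H1) with (eps := eps / 2)
  as [N1 K1]; try lra.
{ intros N v Hv. apply (HB _ (theta_partial_bound N) v Hv). }
{ intros v Hv. apply (HB _ Ht v Hv). }
{ intros T e HT He'. destruct (Hunif T e HT He') as [N0 HN0]. exists N0.
  intros N v HN Hv. apply HN0; auto. lra. }
destruct (HInt_dominated (fun N v => fN N (- v)) (fun v => f (- v)) (fun N => HInt (fun v => fN N (- v)))
  (HInt (fun v => f (- v))) K al Hal HN2 H2) with (eps := eps / 2)
  as [N2 K2]; try lra.
{ intros N v Hv. apply (HB _ (theta_partial_bound N) v Hv). }
{ intros v Hv. apply (HB _ Ht v Hv). }
{ intros T e HT He'. destruct (Hunif T e HT He') as [N0 HN0]. exists N0.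
  intros N v HN Hv. apply HN0; auto. lra. }
exists (N1 + N2)%nat. intros N HN. specialize (K1 N ltac:(lia)). specialize (K2 N ltac:(lia)).
assert (E : (Rcpower PI (- z) * Gamma z * zeta_partial (2 * z) N = HInt (fN N) + HInt (fun v => fN N (- v)%R))%C).
{ apply (is_DInt_unique (fN N)).
  - apply is_DInt_theta_partial. lra.
  - exists (HInt (fN N)), (HInt (fun v => fN N (- v))).
    split; [apply HN1|split; [apply HN2|reflexivity]]. }
rewrite E.
replace (HInt (fN N) + HInt (fun v => fN N (- v)%R) - (HInt f + HInt (fun v => f (- v)%R)))%C
  with ((HInt (fN N) - HInt f) + (HInt (fun v => fN N (- v)%R) - HInt (fun v => f (- v)%R)))%C by Cring.
eapply Rle_lt_trans; [apply Cmod_triangle|]. lra.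
Qed.

(** Compared with the telescoping series of 2 / (n (n + 1)). *)
Lemma ex_series_inv_sqr : ex_series (fun n => / INR (S n) ^ 2).
Proof.
apply (ex_series_Rabs_le _ (fun n => 2 * (/ INR (S n) - / INR (S (S n))))).
- intros n. rewrite (S_INR (S n)). assert (H : 1 <= INR (S n)) by (rewrite S_INR; assert (H := pos_INR n); lra).
  set (x := INR (S n)) in *.
  rewrite Rabs_pos_eq by (apply Rlt_le, Rinv_0_lt_compat; nra).
  replace (2 * (/ x - / (x + 1))) with (2 / (x * (x + 1))) by (field; lra).
  replace (/ x ^ 2) with (1 / x ^ 2) by (field; lra).
  apply Rle_div_l; [nra|]. replace (2 / (x * (x + 1)) * x ^ 2) with (2 * x / (x + 1)) by (field; lra).
  apply Rle_div_r; lra.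
- apply (ex_series_scal_l (K := R_AbsRing) (V := R_NormedModule) 2).
  exists 1. change (is_lim_seq (sum_n (fun n => / INR (S n) - / INR (S (S n)))) 1).
  apply (is_lim_seq_ext (fun n => 1 - / INR (S (S n)))).
  + intros n. rewrite bsum_sum_n. induction n.
    * simpl. field.
    * cbn [bsum] in *. rewrite <- IHn. ring.
  + replace (Finite 1) with (Finite (1 - 0)) by (f_equal; ring).
    apply is_lim_seq_minus'; [apply is_lim_seq_const|].
    apply (is_lim_seq_incr_1 (fun n => / INR (S n))), (is_lim_seq_incr_1 (fun n => / INR n)).
    apply (is_lim_seq_inv INR p_infty); [apply is_lim_seq_INR|discriminate].
Qed.

Lemma Cmod_Rcpower_INR (s : C) (n : nat) : 2 <= Re s ->
  Cmod (Rcpower (INR (S n)) (- s)) <= / INR (S n) ^ 2.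
Proof.
intros Hs. unfold Rcpower. rewrite Cmod_Cexp, Re_mult_R.
assert (H : 1 <= INR (S n)) by (rewrite S_INR; assert (H := pos_INR n); lra).
assert (Hl : 0 <= ln (INR (S n))).
{ rewrite <- ln_1. destruct H as [H| <-]; [apply Rlt_le, ln_increasing; lra|lra]. }
replace (/ INR (S n) ^ 2) with (exp (- (ln (INR (S n)) + ln (INR (S n))))).
- apply exp_le. destruct s as [a b]. simpl in *. nra.
- rewrite exp_Ropp, exp_plus, !exp_ln by lra. f_equal. ring.
Qed.

Lemma zeta_partial_lim (s : C) : 2 <= Re s ->
  forall eps, 0 < eps -> exists N0, forall N, (N0 <= N)%nat ->
    Cmod (zeta_partial s N - zeta s)%C < eps.
Proof.
intros Hs eps He.
assert (HR : forall g : C -> R, (forall z, Rabs (g z) <= Cmod z) ->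
  is_lim_seq (fun N => bsum (fun n => g (Rcpower (INR (S n)) (- s))) N)
    (Series (fun n => g (Rcpower (INR (S n)) (- s))))).
{ intros g Hg. apply is_lim_seq_incr_1.
  apply (is_lim_seq_ext (sum_n (fun n => g (Rcpower (INR (S n)) (- s))))).
  - intros n. apply bsum_sum_n.
  - apply Series_correct. apply (ex_series_Rabs_le _ (fun n => / INR (S n) ^ 2)).
    + intros n. eapply Rle_trans; [apply Hg|]. now apply Cmod_Rcpower_INR.
    + apply ex_series_inv_sqr. }
assert (H1 := HR Re re_le_Cmod). assert (H2 := HR Im Im_le_Cmod).
apply is_lim_seq_spec in H1, H2. assert (He2 : 0 < eps / 2) by lra.
destruct (H1 (mkposreal _ He2)) as [N1 K1]. destruct (H2 (mkposreal _ He2)) as [N2 K2].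
exists (N1 + N2)%nat. intros N HN. specialize (K1 N ltac:(lia)). specialize (K2 N ltac:(lia)).
cbn [pos] in K1, K2.
eapply Rle_lt_trans; [apply Cmod_pair|].
apply Rlt_le_trans with (eps / 2 + eps / 2); [|lra].
apply Rplus_lt_compat; [exact K1|exact K2].
Qed.

(** On the negative half-line psi(e^(-v)) = e^(v/2) psi(e^v) + (e^(v/2) - 1) / 2. The first summand
    completes the kernel, the second integrates against e^(-z v) to the two polar terms. *)
Lemma Mellin_theta_value (z M : C) : 1 / 2 < Re z ->
  is_DInt (fun v => Cexp (z * RtoC v) * RtoC (theta_tail v))%C M ->
  M = (HInt (Xi_kernel z) + RtoC (1 / 2) * (/ (z - RtoC (1 / 2)) - / z))%C.
Proof.
intros Hz [L1 [L2 [H1 [H2 ->]]]].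
assert (H3 := is_HInt_Cexp (z - RtoC (1 / 2))%C ltac:(destruct z; simpl in *; lra)).
assert (H4 := is_HInt_Cexp z ltac:(lra)).
assert (H5 := is_HInt_plus _ _ _ _ (is_HInt_Xi_kernel z) (is_HInt_scal _ (RtoC (1 / 2)) _
  (is_HInt_plus _ _ _ _ H3 (is_HInt_scal _ (- (1))%C _ H4)))).
assert (H6 := is_HInt_plus _ _ _ _ H1 H2).
replace (/ (z - RtoC (1 / 2)) - / z)%C with (/ (z - RtoC (1 / 2)) + - (1) * / z)%C by ring.
refine (is_HInt_unique _ _ _ H6 (is_HInt_ext _ _ _ _ H5)).
intros v. cbv beta. unfold Xi_kernel.
assert (E : RtoC (theta_tail (- v)) = (Cexp (RtoC (1 / 2) * RtoC v) * RtoC (theta_tail v)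
  + RtoC (1 / 2) * (Cexp (RtoC (1 / 2) * RtoC v) - 1))%C).
{ rewrite <- RtoC_mult, Cexp_R. replace (1 / 2 * v) with (v / 2) by field.
  assert (T := theta_reflection v).
  replace (theta_tail (- v)) with (exp (v / 2) * theta_tail v + 1 / 2 * (exp (v / 2) - 1)) by lra.
  rewrite RtoC_plus, !RtoC_mult, RtoC_minus. reflexivity. }
rewrite E.
replace ((RtoC (1 / 2) - z) * RtoC v)%C with (z * RtoC (- v) + RtoC (1 / 2) * RtoC v)%C
  by (rewrite RtoC_opp; ring).
replace (- (z - RtoC (1 / 2)) * RtoC v)%C with (z * RtoC (- v) + RtoC (1 / 2) * RtoC v)%C
  by (rewrite RtoC_opp; ring).
replace (- z * RtoC v)%C with (z * RtoC (- v))%C by (rewrite RtoC_opp; ring).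
rewrite !Cexp_plus. ring.
Qed.

(** With z = s / 2 the polar terms amount to 1 / (s (s - 1)), so the factor s (s - 1) / 2 turns them
    into the constant 1/2 of [Xi_formula]. *)
Lemma completed_zeta_formula (Xi : C -> C) (s : C) : is_completed_zeta Xi -> 2 <= Re s ->
  Xi s = Xi_formula s.
Proof.
intros [_ HXi] Hs. rewrite HXi by lra.
set (z := (s / 2)%C).
assert (Es : s = (2 * z)%C) by (unfold z; field).
assert (Hz : Re z = Re s / 2) by (rewrite Es; destruct z; simpl; field).
destruct (Mellin_theta_limit z ltac:(lra)) as [M [HM Hlim]].
assert (E : (Rcpower PI (- z) * Gamma z * zeta s)%C = M).
{ set (A := (Rcpower PI (- z) * Gamma z)%C) in *. rewrite <- Es in Hlim.
  apply Cmod_eq. intros eps He. assert (HA := Cmod_ge_0 A).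
  destruct (Hlim (eps / 2) ltac:(lra)) as [N1 K1].
  destruct (zeta_partial_lim s Hs (eps / (2 * (1 + Cmod A)))) as [N2 K2].
  { apply Rdiv_lt_0_compat; lra. }
  specialize (K1 (N1 + N2)%nat ltac:(lia)). specialize (K2 (N1 + N2)%nat ltac:(lia)).
  set (P := zeta_partial s (N1 + N2)) in *.
  replace (A * zeta s - M)%C with ((A * P - M) + - (A * (P - zeta s)))%C by ring.
  eapply Rle_lt_trans; [apply Cmod_triangle|]. rewrite Cmod_opp, Cmod_mult.
  assert (H0 := Cmod_ge_0 (P - zeta s)%C).
  apply Rlt_div_r in K2; [|lra]. nra. }
replace (- s / 2)%C with (- z)%C by (unfold z; field).
replace (RtoC (1 / 2) * s * (s - 1) * Rcpower PI (- z) * Gamma z * zeta s)%C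
  with (RtoC (1 / 2) * s * (s - 1) * (Rcpower PI (- z) * Gamma z * zeta s))%C by ring.
rewrite E, (Mellin_theta_value z M) by (auto; lra).
unfold Xi_formula. fold z. rewrite Es.
assert (Hz0 : z <> 0) by (intros H; rewrite H in Hz; simpl in Hz; lra).
assert (Hz1 : (2 * z - 1)%C <> 0).
{ intros H. rewrite <- Es in H. assert (H' : Re (s - 1)%C = 0) by now rewrite H.
  destruct s; simpl in *; lra. }
replace (RtoC (1 / 2)) with (/ 2)%C by (rewrite RtoC_div by lra; unfold Cdiv; ring).
field. split; auto.
intros H. apply Hz1. rewrite <- H. ring.
Qed.

(** * Xi on the critical line and the failure of concavity *)

Lemma completed_zeta_real (Xi : C -> C) (t : R) : is_completed_zeta Xi -> Im (Xi ((1 / 2)%R, t)) = 0.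
Proof.
intros HXi. rewrite <- (Xi_formula_critical_line t).
assert (H : (Xi ((1 / 2)%R, t) + - (1) * Xi_formula ((1 / 2)%R, t))%C = 0).
(* The difference vanishes on Re s = 2; the half-height 2 exceeds the distance 3/2 to the critical
   line. *)
{ apply (entire_zero_segment (fun s => Xi s + - (1) * Xi_formula s)%C 2 (1 / 2) t 2); try lra.
  - apply entire_plus; [apply HXi|].
    apply (entire_ext (fun s => 0 + - (1) * Xi_formula s)%C); [intros; ring|].
    apply (entire_comp (fun w => 0 + - (1) * w)%C); [apply entire_affine|apply entire_Xi_formula].
  - intros u _. rewrite (completed_zeta_formula Xi) by (auto; simpl; lra). ring. }
f_equal. replace (Xi ((1 / 2)%R, t)) with (Xi ((1 / 2)%R, t) + - (1) * Xi_formula ((1 / 2)%R, t) + Xi_formula ((1 / 2)%R, t))%C by ring.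
rewrite H. ring.
Qed.

(** An increment i h keeps Xi real, so Im (i h l) = h Re l must be o(h) and l is imaginary. The
    value is 0 at zeros of Xi too, by the default value of the division. *)
Lemma re_log_deriv_critical_line (Xi : C -> C) (t : R) : is_completed_zeta Xi ->
  re_log_deriv Xi (1 / 2) t = 0.
Proof.
intros HXi. destruct (proj1 HXi ((1 / 2)%R, t)) as [l Hl].
unfold re_log_deriv. rewrite (is_C_derive_unique _ _ _ Hl).
assert (Hr : Re l = 0).
{ assert (He := proj1 (is_Cderive_eps Xi ((1 / 2)%R, t) l) Hl).
  destruct (Req_dec (Re l) 0) as [|Hne]; auto. exfalso.
  assert (Hp := Rabs_pos_lt _ Hne).
  destruct (He (Rabs (Re l) / 2) ltac:(lra)) as [d [Hd H]].
  assert (Hm : Cmod (Ci * RtoC (d / 2))%C = d / 2).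
  { rewrite Cmod_mult, Cmod_Ci, Cmod_R, Rabs_pos_eq; lra. }
  specialize (H (Ci * RtoC (d / 2))%C ltac:(lra)). rewrite Hm in H.
  assert (Hz : (((1 / 2)%R, t) + Ci * RtoC (d / 2))%C = ((1 / 2)%R, (t + d / 2)%R)).
  { unfold Cplus, Cmult, Ci, RtoC; simpl. f_equal; ring. }
  rewrite Hz in H. eapply Rle_trans in H; [|apply Im_le_Cmod].
  assert (E : Im (Xi ((1 / 2)%R, (t + d / 2)%R) - Xi ((1 / 2)%R, t) - Ci * RtoC (d / 2) * l)%C = - (d / 2 * Re l)).
  { assert (E1 := completed_zeta_real Xi t HXi). assert (E2 := completed_zeta_real Xi (t + d / 2) HXi).
    destruct (Xi ((1 / 2)%R, (t + d / 2)%R)), (Xi ((1 / 2)%R, t)), l. simpl in *. rewrite E1, E2. ring. }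
  rewrite E, Rabs_Ropp, Rabs_mult, (Rabs_pos_eq (d / 2)) in H by lra. nra. }
assert (Hi := completed_zeta_real Xi t HXi).
destruct (Xi ((1 / 2)%R, t)) as [x y], l as [a b]. simpl in *. rewrite Hr, Hi. unfold Rdiv. ring.
Qed.

Theorem corollary4p2 (Xi : C -> C) (HXi : is_completed_zeta Xi) :
  ~ (concavity_A Xi /\ (concavity_A Xi <-> Riemann_hypothesis Xi)).
Proof.
intros [HA HAR]. assert (HRH := proj1 HAR HA). destruct HA as [delta [T0 [Hdelta HA]]].
(* Leaves room for t1 within 1 of t0 and a radius r <= 1 around t1, all at heights at least |T0|. *)
set (t0 := Rabs T0 + 2). assert (HT0 := Rle_abs T0).
assert (Hne : exists t, t0 - 1 <= t <= t0 + 1 /\ Xi ((1 / 2)%R, t) <> 0).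
{ apply NNPP. intros Hno.
  assert (H : Xi (1 / 4, t0) = 0).
  (* Any abscissa left of 1/2 and nearer to it than the half-height 1 would do in place of 1/4. *)
  { apply (entire_zero_segment Xi (1 / 2) (1 / 4) t0 1); try lra; [apply HXi|].
    intros t Ht. apply NNPP. intros Ht0. apply Hno. exists t. auto. }
  apply HRH in H. simpl in H. lra. }
destruct Hne as [t1 [Ht1 Hne]].
destruct (entire_cont Xi ((1 / 2)%R, t1) (proj1 HXi) (Cmod (Xi ((1 / 2)%R, t1)))) as [d [Hd Hc]].
{ now apply Cmod_gt_0. }
set (r := Rmin d 1). assert (Hr : 0 < r) by (apply Rmin_glb_lt; lra).
assert (Hrd : r <= d) by apply Rmin_l. assert (Hr1 : r <= 1) by apply Rmin_r.
assert (Hconc := HA (1 / 2) ltac:(lra) (fun t => t1 - r < t < t1 + r)).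
assert (Habs : 0 <= Rabs T0) by apply Rabs_pos.
specialize (Hconc ltac:(intros x y w Hx Hw Hy; lra)).
assert (HI : forall t, t1 - r < t < t1 + r -> T0 <= Rabs t /\ Xi ((1 / 2)%R, t) <> 0).
{ intros t Ht. split.
  - eapply Rle_trans; [|apply Rle_abs]. unfold t0 in *. lra.
  - intros H0.
    assert (Hlt : Cmod (((1 / 2)%R, t) - ((1 / 2)%R, t1))%C < d).
    { replace (((1 / 2)%R, t) - ((1 / 2)%R, t1))%C with (Ci * RtoC (t - t1))%C
        by (unfold Cminus, Cplus, Cmult, Copp, Ci, RtoC; simpl; f_equal; ring).
      rewrite Cmod_mult, Cmod_Ci, Cmod_R, Rmult_1_l. apply Rabs_def1; lra. }
    specialize (Hc _ Hlt). rewrite H0 in Hc.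
    replace (0 - Xi ((1 / 2)%R, t1))%C with (- Xi ((1 / 2)%R, t1))%C in Hc by ring.
    rewrite Cmod_opp in Hc. lra. }
(* Strict concavity at the midpoint of two points of the interval reads 0 < 0. *)
specialize (Hconc HI (t1 - r / 2) (t1 + r / 2) (1 / 2)).
rewrite !re_log_deriv_critical_line in Hconc by auto.
assert (H := Hconc ltac:(lra) ltac:(lra) ltac:(lra) ltac:(lra)). lra.
Qed.
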